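(* Let $(\phi_t)$ be a one-parameter semigroup in $\mathbb D$ with infinitesimal generator $G$ and Kœnigs function $h$, and let $x\in\partial\mathbb D$. Suppose there is a Jordan domain $\Omega_0\subset h(\mathbb D)$ with $w_0:=h(x)\in\partial\Omega_0$ such that $h(\{sx:r\le s<1\})\subset\Omega_0$ for some $r\in(0,1)$ and $\partial\Omega_0$ has a Dini-smooth corner of opening $2\pi$ at $w_0$. Then $x$ is a regular pole of $G$.
   Context: One-parameter semigroup $(\phi_t)$ in $\mathbb D$: continuous homomorphism from $([0,\infty),+)$ to holomorphic self-maps of $\mathbb D$ under composition, none an automorphism for $t>0$; generator $G$ with $\partial_t\phi_t=G\circ\phi_t$; Denjoy–Wolff point $\tau=\lim_{t\to\infty}\phi_t$. Kœnigs function: the univalent $h$ with $h(\tau)=0,h'(\tau)=1,h\circ\phi_t=e^{G'(\tau)t}h$ if $\tau\in\mathbb D$, and $h(0)=0$, $h\circ\phi_t=h+t$ if $\tau\in\partial\mathbb D$; $h(x)$ is the angular limit at $x$. A point $x\in\partial\mathbb D$ is a regular pole of $G$ if $\angle\liminf_{z\to x}|G(z)(x-z)|\in(0,+\infty)$. A Jordan curve $\Gamma$ has a Dini-smooth corner of opening $\theta$ at $w_0\in\Gamma$ if: for small $\rho>0$, $\Gamma$ meets $\{|w-w_0|=\rho\}$ in exactly two points $\gamma^\pm(\rho)$ depending continuously on $\rho$; $\rho\mapsto\arg(\gamma^\pm(\rho)-w_0)$ extend continuously to $\rho=0$ with a modulus of continuity $\omega$ satisfying $\int_0^\epsilon\omega(t)/t\,dt<\infty$;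 and the interior angle between the one-sided tangents at $w_0$ (w.r.t. the Jordan domain bounded by $\Gamma$) equals $\theta$. *)

(* Defs.v *)
From Stdlib Require Import Reals Lra.
Open Scope R_scope.

Definition Cx : Type := (R * R)%type.
Definition Cre (z : Cx) : R := fst z.
Definition Cim (z : Cx) : R := snd z.
Definition RtoC (a : R) : Cx := (a, 0).
Definition C0 : Cx := (0, 0).
Definition C1 : Cx := (1, 0).
Definition Cadd (z w : Cx) : Cx := (fst z + fst w, snd z + snd w).
Definition Copp (z : Cx) : Cx := (- fst z, - snd z).
Definition Csub (z w : Cx) : Cx := Cadd z (Copp w).
Definition Cmul (z w : Cx) : Cx :=
  (fst z * fst w - snd z * snd w, fst z * snd w + snd z * fst w).
Definition Cscale (a : R) (z : Cx) : Cx := (a * fst z, a * snd z).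
Definition Cnorm (z : Cx) : R := sqrt (fst z * fst z + snd z * snd z).
Definition Cinv (z : Cx) : Cx :=
  let d := fst z * fst z + snd z * snd z in (fst z / d, - snd z / d).
Definition Cdiv (z w : Cx) : Cx := Cmul z (Cinv w).
Definition Cexp (z : Cx) : Cx := Cscale (exp (fst z)) (cos (snd z), sin (snd z)).
Definition Cunit (a : R) : Cx := (cos a, sin a).

Definition inD (z : Cx) : Prop := Cnorm z < 1.

Definition C_deriv (f : Cx -> Cx) (z l : Cx) : Prop :=
  forall eps, 0 < eps -> exists delta, 0 < delta /\
    forall w, w <> z -> Cnorm (Csub w z) < delta ->
      Cnorm (Csub (Cdiv (Csub (f w) (f z)) (Csub w z)) l) < eps.

Definition holo_on_D (f : Cx -> Cx) : Prop :=
  forall z, inD z -> exists l, C_deriv f z l.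

Definition holo_self (f : Cx -> Cx) : Prop :=
  holo_on_D f /\ forall z, inD z -> inD (f z).

Definition disc_aut (f : Cx -> Cx) : Prop :=
  holo_self f /\ exists g, holo_self g /\
    forall z, inD z -> g (f z) = z /\ f (g z) = z.

Definition one_param_semigroup (phi : R -> Cx -> Cx) : Prop :=
  (forall t, 0 <= t -> holo_self (phi t)) /\
  (forall z, inD z -> phi 0 z = z) /\
  (forall s t z, 0 <= s -> 0 <= t -> inD z -> phi (s + t) z = phi s (phi t z)) /\
  (forall t0 rho eps, 0 <= t0 -> 0 <= rho < 1 -> 0 < eps ->
     exists delta, 0 < delta /\ forall t z, 0 <= t -> Rabs (t - t0) < delta ->
       Cnorm z <= rho -> Cnorm (Csub (phi t z) (phi t0 z)) < eps) /\
  (forall t, 0 < t -> ~ disc_aut (phi t)).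

Definition is_generator (phi : R -> Cx -> Cx) (G : Cx -> Cx) : Prop :=
  holo_on_D G /\
  forall z t, inD z -> 0 <= t ->
    forall eps, 0 < eps -> exists delta, 0 < delta /\
      forall s, 0 <= s -> s <> t -> Rabs (s - t) < delta ->
        Cnorm (Csub (Cscale (/ (s - t)) (Csub (phi s z) (phi t z))) (G (phi t z))) < eps.

Definition denjoy_wolff (phi : R -> Cx -> Cx) (tau : Cx) : Prop :=
  Cnorm tau <= 1 /\
  forall z, inD z -> forall eps, 0 < eps -> exists T, forall t, T <= t ->
    Cnorm (Csub (phi t z) tau) < eps.

Definition univalent (h : Cx -> Cx) : Prop :=
  holo_on_D h /\ forall z w, inD z -> inD w -> h z = h w -> z = w.

Definition koenigs_function (phi : R -> Cx -> Cx) (G : Cx -> Cx) (tau : Cx)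
  (h : Cx -> Cx) : Prop :=
  univalent h /\
  (inD tau ->
     h tau = C0 /\ C_deriv h tau C1 /\
     exists lam, C_deriv G tau lam /\
       forall t z, 0 <= t -> inD z ->
         h (phi t z) = Cmul (Cexp (Cscale t lam)) (h z)) /\
  (Cnorm tau = 1 ->
     h C0 = C0 /\
     forall t z, 0 <= t -> inD z -> h (phi t z) = Cadd (h z) (RtoC t)).

Definition in_stolz (x : Cx) (M : R) (z : Cx) : Prop :=
  inD z /\ Cnorm (Csub x z) <= M * (1 - Cnorm z).

Definition angular_limit (f : Cx -> Cx) (x l : Cx) : Prop :=
  forall M eps, 1 < M -> 0 < eps -> exists delta, 0 < delta /\
    forall z, in_stolz x M z -> Cnorm (Csub z x) < delta ->
      Cnorm (Csub (f z) l) < eps.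

Definition nontangential_seq (x : Cx) (zs : nat -> Cx) : Prop :=
  (exists M, forall n, in_stolz x M (zs n)) /\
  (forall eps, 0 < eps -> exists N, forall n, (N <= n)%nat ->
     Cnorm (Csub (zs n) x) < eps).

Definition liminf_ge (u : nat -> R) (a : R) : Prop :=
  forall b, b < a -> exists N, forall n, (N <= n)%nat -> b < u n.

(* angular liminf of f at x equals the real number L:
   L = inf over non-tangential sequences z_n -> x of liminf f(z_n) *)
Definition angular_liminf_eq (f : Cx -> R) (x : Cx) (L : R) : Prop :=
  (forall zs, nontangential_seq x zs -> liminf_ge (fun n => f (zs n)) L) /\
  (forall L', L < L' -> exists zs, nontangential_seq x zs /\
     ~ liminf_ge (fun n => f (zs n)) L').

Definition regular_pole (G : Cx -> Cx) (x : Cx) : Prop :=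
  exists L, 0 < L /\
    angular_liminf_eq (fun z => Cnorm (Cmul (G z) (Csub x z))) x L.

Definition curve_continuous (g : R -> Cx) : Prop :=
  forall s eps, 0 < eps -> exists delta, 0 < delta /\
    forall s', Rabs (s' - s) < delta -> Cnorm (Csub (g s') (g s)) < eps.

Definition jordan_curve (gamma : R -> Cx) : Prop :=
  curve_continuous gamma /\
  (forall s, gamma (s + 2 * PI) = gamma s) /\
  (forall s s', 0 <= s < 2 * PI -> 0 <= s' < 2 * PI -> gamma s = gamma s' -> s = s').

Definition trace (gamma : R -> Cx) (w : Cx) : Prop := exists s, gamma s = w.

Definition path_connected_in (U : Cx -> Prop) (a b : Cx) : Prop :=
  exists p : R -> Cx, p 0 = a /\ p 1 = b /\ (forall s, 0 <= s <= 1 -> U (p s)) /\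
    forall s eps, 0 <= s <= 1 -> 0 < eps -> exists delta, 0 < delta /\
      forall s', 0 <= s' <= 1 -> Rabs (s' - s) < delta ->
        Cnorm (Csub (p s') (p s)) < eps.

Definition jordan_domain (gamma : R -> Cx) (Omega : Cx -> Prop) : Prop :=
  jordan_curve gamma /\
  (exists a, ~ trace gamma a /\
     forall z, Omega z <-> path_connected_in (fun w => ~ trace gamma w) a z) /\
  (exists B, forall z, Omega z -> Cnorm z <= B).

(* Dini-smooth corner of opening theta at w0 of the boundary curve gamma
   of the Jordan domain Omega.  gp, gm : the two intersection points with the
   circle |w - w0| = rho; ap, am : continuous arguments of gp - w0, gm - w0,
   extended to rho = 0, with Dini modulus of continuity om.  The interior
   angle is measured inside Omega: the arc going counterclockwise from gm(rho)
   to gp(rho) lies in Omega, and theta = ap(0) - am(0). *)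
Definition dini_smooth_corner (gamma : R -> Cx) (Omega : Cx -> Prop) (w0 : Cx)
  (theta : R) : Prop :=
  trace gamma w0 /\
  exists eps (gp gm : R -> Cx) (ap am om : R -> R),
    0 < eps /\
    (forall rho, 0 < rho < eps ->
       gp rho <> gm rho /\
       forall w, (trace gamma w /\ Cnorm (Csub w w0) = rho) <->
                 (w = gp rho \/ w = gm rho)) /\
    (forall rho eps', 0 < rho < eps -> 0 < eps' -> exists delta, 0 < delta /\
       forall rho', 0 < rho' < eps -> Rabs (rho' - rho) < delta ->
         Cnorm (Csub (gp rho') (gp rho)) < eps' /\
         Cnorm (Csub (gm rho') (gm rho)) < eps') /\
    (forall rho, 0 < rho < eps ->
       gp rho = Cadd w0 (Cscale rho (Cunit (ap rho))) /\
       gm rho = Cadd w0 (Cscale rho (Cunit (am rho)))) /\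
    (forall t, 0 <= t -> 0 <= om t) /\
    (forall t t', 0 <= t <= t' -> om t <= om t') /\
    (forall e, 0 < e -> exists delta, 0 < delta /\ forall t, 0 < t < delta -> om t < e) /\
    (forall s t, 0 <= s < eps -> 0 <= t < eps ->
       Rabs (ap s - ap t) <= om (Rabs (s - t)) /\
       Rabs (am s - am t) <= om (Rabs (s - t))) /\
    (* Dini condition: int_0^eps om(t)/t dt < oo *)
    (exists B, forall d, 0 < d < eps ->
       exists pr : Riemann_integrable (fun t => om t / t) d eps, RiemannInt pr <= B) /\
    (forall rho, 0 < rho < eps ->
       am rho < ap rho < am rho + 2 * PI /\
       forall a, am rho < a < ap rho -> Omega (Cadd w0 (Cscale rho (Cunit a)))) /\
    theta = ap 0 - am 0.

(* Main.v *)
Require Import Defs.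
From Stdlib Require Import ZArith Reals Lra Lia Psatz Classical ClassicalEpsilon.
From Coquelicot Require Import Coquelicot.
Open Scope R_scope.

(** Write [G z = (tau - z) (1 - conj tau z) p z].  Horocycles at [tau] are invariant, so [Re p >= 0]
    (Berkson-Porta), and the Julia-Wolff-Caratheodory theorem gives [|G z (x - z)|] a nontangential
    limit [L] at [x], finite.  What has to be excluded is [L = 0].

    A point of [h D] is flowed into [h D], and [w0] is not in [h D]; hence the backward flow line of
    [w0] avoids [h D], so that the slit at the corner points against the flow.  Flowing [w0]
    forward therefore stays in [h D], and [h^-1] lifts this flow line to a curve [z t] with
    [z' = G z] issuing from [x].  Schwarz-Pick for [h^-1] on the slit-like sector, where the Dini
    condition makes distances along the bisector those of the slit plane up to a bounded error,
    yields [1 - |z t|^2 >= c sqrt t].  On the other hand a primitive [W] of [1 / p] satisfies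
    [|W (z t) - W x| <= C t], and averaging [Re (1 / p)], which is at least a constant times
    [1 - |z|^2], over chords yields [|z t - x| (1 - |z t|^2) <= C t].  Hence [z t] tends to [x]
    nontangentially with [|z t - x| = O (sqrt t)].  If [L] were [0], then [z' = G z] would be
    [o (1 / sqrt t)] and [z t - x = o (sqrt t)], contradicting the lower bound. *)

(** The obstacle is that [x] has no orbit of its own. Nothing says beforehand that z t tends to x,
    let alone nontangentially, while the limit L is only available in Stolz angles. The estimates
    are therefore proved for the orbits of s x and passed to the limit s -> 1. A bound on |z t -
    x|^3 comes first and already gives convergence to x; the bound on the product with 1 - |z t|^2
    becomes nontangential approach once 1 - |z t|^2 is bounded below. The exponent 1/2 is that of
    the slit plane, the image of a half-plane under squaring: Schwarz-Pick gives there |G z| <= (1 -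
    |z|^2) / (4 t), so the logarithmic derivative of 1 - |z t|^2 is at most 1 / (2 t), and
    integrating down from a fixed time gives the lower bound. The actual corner lacks an angle om a
    at scale a, which adds a multiple of om a + a to 1/2; summed over dyadic scales this error is
    finite. The primitive is taken of 1 / p because W (z t) then has derivative (tau - z) (1 - conj
    tau z), which is bounded whatever G does near x. *)

(** * Complex derivatives as first-order expansions *)

Definition cderiv (f : C -> C) (z l : C) : Prop :=
  forall eps, 0 < eps -> exists delta, 0 < delta /\
    forall w, Cmod (w - z) < delta ->
      Cmod (f w - f z - l * (w - z)) <= eps * Cmod (w - z).

Definition ccont (f : C -> C) (z : C) : Prop :=
  forall eps, 0 < eps -> exists delta, 0 < delta /\
    forall w, Cmod (w - z) < delta -> Cmod (f w - f z) < eps.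

Lemma Cmod_minus_sym (a b : C) : Cmod (a - b) = Cmod (b - a).
Proof. rewrite <- Cmod_opp; f_equal; ring. Qed.

Lemma Cmod_triangle_inv (a b : C) : Cmod a - Cmod b <= Cmod (a - b).
Proof.
  assert (H := Cmod_triangle (a - b) b).
  replace (a - b + b)%C with a in H by ring. lra.
Qed.

Lemma Cmod_minus_triangle (a b c : C) : Cmod (a - c) <= Cmod (a - b) + Cmod (b - c).
Proof.
  assert (H := Cmod_triangle (a - b) (b - c)).
  replace (a - b + (b - c))%C with (a - c)%C in H by ring. lra.
Qed.

Lemma Cmod_minus_le (a b : C) : Cmod (a - b) <= Cmod a + Cmod b.
Proof. assert (H := Cmod_triangle a (- b)). rewrite Cmod_opp in H. exact H. Qed.

Lemma cderiv_bound (f : C -> C) (z l : C) :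
  cderiv f z l -> exists delta, 0 < delta /\
    forall w, Cmod (w - z) < delta -> Cmod (f w - f z) <= (Cmod l + 1) * Cmod (w - z).
Proof.
  intros H. destruct (H 1 Rlt_0_1) as [d [Hd Hw]].
  exists d; split; auto. intros w Hwd. specialize (Hw w Hwd).
  assert (T := Cmod_triangle (f w - f z - l * (w - z)) (l * (w - z))).
  replace (f w - f z - l * (w - z) + l * (w - z))%C with (f w - f z)%C in T by ring.
  rewrite Cmod_mult in T. lra.
Qed.

Lemma cderiv_ccont (f : C -> C) (z l : C) : cderiv f z l -> ccont f z.
Proof.
  intros H eps He. destruct (cderiv_bound f z l H) as [d [Hd Hw]].
  assert (Hl := Cmod_ge_0 l).
  exists (Rmin d (eps / (Cmod l + 1))); split.
  - apply Rmin_glb_lt; auto. apply Rdiv_lt_0_compat; lra.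
  - intros w Hwd.
    assert (H1 := Rmin_l d (eps / (Cmod l + 1))). assert (H2 := Rmin_r d (eps / (Cmod l + 1))).
    eapply Rle_lt_trans. { apply Hw. lra. }
    replace eps with ((Cmod l + 1) * (eps / (Cmod l + 1))) by (field; lra).
    apply Rmult_lt_compat_l; lra.
Qed.

Lemma cderiv_const (c z : C) : cderiv (fun _ => c) z 0.
Proof.
  intros eps He. exists 1; split; [lra|]. intros w _.
  replace (c - c - 0 * (w - z))%C with (RtoC 0) by ring.
  rewrite Cmod_0. assert (H := Cmod_ge_0 (w - z)). nra.
Qed.

Lemma cderiv_id (z : C) : cderiv (fun w => w) z 1.
Proof.
  intros eps He. exists 1; split; [lra|]. intros w _.
  replace (w - z - 1 * (w - z))%C with (RtoC 0) by ring.
  rewrite Cmod_0. assert (H := Cmod_ge_0 (w - z)). nra.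
Qed.

Lemma cderiv_eq (f : C -> C) (z l l' : C) : cderiv f z l -> l = l' -> cderiv f z l'.
Proof. intros H <-. exact H. Qed.

Lemma cderiv_plus (f g : C -> C) (z l m : C) :
  cderiv f z l -> cderiv g z m -> cderiv (fun w => f w + g w)%C z (l + m).
Proof.
  intros Hf Hg eps He.
  destruct (Hf (eps / 2)) as [d1 [Hd1 H1]]; [lra|].
  destruct (Hg (eps / 2)) as [d2 [Hd2 H2]]; [lra|].
  exists (Rmin d1 d2); split; [apply Rmin_glb_lt; auto|]. intros w Hw.
  assert (L1 := Rmin_l d1 d2). assert (L2 := Rmin_r d1 d2).
  specialize (H1 w ltac:(lra)). specialize (H2 w ltac:(lra)).
  replace (f w + g w - (f z + g z) - (l + m) * (w - z))%C
    with ((f w - f z - l * (w - z)) + (g w - g z - m * (w - z)))%C by ring.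
  eapply Rle_trans; [apply Cmod_triangle|]. lra.
Qed.

Lemma cderiv_mult (f g : C -> C) (z l m : C) :
  cderiv f z l -> cderiv g z m -> cderiv (fun w => f w * g w)%C z (l * g z + f z * m).
Proof.
  intros Hf Hg eps He.
  assert (Pg := Cmod_ge_0 (g z)). assert (Pf := Cmod_ge_0 (f z)). assert (Pl := Cmod_ge_0 l).
  set (B := Cmod (g z) + 1 + Cmod (f z) + Cmod l).
  assert (HB : 0 < B) by (unfold B; lra).
  assert (He' : 0 < eps / (3 * B)) by (apply Rdiv_lt_0_compat; lra).
  destruct (Hf _ He') as [d1 [Hd1 H1]].
  destruct (Hg _ He') as [d2 [Hd2 H2]].
  destruct (cderiv_ccont g z m Hg (Rmin 1 (eps / (3 * B)))) as [d3 [Hd3 H3]].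
  { apply Rmin_glb_lt; lra. }
  exists (Rmin d1 (Rmin d2 d3)); split; [repeat apply Rmin_glb_lt; auto|]. intros w Hw.
  assert (L1 := Rmin_l d1 (Rmin d2 d3)). assert (L2 := Rmin_r d1 (Rmin d2 d3)).
  assert (L3 := Rmin_l d2 d3). assert (L4 := Rmin_r d2 d3).
  specialize (H1 w ltac:(lra)). specialize (H2 w ltac:(lra)). specialize (H3 w ltac:(lra)).
  assert (L5 := Rmin_l 1 (eps / (3 * B))). assert (L6 := Rmin_r 1 (eps / (3 * B))).
  replace (f w * g w - f z * g z - (l * g z + f z * m) * (w - z))%C
    with ((f w - f z - l * (w - z)) * g w + l * (w - z) * (g w - g z)
          + f z * (g w - g z - m * (w - z)))%C by ring.
  assert (Hgw : Cmod (g w) <= Cmod (g z) + 1).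
  { assert (T := Cmod_triangle_inv (g w) (g z)). lra. }
  eapply Rle_trans; [apply Cmod_triangle|].
  eapply Rle_trans; [apply Rplus_le_compat_r; apply Cmod_triangle|].
  rewrite !Cmod_mult.
  set (D := Cmod (w - z)) in *. assert (HD : 0 <= D) by apply Cmod_ge_0.
  set (e := eps / (3 * B)) in *.
  assert (E : eps = 3 * (e * B)) by (unfold e; field; lra).
  assert (Pgw := Cmod_ge_0 (g w)).
  assert (X1 : Cmod (f w - f z - l * (w - z)) * Cmod (g w) <= e * D * B).
  { apply Rmult_le_compat; try apply Cmod_ge_0; auto. unfold B; lra. }
  assert (X2 : Cmod l * D * Cmod (g w - g z) <= B * D * e).
  { apply Rmult_le_compat; try apply Cmod_ge_0; try lra.
    - apply Rmult_le_pos; lra.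
    - apply Rmult_le_compat_r; unfold B; lra. }
  assert (X3 : Cmod (f z) * Cmod (g w - g z - m * (w - z)) <= B * (e * D)).
  { apply Rmult_le_compat; try apply Cmod_ge_0; auto. unfold B; lra. }
  rewrite E. nra.
Qed.

Lemma cderiv_scal (c : C) (f : C -> C) (z l : C) :
  cderiv f z l -> cderiv (fun w => c * f w)%C z (c * l).
Proof.
  intros H. eapply cderiv_eq.
  - apply (cderiv_mult (fun _ => c) f z 0 l); auto. apply cderiv_const.
  - ring.
Qed.

Lemma cderiv_opp (f : C -> C) (z l : C) : cderiv f z l -> cderiv (fun w => - f w)%C z (- l).
Proof.
  intros H eps He. destruct (H eps He) as [d [Hd Hw]]. exists d; split; auto.
  intros w Hwd. replace (- f w - - f z - - l * (w - z))%C with (- (f w - f z - l * (w - z)))%C by ring.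
  rewrite Cmod_opp; auto.
Qed.

Lemma cderiv_minus (f g : C -> C) (z l m : C) :
  cderiv f z l -> cderiv g z m -> cderiv (fun w => f w - g w)%C z (l - m).
Proof. intros. apply cderiv_plus; auto. apply cderiv_opp; auto. Qed.

(** The expansion without a quotient pays off here: points w with f w = f z need no separate
    treatment. *)
Lemma cderiv_comp (f g : C -> C) (z l m : C) :
  cderiv f z l -> cderiv g (f z) m -> cderiv (fun w => g (f w)) z (m * l).
Proof.
  intros Hf Hg eps He.
  assert (Pl := Cmod_ge_0 l). assert (Pm := Cmod_ge_0 m).
  assert (He1 : 0 < eps / (2 * (Cmod l + 1))) by (apply Rdiv_lt_0_compat; lra).
  assert (He2 : 0 < eps / (2 * (Cmod m + 1))) by (apply Rdiv_lt_0_compat; lra).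
  destruct (Hg _ He1) as [d1 [Hd1 H1]].
  destruct (Hf _ He2) as [d2 [Hd2 H2]].
  destruct (cderiv_bound f z l Hf) as [d3 [Hd3 H3]].
  destruct (cderiv_ccont f z l Hf d1 Hd1) as [d4 [Hd4 H4]].
  exists (Rmin d2 (Rmin d3 d4)); split; [repeat apply Rmin_glb_lt; auto|]. intros w Hw.
  assert (L1 := Rmin_l d2 (Rmin d3 d4)). assert (L2 := Rmin_r d2 (Rmin d3 d4)).
  assert (L3 := Rmin_l d3 d4). assert (L4 := Rmin_r d3 d4).
  specialize (H2 w ltac:(lra)). specialize (H3 w ltac:(lra)). specialize (H4 w ltac:(lra)).
  specialize (H1 (f w) H4).
  replace (g (f w) - g (f z) - m * l * (w - z))%C
    with ((g (f w) - g (f z) - m * (f w - f z)) + m * (f w - f z - l * (w - z)))%C by ring.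
  eapply Rle_trans; [apply Cmod_triangle|]. rewrite Cmod_mult.
  set (D := Cmod (w - z)) in *. assert (HD : 0 <= D) by apply Cmod_ge_0.
  set (e1 := eps / (2 * (Cmod l + 1))) in *. set (e2 := eps / (2 * (Cmod m + 1))) in *.
  assert (E1 : e1 * (Cmod l + 1) = eps / 2) by (unfold e1; field; lra).
  assert (E2 : e2 * (Cmod m + 1) = eps / 2) by (unfold e2; field; lra).
  assert (X1 : e1 * Cmod (f w - f z) <= e1 * ((Cmod l + 1) * D)) by (apply Rmult_le_compat_l; lra).
  assert (X2 : Cmod m * Cmod (f w - f z - l * (w - z)) <= (Cmod m + 1) * (e2 * D)).
  { apply Rmult_le_compat; try apply Cmod_ge_0; lra. }
  nra.
Qed.

Lemma cderiv_inv_id (z : C) : z <> 0%C -> cderiv (fun w => / w)%C z (- / (z * z))%C.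
Proof.
  intros Hz eps He. assert (Pz : 0 < Cmod z) by (apply Cmod_gt_0; auto).
  set (k := Cmod z) in *.
  exists (Rmin (k / 2) (eps * (k * k * k / 2))). split.
  { apply Rmin_glb_lt; [lra|]. repeat apply Rmult_lt_0_compat; try lra. }
  intros w Hw.
  assert (L1 := Rmin_l (k / 2) (eps * (k * k * k / 2))).
  assert (L2 := Rmin_r (k / 2) (eps * (k * k * k / 2))).
  assert (Kw : k / 2 < Cmod w).
  { assert (T := Cmod_triangle_inv z w). rewrite Cmod_minus_sym in T. fold k in T. lra. }
  assert (Hw0 : w <> 0%C). { apply Cmod_gt_0. lra. }
  replace (/ w - / z - - / (z * z) * (w - z))%C
    with ((w - z) * ((w - z) * / (w * (z * z))))%C by (field; auto).
  rewrite !Cmod_mult, Cmod_inv, !Cmod_mult. 2:{ repeat apply Cmult_neq_0; auto. }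
  fold k. rewrite Rmult_comm. apply Rmult_le_compat_r; [apply Cmod_ge_0|].
  apply Rle_trans with (eps * (k * k * k / 2) * / (k / 2 * (k * k))).
  - apply Rmult_le_compat; try apply Cmod_ge_0.
    + left. apply Rinv_0_lt_compat. repeat apply Rmult_lt_0_compat; lra.
    + lra.
    + apply Rinv_le_contravar; [repeat apply Rmult_lt_0_compat; lra|].
      apply Rmult_le_compat_r; [nra|lra].
  - right. field. lra.
Qed.

Lemma cderiv_inv (f : C -> C) (z l : C) :
  cderiv f z l -> f z <> 0%C -> cderiv (fun w => / f w)%C z (- l / (f z * f z))%C.
Proof.
  intros H Hz. eapply cderiv_eq.
  - apply (cderiv_comp f (fun w => / w)%C z l (- / (f z * f z))%C); auto.
    apply cderiv_inv_id; auto.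
  - field; auto.
Qed.

Lemma cderiv_div (f g : C -> C) (z l m : C) :
  cderiv f z l -> cderiv g z m -> g z <> 0%C ->
  cderiv (fun w => f w / g w)%C z ((l * g z - f z * m) / (g z * g z))%C.
Proof.
  intros Hf Hg Hz. eapply cderiv_eq.
  - apply (cderiv_mult f (fun w => / g w)%C); [exact Hf|]. apply cderiv_inv; eauto.
  - cbv beta. field; auto.
Qed.

(** * Curves *)

(** Componentwise, so that real calculus applies to curves; [curve_deriv_eps] recovers the complex
    expansion. *)
Definition curve_deriv (g : R -> C) (t : R) (v : C) : Prop :=
  is_derive (fun s => fst (g s)) t (fst v) /\ is_derive (fun s => snd (g s)) t (snd v).

Lemma is_derive_eps (f : R -> R) (t l : R) :
  is_derive f t l <-> forall eps, 0 < eps -> exists delta, 0 < delta /\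
    forall s, Rabs (s - t) < delta -> Rabs (f s - f t - l * (s - t)) <= eps * Rabs (s - t).
Proof.
  split.
  - intros [_ H] eps He. specialize (H t (fun P HP => HP) (mkposreal eps He)).
    destruct H as [d Hd]. exists d; split; [apply cond_pos|]. intros s Hs.
    specialize (Hd s Hs). unfold norm, minus, scal, plus, opp in Hd; simpl in Hd.
    unfold abs, mult in Hd; simpl in Hd.
    replace (f s - f t - l * (s - t)) with (f s + - f t + - ((s + - t) * l)) by ring. exact Hd.
  - intros H. split; [apply is_linear_scal_l|].
    intros x Hx. rewrite <- (is_filter_lim_locally_unique t x Hx).
    intros [eps He]. destruct (H eps He) as [d [Hd Hs]]. exists (mkposreal d Hd). intros s Hss.
    unfold norm, minus, scal, plus, opp; simpl. unfold abs, mult; simpl.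
    replace (f s + - f t + - ((s + - t) * l)) with (f s - f t - l * (s - t)) by ring.
    apply Hs. exact Hss.
Qed.

Lemma Rabs_fst_le (z : C) : Rabs (fst z) <= Cmod z.
Proof. apply (re_le_Cmod z). Qed.

Lemma Rabs_snd_le (z : C) : Rabs (snd z) <= Cmod z.
Proof. eapply Rle_trans; [apply Rmax_r | apply Rmax_Cmod]. Qed.

Lemma Cmod_le_sum (z : C) : Cmod z <= Rabs (fst z) + Rabs (snd z).
Proof.
  unfold Cmod. apply Rsqr_incr_0_var; [|assert (H1 := Rabs_pos (fst z)); assert (H2 := Rabs_pos (snd z)); lra].
  rewrite Rsqr_sqrt by nra. unfold Rsqr.
  assert (H1 := Rabs_pos (fst z)); assert (H2 := Rabs_pos (snd z)).
  assert (E1 : Rabs (fst z) * Rabs (fst z) = fst z * fst z) by (rewrite <- Rabs_mult; apply Rabs_right; nra).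
  assert (E2 : Rabs (snd z) * Rabs (snd z) = snd z * snd z) by (rewrite <- Rabs_mult; apply Rabs_right; nra).
  nra.
Qed.

Lemma curve_deriv_eps (g : R -> C) (t : R) (v : C) :
  curve_deriv g t v <-> forall eps, 0 < eps -> exists delta, 0 < delta /\
    forall s, Rabs (s - t) < delta ->
      Cmod (g s - g t - v * RtoC (s - t)) <= eps * Rabs (s - t).
Proof.
  unfold curve_deriv. rewrite !is_derive_eps. split.
  - intros [H1 H2] eps He.
    destruct (H1 (eps / 2)) as [d1 [Hd1 K1]]; [lra|]. destruct (H2 (eps / 2)) as [d2 [Hd2 K2]]; [lra|].
    exists (Rmin d1 d2); split; [apply Rmin_glb_lt; auto|]. intros s Hs.
    assert (L1 := Rmin_l d1 d2). assert (L2 := Rmin_r d1 d2).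
    specialize (K1 s ltac:(lra)). specialize (K2 s ltac:(lra)).
    eapply Rle_trans; [apply Cmod_le_sum|]. simpl.
    replace (fst (g s) + - fst (g t) + - (fst v * (s - t) - snd v * 0))
      with (fst (g s) - fst (g t) - fst v * (s - t)) by ring.
    replace (snd (g s) + - snd (g t) + - (fst v * 0 + snd v * (s - t)))
      with (snd (g s) - snd (g t) - snd v * (s - t)) by ring. lra.
  - intros H; split; intros eps He; destruct (H eps He) as [d [Hd K]]; exists d; split; auto;
      intros s Hs; specialize (K s Hs).
    + eapply Rle_trans; [|exact K].
      eapply Rle_trans; [|apply Rabs_fst_le]. right. f_equal. simpl. ring.
    + eapply Rle_trans; [|exact K].
      eapply Rle_trans; [|apply Rabs_snd_le]. right. f_equal. simpl. ring.
Qed.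

Lemma curve_deriv_eq (g : R -> C) t v v' : curve_deriv g t v -> v = v' -> curve_deriv g t v'.
Proof. intros H <-; exact H. Qed.

Lemma curve_deriv_comp (f : C -> C) (g : R -> C) (t : R) (v l : C) :
  curve_deriv g t v -> cderiv f (g t) l -> curve_deriv (fun s => f (g s)) t (l * v).
Proof.
  rewrite !curve_deriv_eps. intros Hg Hf eps He.
  assert (Pl := Cmod_ge_0 l). assert (Pv := Cmod_ge_0 v).
  assert (He1 : 0 < eps / (2 * (Cmod v + 1))) by (apply Rdiv_lt_0_compat; lra).
  assert (He2 : 0 < eps / (2 * (Cmod l + 1))) by (apply Rdiv_lt_0_compat; lra).
  destruct (Hf _ He1) as [d1 [Hd1 H1]].
  destruct (Hg _ He2) as [d2 [Hd2 H2]].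
  destruct (Hg 1 Rlt_0_1) as [d3 [Hd3 H3]].
  assert (Hd4 : 0 < d1 / (Cmod v + 1)) by (apply Rdiv_lt_0_compat; lra).
  exists (Rmin (d1 / (Cmod v + 1)) (Rmin d2 d3)); split; [repeat apply Rmin_glb_lt; auto|].
  intros s Hs.
  assert (L1 := Rmin_l (d1 / (Cmod v + 1)) (Rmin d2 d3)).
  assert (L2 := Rmin_r (d1 / (Cmod v + 1)) (Rmin d2 d3)).
  assert (L3 := Rmin_l d2 d3). assert (L4 := Rmin_r d2 d3).
  specialize (H2 s ltac:(lra)). specialize (H3 s ltac:(lra)).
  set (D := Rabs (s - t)) in *. assert (HD : 0 <= D) by apply Rabs_pos.
  assert (B : Cmod (g s - g t) <= (Cmod v + 1) * D).
  { assert (T := Cmod_triangle (g s - g t - v * RtoC (s - t)) (v * RtoC (s - t))).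
    replace (g s - g t - v * RtoC (s - t) + v * RtoC (s - t))%C with (g s - g t)%C in T by ring.
    rewrite Cmod_mult, Cmod_R in T. fold D in T. lra. }
  assert (Hd : Cmod (g s - g t) < d1).
  { eapply Rle_lt_trans; [exact B|].
    replace d1 with ((Cmod v + 1) * (d1 / (Cmod v + 1))) by (field; lra).
    apply Rmult_lt_compat_l; lra. }
  specialize (H1 _ Hd).
  replace (f (g s) - f (g t) - l * v * RtoC (s - t))%C
    with ((f (g s) - f (g t) - l * (g s - g t)) + l * (g s - g t - v * RtoC (s - t)))%C by ring.
  eapply Rle_trans; [apply Cmod_triangle|]. rewrite Cmod_mult.
  set (e1 := eps / (2 * (Cmod v + 1))) in *. set (e2 := eps / (2 * (Cmod l + 1))) in *.
  assert (E1 : e1 * (Cmod v + 1) = eps / 2) by (unfold e1; field; lra).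
  assert (E2 : e2 * (Cmod l + 1) = eps / 2) by (unfold e2; field; lra).
  assert (X1 : e1 * Cmod (g s - g t) <= e1 * ((Cmod v + 1) * D)) by (apply Rmult_le_compat_l; lra).
  assert (X2 : Cmod l * Cmod (g s - g t - v * RtoC (s - t)) <= (Cmod l + 1) * (e2 * D)).
  { apply Rmult_le_compat; try apply Cmod_ge_0; lra. }
  nra.
Qed.

Lemma curve_deriv_line (a b : C) (t : R) : curve_deriv (fun s => a + RtoC s * b)%C t b.
Proof.
  split; simpl; auto_derive; auto; ring.
Qed.

Lemma is_derive_continuity (f : R -> R) (t l : R) : is_derive f t l -> continuity_pt f t.
Proof.
  intros H. apply derivable_continuous_pt. exists l. apply is_derive_Reals. exact H.
Qed.

Lemma derive_nonneg_le (f df : R -> R) (a b : R) :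
  a <= b -> (forall t, a <= t <= b -> is_derive f t (df t)) ->
  (forall t, a <= t <= b -> 0 <= df t) -> f a <= f b.
Proof.
  intros Hab Hd Hp.
  destruct (MVT_gen f a b df) as [c [Hc E]].
  - rewrite Rmin_left, Rmax_right by auto. intros x Hx. apply Hd; lra.
  - rewrite Rmin_left, Rmax_right by auto. intros x Hx. eapply is_derive_continuity. apply Hd; lra.
  - rewrite Rmin_left, Rmax_right in Hc by auto. specialize (Hp c Hc). nra.
Qed.

Lemma is_derive_dot (g : R -> C) (t : R) (v e : C) :
  curve_deriv g t v ->
  is_derive (fun s => fst (g s) * fst e + snd (g s) * snd e) t (fst v * fst e + snd v * snd e).
Proof.
  intros [H1 H2].
  apply (is_derive_plus (K := R_AbsRing) (V := R_NormedModule)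
    (fun s => fst (g s) * fst e) (fun s => snd (g s) * snd e)).
  - apply (is_derive_ext (fun s => scal (fst e) (fst (g s)))).
    { intros s. unfold scal; simpl; unfold mult; simpl; ring. }
    replace (fst v * fst e) with (scal (fst e) (fst v)) by (unfold scal; simpl; unfold mult; simpl; ring).
    apply is_derive_scal. exact H1.
  - apply (is_derive_ext (fun s => scal (snd e) (snd (g s)))).
    { intros s. unfold scal; simpl; unfold mult; simpl; ring. }
    replace (snd v * snd e) with (scal (snd e) (snd v)) by (unfold scal; simpl; unfold mult; simpl; ring).
    apply is_derive_scal. exact H2.
Qed.

Lemma Cmod_sqr (z : C) : Cmod z * Cmod z = fst z * fst z + snd z * snd z.
Proof. unfold Cmod. rewrite sqrt_sqrt; nra. Qed.

Lemma dot_le_Cmod (z w : C) : fst z * fst w + snd z * snd w <= Cmod z * Cmod w.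
Proof.
  assert (H := re_le_Cmod (z * Cconj w)). rewrite Cmod_mult, Cmod_conj in H.
  assert (H' := Rle_abs (Re (z * Cconj w))). unfold Re in *. simpl in *. lra.
Qed.

(* The increment is projected on its own direction. *)
Lemma curve_increment_le (g : R -> C) (dg : R -> C) (m dm : R -> R) (a b : R) :
  a <= b -> (forall t, a <= t <= b -> curve_deriv g t (dg t)) ->
  (forall t, a <= t <= b -> is_derive m t (dm t)) ->
  (forall t, a <= t <= b -> Cmod (dg t) <= dm t) ->
  Cmod (g b - g a) <= m b - m a.
Proof.
  intros Hab Hg Hm Hle.
  set (e := (g b - g a)%C).
  assert (K : Cmod e * m a - (fst (g a) * fst e + snd (g a) * snd e)
     <= Cmod e * m b - (fst (g b) * fst e + snd (g b) * snd e)).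
  { apply (derive_nonneg_le (fun t => Cmod e * m t - (fst (g t) * fst e + snd (g t) * snd e))
      (fun t => Cmod e * dm t - (fst (dg t) * fst e + snd (dg t) * snd e)) a b Hab).
    - intros t Ht. apply (is_derive_minus (K := R_AbsRing) (V := R_NormedModule)
        (fun t => Cmod e * m t)).
      + apply (is_derive_scal m t (Cmod e)). auto.
      + apply is_derive_dot. auto.
    - intros t Ht. assert (H := dot_le_Cmod (dg t) e). specialize (Hle t Ht).
      assert (P := Cmod_ge_0 e). nra. }
  assert (Q := Cmod_sqr e). assert (P := Cmod_ge_0 e).
  assert (F : fst e = fst (g b) - fst (g a)) by (unfold e; simpl; ring).
  assert (S : snd e = snd (g b) - snd (g a)) by (unfold e; simpl; ring).
  (* A zero increment has no direction to project on; then only [m a <= m b] is required. *)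
  destruct (Req_dec (Cmod e) 0) as [Z|NZ].
  - rewrite Z. rewrite <- (Rminus_diag_eq (m a) (m a) eq_refl).
    assert (m a <= m b). { apply (derive_nonneg_le m dm a b Hab Hm).
      intros t Ht. specialize (Hle t Ht). assert (X := Cmod_ge_0 (dg t)). lra. }
    lra.
  - apply Rmult_le_reg_l with (Cmod e); [lra|].
    rewrite Q, F, S. rewrite F, S in K. lra.
Qed.

(** * Goursat's lemma and primitives on convex sets *)

Definition seg_point (a b : C) (s : R) : C := (a + RtoC s * (b - a))%C.

Definition seg_int (f : C -> C) (a b : C) : C :=
  (RInt (fun s => fst (f (seg_point a b s) * (b - a))%C) 0 1,
   RInt (fun s => snd (f (seg_point a b s) * (b - a))%C) 0 1).

Definition seg_cont (f : C -> C) (a b : C) : Prop :=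
  forall s, 0 <= s <= 1 -> ccont f (seg_point a b s).

Lemma seg_point_lip (a b : C) (s t : R) :
  Cmod (seg_point a b s - seg_point a b t) = Rabs (s - t) * Cmod (b - a).
Proof.
  unfold seg_point. rewrite <- Cmod_R, <- Cmod_mult. f_equal.
  rewrite RtoC_minus. ring.
Qed.

Lemma continuous_eps (f : R -> R) (x : R) :
  (forall eps, 0 < eps -> exists d, 0 < d /\ forall y, Rabs (y - x) < d -> Rabs (f y - f x) < eps) ->
  continuous f x.
Proof.
  intros H. apply filterlim_locally. intros [e He].
  destruct (H e He) as [d [Hd Hy]]. exists (mkposreal d Hd). intros y By. apply Hy. exact By.
Qed.

Lemma seg_integrand_cont (f : C -> C) (a b k : C) (s : R) :
  ccont f (seg_point a b s) ->
  continuous (fun s => fst (f (seg_point a b s) * k)%C) s /\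
  continuous (fun s => snd (f (seg_point a b s) * k)%C) s.
Proof.
  intros H.
  assert (K : forall eps, 0 < eps -> exists d, 0 < d /\ forall y, Rabs (y - s) < d ->
     Cmod (f (seg_point a b y) * k - f (seg_point a b s) * k) < eps).
  { intros eps He. assert (Pk := Cmod_ge_0 k).
    destruct (H (eps / (Cmod k + 1))) as [d [Hd Hw]]; [apply Rdiv_lt_0_compat; lra|].
    assert (Pba := Cmod_ge_0 (b - a)).
    exists (d / (Cmod (b - a) + 1)); split; [apply Rdiv_lt_0_compat; lra|].
    intros y Hy.
    replace (f (seg_point a b y) * k - f (seg_point a b s) * k)%C
      with ((f (seg_point a b y) - f (seg_point a b s)) * k)%C by ring.
    rewrite Cmod_mult.
    assert (X : Cmod (seg_point a b y - seg_point a b s) < d).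
    { rewrite seg_point_lip. assert (P := Rabs_pos (y - s)).
      apply Rle_lt_trans with (Rabs (y - s) * (Cmod (b - a) + 1)); [nra|].
      replace d with (d / (Cmod (b - a) + 1) * (Cmod (b - a) + 1)) by (field; lra).
      apply Rmult_lt_compat_r; lra. }
    specialize (Hw _ X).
    replace eps with (eps / (Cmod k + 1) * (Cmod k + 1)) by (field; lra).
    apply Rle_lt_trans with (Cmod (f (seg_point a b y) - f (seg_point a b s)) * (Cmod k + 1)).
    - assert (Q := Cmod_ge_0 (f (seg_point a b y) - f (seg_point a b s))). nra.
    - apply Rmult_lt_compat_r; lra. }
  split; apply continuous_eps; intros eps He; destruct (K eps He) as [d [Hd Hy]];
    exists d; split; auto; intros y Hyd; eapply Rle_lt_trans; [|exact (Hy y Hyd)| |exact (Hy y Hyd)].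
  - eapply Rle_trans; [|apply Rabs_fst_le]. right; f_equal; simpl; ring.
  - eapply Rle_trans; [|apply Rabs_snd_le]. right; f_equal; simpl; ring.
Qed.

Lemma seg_ex (f : C -> C) (a b k : C) (s0 s1 : R) :
  seg_cont f a b -> 0 <= s0 <= s1 -> s1 <= 1 ->
  ex_RInt (fun s => fst (f (seg_point a b s) * k)%C) s0 s1 /\
  ex_RInt (fun s => snd (f (seg_point a b s) * k)%C) s0 s1.
Proof.
  intros H H0 H1.
  split; apply (ex_RInt_continuous (V := R_CompleteNormedModule)); intros z Hz;
    rewrite Rmin_left, Rmax_right in Hz by lra; apply (seg_integrand_cont f a b k z); apply H; lra.
Qed.

Lemma seg_int_rev (f : C -> C) (a b : C) :
  seg_cont f a b -> seg_int f b a = (- seg_int f a b)%C.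
Proof.
  intros H. destruct (seg_ex f a b (b - a) 0 1 H ltac:(lra) ltac:(lra)) as [E1 E2].
  unfold seg_int.
  assert (P : forall s, seg_point b a s = seg_point a b (-1 * s + 1)).
  { intros s. unfold seg_point. apply injective_projections; simpl; ring. }
  assert (Q1 := RInt_comp_lin (V := R_CompleteNormedModule)
     (fun s => fst (f (seg_point a b s) * (b - a))%C) (-1) 1 0 1).
  assert (Q2 := RInt_comp_lin (V := R_CompleteNormedModule)
     (fun s => snd (f (seg_point a b s) * (b - a))%C) (-1) 1 0 1).
  replace (-1 * 0 + 1) with 1 in * by ring. replace (-1 * 1 + 1) with 0 in * by ring.
  specialize (Q1 (ex_RInt_swap _ _ _ E1)). specialize (Q2 (ex_RInt_swap _ _ _ E2)).
  rewrite <- (opp_RInt_swap _ _ _ E1) in Q1. rewrite <- (opp_RInt_swap _ _ _ E2) in Q2.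
  unfold Copp; cbn [fst snd]. f_equal.
  - etransitivity; [|exact Q1]. apply RInt_ext. intros s _. rewrite P.
    unfold scal; simpl; unfold mult; simpl. ring.
  - etransitivity; [|exact Q2]. apply RInt_ext. intros s _. rewrite P.
    unfold scal; simpl; unfold mult; simpl. ring.
Qed.

Definition midp (a b : C) : C := ((a + b) / 2)%C.

Lemma seg_int_split (f : C -> C) (a b : C) :
  seg_cont f a b -> seg_int f a b = (seg_int f a (midp a b) + seg_int f (midp a b) b)%C.
Proof.
  intros H.
  destruct (seg_ex f a b (b - a) 0 (1/2) H ltac:(lra) ltac:(lra)) as [E1 E2].
  destruct (seg_ex f a b (b - a) (1/2) 1 H ltac:(lra) ltac:(lra)) as [E3 E4].
  assert (two : (RtoC 2 <> 0)%C). { intros X. injection X. lra. }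
  assert (half : RtoC (1/2) = (/ 2)%C).
  { replace (1/2) with (/2) by field. rewrite RtoC_inv by lra. reflexivity. }
  assert (P1 : forall s, seg_point a (midp a b) s = seg_point a b (1/2 * s + 0)).
  { intros s. unfold seg_point, midp. rewrite RtoC_plus, RtoC_mult, half. field; auto. }
  assert (P2 : forall s, seg_point (midp a b) b s = seg_point a b (1/2 * s + 1/2)).
  { intros s. unfold seg_point, midp. rewrite RtoC_plus, RtoC_mult, half. field; auto. }
  assert (D1 : (midp a b - a = RtoC (1/2) * (b - a))%C) by (unfold midp; rewrite half; field; auto).
  assert (D2 : (b - midp a b = RtoC (1/2) * (b - a))%C) by (unfold midp; rewrite half; field; auto).
  unfold seg_int. rewrite D1, D2.
  assert (M : forall (p : R -> R), ex_RInt p 0 (1/2) -> ex_RInt p (1/2) 1 ->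
    RInt p 0 1 = RInt (fun s => 1/2 * p (1/2 * s + 0)) 0 1 + RInt (fun s => 1/2 * p (1/2 * s + 1/2)) 0 1).
  { intros p X Y.
    rewrite <- (RInt_Chasles (V := R_CompleteNormedModule) p 0 (1/2) 1 X Y).
    assert (A1 := RInt_comp_lin (V := R_CompleteNormedModule) p (1/2) 0 0 1).
    assert (A2 := RInt_comp_lin (V := R_CompleteNormedModule) p (1/2) (1/2) 0 1).
    replace (1/2 * 0 + 0) with 0 in A1 by field. replace (1/2 * 1 + 0) with (1/2) in A1 by field.
    replace (1/2 * 0 + 1/2) with (1/2) in A2 by field. replace (1/2 * 1 + 1/2) with 1 in A2 by field.
    unfold plus; simpl. f_equal; symmetry; [apply A1 | apply A2]; auto. }
  unfold Cplus; cbn [fst snd]. rewrite (M _ E1 E3), (M _ E2 E4).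
  f_equal; f_equal; apply RInt_ext; intros s _; rewrite ?P1, ?P2; simpl; ring.
Qed.

(** An affine function integrates exactly to the increment of [P], so only the deviation [eta]
    counts; the factor 2 comes from bounding the two components separately. Goursat's lemma uses it
    with slope [df z], the primitive with slope 0. *)
Lemma seg_int_affine_close (f : C -> C) (a b al be z0 : C) (eta : R) :
  seg_cont f a b ->
  (forall s, 0 <= s <= 1 ->
     Cmod (f (seg_point a b s) - (al + be * (seg_point a b s - z0))) <= eta) ->
  let P := fun z => (al * z + be * ((z - z0) * (z - z0)) / 2)%C in
  Cmod (seg_int f a b - (P b - P a)) <= 2 * (eta * Cmod (b - a)).
Proof.
  intros H Hs P.
  destruct (seg_ex f a b (b - a) 0 1 H ltac:(lra) ltac:(lra)) as [E1 E2].
  assert (two : (RtoC 2 <> 0)%C). { intros X. injection X. lra. }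
  set (L := fun s => ((al + be * (seg_point a b s - z0)) * (b - a))%C).
  assert (DP : forall s, curve_deriv (fun s => P (seg_point a b s)) s (L s)).
  { intros s. eapply curve_deriv_eq.
    - apply (curve_deriv_comp P (seg_point a b) s (b - a) (al + be * (seg_point a b s - z0))).
      + apply curve_deriv_line.
      + eapply cderiv_eq.
        * unfold P. apply cderiv_plus.
          -- apply cderiv_scal. apply cderiv_id.
          -- apply (cderiv_mult (fun z => (be * ((z - z0) * (z - z0)))%C) (fun _ => (/ 2)%C)).
             ++ apply cderiv_scal. apply cderiv_mult; apply cderiv_minus;
                  [apply cderiv_id|apply cderiv_const|apply cderiv_id|apply cderiv_const].
             ++ apply cderiv_const.
        * cbv beta. field; auto.
    - reflexivity. }
  assert (I1 : is_RInt (fun s => fst (L s)) 0 1 (fst (P b - P a)%C)).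
  { replace (fst (P b - P a)%C) with (minus (fst (P (seg_point a b 1))) (fst (P (seg_point a b 0)))).
    2:{ replace (seg_point a b 1) with b by (unfold seg_point; ring).
        replace (seg_point a b 0) with a by (unfold seg_point; ring).
        unfold minus, plus, opp; simpl; ring. }
    apply (is_RInt_derive (V := R_CompleteNormedModule) (fun s => fst (P (seg_point a b s)))).
    - intros s _. apply DP.
    - intros s _. apply (ex_derive_continuous (K := R_AbsRing) (V := R_NormedModule)).
      unfold L, seg_point; simpl. auto_derive; auto. }
  assert (I2 : is_RInt (fun s => snd (L s)) 0 1 (snd (P b - P a)%C)).
  { replace (snd (P b - P a)%C) with (minus (snd (P (seg_point a b 1))) (snd (P (seg_point a b 0)))).
    2:{ replace (seg_point a b 1) with b by (unfold seg_point; ring).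
        replace (seg_point a b 0) with a by (unfold seg_point; ring).
        unfold minus, plus, opp; simpl; ring. }
    apply (is_RInt_derive (V := R_CompleteNormedModule) (fun s => snd (P (seg_point a b s)))).
    - intros s _. apply DP.
    - intros s _. apply (ex_derive_continuous (K := R_AbsRing) (V := R_NormedModule)).
      unfold L, seg_point; simpl. auto_derive; auto. }
  assert (J1 := is_RInt_minus _ _ _ _ _ _ (RInt_correct _ _ _ E1) I1).
  assert (J2 := is_RInt_minus _ _ _ _ _ _ (RInt_correct _ _ _ E2) I2).
  assert (B : forall s, 0 <= s <= 1 -> Cmod (f (seg_point a b s) * (b - a) - L s) <= eta * Cmod (b - a)).
  { intros s Hs'. unfold L.
    replace (f (seg_point a b s) * (b - a) - (al + be * (seg_point a b s - z0)) * (b - a))%C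
      with ((f (seg_point a b s) - (al + be * (seg_point a b s - z0))) * (b - a))%C by ring.
    rewrite Cmod_mult. apply Rmult_le_compat_r; [apply Cmod_ge_0|auto]. }
  eapply Rle_trans; [apply Cmod_le_sum|].
  replace (2 * (eta * Cmod (b - a))) with ((1 - 0) * (eta * Cmod (b - a)) + (1 - 0) * (eta * Cmod (b - a))) by ring.
  apply Rplus_le_compat.
  - refine (norm_RInt_le_const (V := R_NormedModule) _ 0 1 _ (eta * Cmod (b - a)) Rle_0_1 _ J1).
    intros s Hs'. eapply Rle_trans; [|exact (B s Hs')]. eapply Rle_trans; [|apply Rabs_fst_le].
    right. unfold norm; simpl. unfold abs; simpl. f_equal.
  - refine (norm_RInt_le_const (V := R_NormedModule) _ 0 1 _ (eta * Cmod (b - a)) Rle_0_1 _ J2).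
    intros s Hs'. eapply Rle_trans; [|exact (B s Hs')]. eapply Rle_trans; [|apply Rabs_snd_le].
    right. unfold norm; simpl. unfold abs; simpl. f_equal.
Qed.

(** [u n - 2 L / 2^n] increases and [u n + 2 L / 2^n] decreases, so the supremum of the former lies
    between the two for every n. *)
Lemma geometric_cauchy (u : nat -> R) (L : R) :
  (forall n, Rabs (u (S n) - u n) <= L / 2 ^ n) ->
  exists l, forall n, Rabs (u n - l) <= 2 * (L / 2 ^ n).
Proof.
  intros H.
  assert (Pw : forall n, 0 < 2 ^ n) by (intros n; apply pow_lt; lra).
  assert (E : forall n, L / 2 ^ n = 2 * (L / 2 ^ (S n))).
  { intros n. specialize (Pw n). simpl. field. lra. }
  assert (LP : forall n, 0 <= L / 2 ^ n). { intros n. eapply Rle_trans; [apply Rabs_pos|apply H]. }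
  assert (Up : forall n k, u (n + k)%nat + 2 * (L / 2 ^ (n + k)) <= u n + 2 * (L / 2 ^ n)).
  { intros n k. induction k; [rewrite Nat.add_0_r; lra|].
    rewrite Nat.add_succ_r. specialize (H (n + k)%nat). apply Rabs_le_between in H.
    assert (E' := E (n + k)%nat). lra. }
  assert (Dn : forall n k, u n - 2 * (L / 2 ^ n) <= u (n + k)%nat - 2 * (L / 2 ^ (n + k))).
  { intros n k. induction k; [rewrite Nat.add_0_r; lra|].
    rewrite Nat.add_succ_r. specialize (H (n + k)%nat). apply Rabs_le_between in H.
    assert (E' := E (n + k)%nat). lra. }
  destruct (completeness (fun x => exists n, x = u n - 2 * (L / 2 ^ n))) as [l [Hl1 Hl2]].
  - exists (u 0%nat + 2 * (L / 2 ^ 0)). intros x [n ->].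
    assert (X := Up 0%nat n). simpl Nat.add in X. specialize (LP n). lra.
  - exists (u 0%nat - 2 * (L / 2 ^ 0)). exists 0%nat; auto.
  - exists l. intros n. apply Rabs_le_between. split.
    + assert (l <= u n + 2 * (L / 2 ^ n)); [|lra].
      apply Hl2. intros x [m ->].
      destruct (Nat.le_ge_cases m n) as [Hmn|Hmn].
      * replace n with (m + (n - m))%nat by lia.
        assert (X := Dn m (n - m)%nat). assert (Y := LP (m + (n - m))%nat). lra.
      * replace m with (n + (m - n))%nat by lia.
        assert (X := Up n (m - n)%nat). assert (Y := LP (n + (m - n))%nat). lra.
    + assert (u n - 2 * (L / 2 ^ n) <= l); [|lra]. apply Hl1. exists n; auto.
Qed.

Definition tri_int (f : C -> C) (a b c : C) : C :=
  (seg_int f a b + seg_int f b c + seg_int f c a)%C.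

(* The convex open set is given as a sublevel set [{g < 0}], so that staying inside
   is inherited by limits of nested triangles. *)
Definition quasiconvex_lip (g : C -> R) : Prop :=
  (forall a b s, 0 <= s <= 1 -> g (seg_point a b s) <= Rmax (g a) (g b)) /\
  (forall a b, g a <= g b + Cmod (a - b)).

Section goursat.
Variables (g : C -> R) (f df : C -> C).
Hypothesis Hg : quasiconvex_lip g.
Hypothesis Hf : forall z, g z < 0 -> cderiv f z (df z).

Lemma seg_cont_sub (a b : C) : g a < 0 -> g b < 0 -> seg_cont f a b.
Proof.
  intros Ha Hb s Hs. eapply cderiv_ccont. apply Hf.
  eapply Rle_lt_trans; [apply (proj1 Hg); auto|]. apply Rmax_lub_lt; auto.
Qed.

Lemma midp_seg (a b : C) : midp a b = seg_point a b (1/2).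
Proof.
  assert (two : (RtoC 2 <> 0)%C). { intros X. injection X. lra. }
  unfold midp, seg_point. replace (1/2) with (/2) by field. rewrite RtoC_inv by lra. field; auto.
Qed.

Lemma g_midp (a b : C) (M : R) : g a <= M -> g b <= M -> g (midp a b) <= M.
Proof.
  intros Ha Hb. rewrite midp_seg. eapply Rle_trans; [apply (proj1 Hg); lra|]. apply Rmax_lub; auto.
Qed.

Lemma tri_int_split (a b c : C) : g a < 0 -> g b < 0 -> g c < 0 ->
  tri_int f a b c =
  (tri_int f a (midp a b) (midp c a) + tri_int f (midp a b) b (midp b c)
   + tri_int f (midp c a) (midp b c) c + tri_int f (midp a b) (midp b c) (midp c a))%C.
Proof.
  intros Ha Hb Hc.
  assert (Ka := Rlt_le _ _ (Rmax_lub_lt _ _ _ Ha (Rmax_lub_lt _ _ _ Hb Hc))).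
  assert (M : Rmax (g a) (Rmax (g b) (g c)) < 0) by (repeat apply Rmax_lub_lt; auto).
  assert (Ma := Rmax_l (g a) (Rmax (g b) (g c))).
  assert (Mb : g b <= Rmax (g a) (Rmax (g b) (g c))).
  { eapply Rle_trans; [|apply Rmax_r]. apply Rmax_l. }
  assert (Mc : g c <= Rmax (g a) (Rmax (g b) (g c))).
  { eapply Rle_trans; [|apply Rmax_r]. apply Rmax_r. }
  assert (Hab : g (midp a b) < 0) by (eapply Rle_lt_trans; [apply g_midp; eassumption|auto]).
  assert (Hbc : g (midp b c) < 0) by (eapply Rle_lt_trans; [apply g_midp; eassumption|auto]).
  assert (Hca : g (midp c a) < 0) by (eapply Rle_lt_trans; [apply g_midp; eassumption|auto]).
  unfold tri_int.
  rewrite (seg_int_split f a b), (seg_int_split f b c), (seg_int_split f c a)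
    by (apply seg_cont_sub; auto).
  rewrite (seg_int_rev f (midp c a) (midp a b)), (seg_int_rev f (midp a b) (midp b c)),
    (seg_int_rev f (midp b c) (midp c a)) by (apply seg_cont_sub; auto).
  rewrite (seg_int_rev f (midp b c) (midp a b)) by (apply seg_cont_sub; auto).
  rewrite (seg_int_rev f (midp a b) (midp b c)) by (apply seg_cont_sub; auto).
  ring.
Qed.

(** The invariant of the bisection: a fixed level [M < 0] keeps the triangles, and later their limit
    point, inside the open set; at each step [L] is halved while [K] loses a factor 4. *)
Definition tri_ok (M L K : R) (t : C * C * C) : Prop :=
  let '(a, b, c) := t in
  g a <= M /\ g b <= M /\ g c <= M /\
  Cmod (b - a) <= L /\ Cmod (c - b) <= L /\ Cmod (a - c) <= L /\
  K <= Cmod (tri_int f a b c).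

Lemma Cmod_half (z w : C) (L : R) : (w = z / 2)%C -> Cmod z <= L -> Cmod w <= L / 2.
Proof.
  intros -> H. rewrite Cmod_div. 2:{ intros X. injection X. lra. }
  rewrite Cmod_R, Rabs_right by lra. lra.
Qed.

Lemma tri_step (M L K : R) (t : C * C * C) : M < 0 -> tri_ok M L K t ->
  exists t', tri_ok M (L / 2) (K / 4) t' /\ Cmod (fst (fst t') - fst (fst t)) <= L.
Proof.
  destruct t as [[a b] c]. intros HM (Ha & Hb & Hc & Lab & Lbc & Lca & HK).
  assert (two : (RtoC 2 <> 0)%C). { intros X. injection X. lra. }
  assert (L0 : 0 <= L) by (eapply Rle_trans; [apply Cmod_ge_0|exact Lab]).
  rewrite (tri_int_split a b c) in HK by lra.
  assert (Gab := g_midp a b M Ha Hb). assert (Gbc := g_midp b c M Hb Hc). assert (Gca := g_midp c a M Hc Ha).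
  assert (S1 : forall w, (w = (b - a) / 2)%C \/ (w = (a - b) / 2)%C -> Cmod w <= L / 2).
  { intros w [E|E]; eapply Cmod_half; try exact E; auto. rewrite Cmod_minus_sym; auto. }
  assert (S2 : forall w, (w = (c - b) / 2)%C \/ (w = (b - c) / 2)%C -> Cmod w <= L / 2).
  { intros w [E|E]; eapply Cmod_half; try exact E; auto. rewrite Cmod_minus_sym; auto. }
  assert (S3 : forall w, (w = (a - c) / 2)%C \/ (w = (c - a) / 2)%C -> Cmod w <= L / 2).
  { intros w [E|E]; eapply Cmod_half; try exact E; auto. rewrite Cmod_minus_sym; auto. }
  assert (Q : K / 4 <= Cmod (tri_int f a (midp a b) (midp c a)) \/
              K / 4 <= Cmod (tri_int f (midp a b) b (midp b c)) \/
              K / 4 <= Cmod (tri_int f (midp c a) (midp b c) c) \/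
              K / 4 <= Cmod (tri_int f (midp a b) (midp b c) (midp c a))).
  { apply NNPP. intros N. apply not_or_and in N as [N1 N]. apply not_or_and in N as [N2 N].
    apply not_or_and in N as [N3 N4]. apply Rnot_le_lt in N1, N2, N3, N4.
    assert (X := Cmod_triangle (tri_int f a (midp a b) (midp c a) + tri_int f (midp a b) b (midp b c)
      + tri_int f (midp c a) (midp b c) c) (tri_int f (midp a b) (midp b c) (midp c a))).
    assert (Y := Cmod_triangle (tri_int f a (midp a b) (midp c a) + tri_int f (midp a b) b (midp b c))
       (tri_int f (midp c a) (midp b c) c)).
    assert (Z := Cmod_triangle (tri_int f a (midp a b) (midp c a)) (tri_int f (midp a b) b (midp b c))).
    lra. }
  destruct Q as [Q|[Q|[Q|Q]]].
  - exists (a, midp a b, midp c a). split.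
    + unfold tri_ok. repeat split; auto; [apply S1; left|apply S2; left|apply S3; left]; unfold midp; field; auto.
    + simpl. replace (a - a)%C with (RtoC 0) by ring. rewrite Cmod_0; auto.
  - exists (midp a b, b, midp b c). split.
    + unfold tri_ok. repeat split; auto; [apply S1; left|apply S2; left|apply S3; left]; unfold midp; field; auto.
    + simpl. apply Rle_trans with (L / 2); [|lra]. apply S1. left. unfold midp; field; auto.
  - exists (midp c a, midp b c, c). split.
    + unfold tri_ok. repeat split; auto; [apply S1; left|apply S2; left|apply S3; left]; unfold midp; field; auto.
    + simpl. apply Rle_trans with (L / 2); [|lra]. apply S3. right. unfold midp; field; auto.
  - exists (midp a b, midp b c, midp c a). split.
    + unfold tri_ok. repeat split; auto; [apply S3; right|apply S1; right|apply S2; right]; unfold midp; field; auto.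
    + simpl. apply Rle_trans with (L / 2); [|lra]. apply S1. left. unfold midp; field; auto.
Qed.

Lemma seg_point_close (a b z : C) (s r : R) :
  0 <= s <= 1 -> Cmod (a - z) <= r -> Cmod (b - z) <= r -> Cmod (seg_point a b s - z) <= r.
Proof.
  intros Hs Ha Hb.
  replace (seg_point a b s - z)%C with (RtoC (1 - s) * (a - z) + RtoC s * (b - z))%C.
  2:{ unfold seg_point. rewrite RtoC_minus. ring. }
  eapply Rle_trans; [apply Cmod_triangle|]. rewrite !Cmod_mult, !Cmod_R, !Rabs_right by lra. nra.
Qed.

(** The n-th triangle has an integral of at least K / 4^n, whereas the affine approximation of f at
    the common limit point bounds it by a small multiple of (L / 2^n)^2. *)
Lemma goursat (a b c : C) : g a < 0 -> g b < 0 -> g c < 0 -> tri_int f a b c = 0%C.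
Proof.
  intros Ha Hb Hc. apply Cmod_eq_0. apply NNPP. intros NK.
  set (K := Cmod (tri_int f a b c)) in *.
  assert (PK : 0 < K). { assert (X := Cmod_ge_0 (tri_int f a b c)). fold K in X. lra. }
  set (M := Rmax (g a) (Rmax (g b) (g c))).
  assert (HM : M < 0) by (unfold M; repeat apply Rmax_lub_lt; auto).
  set (L := Rmax (Cmod (b - a)) (Rmax (Cmod (c - b)) (Cmod (a - c)))).
  set (ok := fun n => tri_ok M (L / 2 ^ n) (K / 4 ^ n)).
  set (T := fix T n := match n with
     | O => (a, b, c)
     | S n => epsilon (inhabits (a, b, c)) (fun t' => ok (S n) t' /\ Cmod (fst (fst t') - fst (fst (T n))) <= L / 2 ^ n)
     end).
  assert (Hok0 : ok O (T O)).
  { unfold ok; simpl. unfold tri_ok, M, L, Rdiv. rewrite Rinv_1, !Rmult_1_r.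
    repeat split; try apply Rmax_l.
    - eapply Rle_trans; [|apply Rmax_r]. apply Rmax_l.
    - eapply Rle_trans; [|apply Rmax_r]. apply Rmax_r.
    - eapply Rle_trans; [|apply Rmax_r]. apply Rmax_l.
    - eapply Rle_trans; [|apply Rmax_r]. apply Rmax_r.
    - unfold K. lra. }
  assert (Ex : forall n t, ok n t -> exists t', ok (S n) t' /\ Cmod (fst (fst t') - fst (fst t)) <= L / 2 ^ n).
  { intros n t Hn. destruct (tri_step M (L / 2 ^ n) (K / 4 ^ n) t HM Hn) as [t' [H1 H2]].
    exists t'; split; auto. unfold ok.
    assert (0 < 2 ^ n) by (apply pow_lt; lra). assert (0 < 4 ^ n) by (apply pow_lt; lra).
    replace (L / 2 ^ S n) with (L / 2 ^ n / 2) by (simpl; field; lra).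
    replace (K / 4 ^ S n) with (K / 4 ^ n / 4) by (simpl; field; lra). auto. }
  assert (HT : forall n, ok n (T n) /\ Cmod (fst (fst (T (S n))) - fst (fst (T n))) <= L / 2 ^ n).
  { assert (St : forall n, ok n (T n) -> ok (S n) (T (S n)) /\ Cmod (fst (fst (T (S n))) - fst (fst (T n))) <= L / 2 ^ n).
    { intros n Hn. exact (epsilon_spec (inhabits (a, b, c)) _ (Ex n (T n) Hn)). }
    assert (A : forall n, ok n (T n)). { induction n; auto. apply St; auto. }
    intros n; split; auto. apply St; auto. }
  destruct (geometric_cauchy (fun n => fst (fst (fst (T n)))) L) as [l1 Hl1].
  { intros n. eapply Rle_trans; [|apply (HT n)]. eapply Rle_trans; [|apply Rabs_fst_le].
    right; f_equal. }
  destruct (geometric_cauchy (fun n => snd (fst (fst (T n)))) L) as [l2 Hl2].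
  { intros n. eapply Rle_trans; [|apply (HT n)]. eapply Rle_trans; [|apply Rabs_snd_le].
    right; f_equal. }
  set (z := (l1, l2) : C).
  assert (Hz : forall n, Cmod (fst (fst (T n)) - z) <= 4 * (L / 2 ^ n)).
  { intros n. eapply Rle_trans; [apply Cmod_le_sum|]. specialize (Hl1 n). specialize (Hl2 n).
    unfold Cminus, Cplus, Copp in *; simpl fst; simpl snd. unfold Rminus in *. lra. }
  assert (L0 : 0 <= L). { eapply Rle_trans; [apply Cmod_ge_0|]. apply Rmax_l. }
  assert (Small : forall e, 0 < e -> exists n, L / 2 ^ n < e).
  { intros e He. destruct (Pow_x_infinity 2 ltac:(rewrite Rabs_right; lra) (L / e + 1)) as [n Hn].
    exists n. specialize (Hn n (Nat.le_refl n)). rewrite Rabs_right in Hn by (left; apply pow_lt; lra).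
    assert (P : 0 < 2 ^ n) by (apply pow_lt; lra).
    apply Rmult_lt_reg_r with (2 ^ n); auto. replace (L / 2 ^ n * 2 ^ n) with L by (field; lra).
    apply Rlt_le_trans with (e * (L / e + 1)); [|apply Rmult_le_compat_l; lra].
    replace (e * (L / e + 1)) with (L + e) by (field; lra). lra. }
  (* The limit point is within 4 L / 2^n of a vertex where g <= M, and g is 1-Lipschitz; hence the
     threshold - M / 5. *)
  assert (gz : g z < 0).
  { destruct (Small (- M / 5)) as [n Hn]; [lra|].
    destruct (HT n) as [On _]. specialize (Hz n).
    destruct (T n) as [[a' b'] c']. simpl in Hz. destruct On as [G _].
    assert (X := proj2 Hg z a'). rewrite Cmod_minus_sym in X. lra. }
  (* The three sides contribute at most 30 eta r^2 with r = L / 2^n, so eta = K / (100 (1 + L)^2)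
     leaves less than K / 4^n; [1 + L] covers the case L = 0. *)
  set (eta := K / (2 * (25 * (1 + L) * (1 + L)) * 2)).
  assert (P1L : 0 < (1 + L) * (1 + L)) by nra.
  assert (He : 0 < eta). { unfold eta. apply Rdiv_lt_0_compat; auto. nra. }
  destruct (Hf z gz eta He) as [d [Hd Hw]].
  destruct (Small (d / 5)) as [n Hn]; [lra|].
  destruct (HT n) as [On _]. specialize (Hz n). destruct (T n) as [[a' b'] c']. simpl in Hz.
  destruct On as (Ga & Gb & Gc & S1 & S2 & S3 & HK).
  set (r := L / 2 ^ n) in *.
  assert (r0 : 0 <= r) by (eapply Rle_trans; [apply Cmod_ge_0|exact S1]).
  assert (za : Cmod (a' - z) <= 5 * r) by lra.
  assert (zb : Cmod (b' - z) <= 5 * r).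
  { assert (X := Cmod_minus_triangle b' a' z). lra. }
  assert (zc : Cmod (c' - z) <= 5 * r).
  { assert (X := Cmod_minus_triangle c' a' z). rewrite (Cmod_minus_sym c' a') in X. lra. }
  assert (Bd : forall p q, g p < 0 -> g q < 0 -> Cmod (p - z) <= 5 * r -> Cmod (q - z) <= 5 * r -> Cmod (q - p) <= r ->
    Cmod (seg_int f p q - ((f z * q + df z * ((q - z) * (q - z)) / 2) - (f z * p + df z * ((p - z) * (p - z)) / 2)))
      <= 2 * (eta * (5 * r) * r)).
  { intros p q Gp Gq Zp Zq Zpq.
    eapply Rle_trans.
    - apply (seg_int_affine_close f p q (f z) (df z) z (eta * (5 * r))).
      + apply seg_cont_sub; auto.
      + intros s Hs. assert (X := seg_point_close p q z s (5 * r) Hs Zp Zq).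
        replace (f (seg_point p q s) - (f z + df z * (seg_point p q s - z)))%C
          with (f (seg_point p q s) - f z - df z * (seg_point p q s - z))%C by ring.
        eapply Rle_trans; [apply Hw; lra|]. apply Rmult_le_compat_l; lra.
    - assert (0 <= eta * (5 * r)) by (apply Rmult_le_pos; lra).
      apply Rmult_le_compat_l; [lra|]. apply Rmult_le_compat_l; auto. }
  assert (B1 := Bd a' b' ltac:(lra) ltac:(lra) za zb S1).
  assert (B2 := Bd b' c' ltac:(lra) ltac:(lra) zb zc S2).
  assert (B3 := Bd c' a' ltac:(lra) ltac:(lra) zc za S3).
  assert (B : Cmod (tri_int f a' b' c') <= 30 * eta * (r * r)).
  { unfold tri_int. eapply Rle_trans; [|eapply Rle_trans; [apply (Rplus_le_compat _ _ _ _ (Rplus_le_compat _ _ _ _ B1 B2) B3)|right; ring]].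
    eapply Rle_trans; [|apply Rplus_le_compat_r; apply Cmod_triangle].
    eapply Rle_trans; [|apply Cmod_triangle]. right. f_equal. ring. }
  assert (P2 : 0 < 2 ^ n) by (apply pow_lt; lra).
  assert (P4 : 4 ^ n = 2 ^ n * 2 ^ n) by (rewrite <- Rpow_mult_distr; f_equal; lra).
  assert (F : K <= 30 * eta * (L * L)).
  { apply Rmult_le_reg_r with (/ 4 ^ n). { apply Rinv_0_lt_compat; apply pow_lt; lra. }
    eapply Rle_trans; [exact HK|]. eapply Rle_trans; [exact B|]. right. unfold r. rewrite P4. field. lra. }
  assert (F2 : 30 * eta * (L * L) <= 30 * eta * ((1 + L) * (1 + L))) by (apply Rmult_le_compat_l; nra).
  assert (F3 : eta * ((1 + L) * (1 + L)) = K / 100) by (unfold eta; field; lra).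
  lra.
Qed.

Theorem primitive_exists (z0 : C) : g z0 < 0 ->
  exists W, forall z, g z < 0 -> cderiv W z (f z).
Proof.
  intros H0. exists (fun z => seg_int f z0 z). intros z Hz eps He.
  destruct (cderiv_ccont f z (df z) (Hf z Hz) (eps / 2)) as [d [Hd Hw]]; [lra|].
  exists (Rmin d (- g z)); split; [apply Rmin_glb_lt; lra|]. intros w Hww.
  assert (L1 := Rmin_l d (- g z)). assert (L2 := Rmin_r d (- g z)).
  assert (Gw : g w < 0). { assert (X := proj2 Hg w z). lra. }
  assert (G := goursat z0 z w H0 Hz Gw). unfold tri_int in G.
  rewrite (seg_int_rev f z0 w) in G by (apply seg_cont_sub; auto).
  replace (seg_int f z0 w - seg_int f z0 z - f z * (w - z))%C
    with (seg_int f z w - f z * (w - z)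
      - (seg_int f z0 z + seg_int f z w + - seg_int f z0 w))%C by ring.
  rewrite G.
  assert (X := seg_int_affine_close f z w (f z) 0 z (eps / 2) (seg_cont_sub z w Hz Gw)).
  cbv beta zeta in X.
  replace (seg_int f z w - f z * (w - z) - 0)%C with
    (seg_int f z w - (f z * w + 0 * ((w - z) * (w - z)) / 2 - (f z * z + 0 * ((z - z) * (z - z)) / 2)))%C
    by (field; intros Y; injection Y; lra).
  eapply Rle_trans; [apply X|lra].
  intros s Hs.
  replace (f (seg_point z w s) - (f z + 0 * (seg_point z w s - z)))%C with (f (seg_point z w s) - f z)%C by ring.
  left. apply Hw.
  eapply Rle_lt_trans; [|exact (Rlt_le_trans _ _ _ Hww L1)].
  apply seg_point_close; auto; [|lra].
  replace (z - z)%C with (RtoC 0) by ring. rewrite Cmod_0. apply Cmod_ge_0.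
Qed.

End goursat.

(** * Mean values over circles *)

Ltac Cext := apply injective_projections; simpl.

Definition cexp (z : C) : C := Cexp z.

Lemma cexp_plus (z w : C) : cexp (z + w)%C = (cexp z * cexp w)%C.
Proof.
  unfold cexp, Cexp, Cscale; Cext; rewrite exp_plus, ?cos_plus, ?sin_plus; ring.
Qed.

Lemma Cmod_cexp (z : C) : Cmod (cexp z) = exp (fst z).
Proof.
  unfold Cmod, cexp, Cscale; simpl.
  assert (H := sin2_cos2 (snd z)). unfold Rsqr in H.
  match goal with |- sqrt ?a = _ => replace a with (exp (fst z) * exp (fst z)) end.
  - apply sqrt_square. left; apply exp_pos.
  - set (e := exp (fst z)). set (c := cos (snd z)) in *. set (s := sin (snd z)) in *.
    transitivity (e * e * (s * s + c * c)); [rewrite H|]; ring.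
Qed.

Lemma cexp_neq_0 (z : C) : cexp z <> 0%C.
Proof. apply Cmod_gt_0. rewrite Cmod_cexp. apply exp_pos. Qed.

Lemma cexp_period (z : C) : cexp (z + (0, 2 * PI)%R)%C = cexp z.
Proof.
  unfold cexp, Cexp, Cscale; Cext; rewrite Rplus_0_r, ?cos_2PI_neg; f_equal.
  - rewrite cos_plus, cos_2PI, sin_2PI. ring.
  - rewrite sin_plus, cos_2PI, sin_2PI. ring.
Qed.

Lemma cderiv_cexp (z : C) : cderiv cexp z (cexp z).
Proof.
  intros eps He.
  assert (Pz : 0 < Cmod (cexp z)) by (apply Cmod_gt_0, cexp_neq_0).
  (* The four error terms below add up to 1 + 2 + 2 + 1 = 6 times e D; the radius e / 2 is what
     makes |exp a - 1| <= e. *)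
  set (e := Rmin 1 (eps / (6 * Cmod (cexp z)))).
  assert (He' : 0 < e). { apply Rmin_glb_lt; [lra|]. apply Rdiv_lt_0_compat; lra. }
  assert (e1 : e <= 1) by apply Rmin_l.
  assert (e2 : Cmod (cexp z) * (6 * e) <= eps).
  { assert (X := Rmin_r 1 (eps / (6 * Cmod (cexp z)))). fold e in X.
    apply Rle_trans with (Cmod (cexp z) * (6 * (eps / (6 * Cmod (cexp z))))).
    - apply Rmult_le_compat_l; lra.
    - right. field. lra. }
  assert (D1 : is_derive exp 0 1). { replace 1 with (exp 0) by apply exp_0. apply is_derive_Reals, derivable_pt_lim_exp. }
  assert (D2 : is_derive cos 0 0).
  { replace 0 with (- sin 0) at 2 by (rewrite sin_0; ring). apply is_derive_Reals, derivable_pt_lim_cos. }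
  assert (D3 : is_derive sin 0 1). { replace 1 with (cos 0) by apply cos_0. apply is_derive_Reals, derivable_pt_lim_sin. }
  destruct (proj1 (is_derive_eps _ _ _) D1 e He') as [d1 [Hd1 H1]].
  destruct (proj1 (is_derive_eps _ _ _) D2 e He') as [d2 [Hd2 H2]].
  destruct (proj1 (is_derive_eps _ _ _) D3 e He') as [d3 [Hd3 H3]].
  exists (Rmin (Rmin d1 (e / 2)) (Rmin d2 d3)); split.
  { repeat apply Rmin_glb_lt; lra. }
  intros w Hw. set (d := (w - z)%C) in *.
  assert (L1 := Rmin_l (Rmin d1 (e / 2)) (Rmin d2 d3)). assert (L2 := Rmin_r (Rmin d1 (e / 2)) (Rmin d2 d3)).
  assert (L3 := Rmin_l d1 (e / 2)). assert (L4 := Rmin_r d1 (e / 2)).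
  assert (L5 := Rmin_l d2 d3). assert (L6 := Rmin_r d2 d3).
  replace (cexp w - cexp z - cexp z * d)%C with (cexp z * (cexp d - 1 - d))%C.
  2:{ replace w with (z + d)%C by (unfold d; ring). rewrite cexp_plus. ring. }
  rewrite Cmod_mult. clearbody d.
  assert (A := Rabs_fst_le d). assert (B := Rabs_snd_le d).
  set (D := Cmod d) in *.
  assert (PA := Rabs_pos (fst d)). assert (PB := Rabs_pos (snd d)).
  specialize (H1 (fst d)). specialize (H2 (snd d)). specialize (H3 (snd d)).
  rewrite !Rminus_0_r in H1, H2, H3.
  specialize (H1 ltac:(lra)). specialize (H2 ltac:(lra)). specialize (H3 ltac:(lra)).
  rewrite exp_0 in H1. rewrite cos_0 in H2. rewrite sin_0 in H3.
  assert (X : Cmod (cexp d - 1 - d) <= 6 * e * D).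
  { eapply Rle_trans; [apply Cmod_le_sum|]. unfold cexp, Cexp, Cscale; simpl.
    set (a := fst d) in *. set (b := snd d) in *.
    set (ea := exp a) in *. set (cb := cos b) in *. set (sb := sin b) in *.
    replace (ea * cb + - (1) + - a) with ((ea - 1 - 1 * a) + ea * (cb - 1 - 0 * b)) by ring.
    replace (ea * sb + - 0 + - b) with (ea * (sb - 0 - 1 * b) + (ea - 1) * b) by ring.
    assert (Y : Rabs (ea - 1) <= 2 * Rabs a).
    { replace (ea - 1) with ((ea - 1 - 1 * a) + a) by ring. eapply Rle_trans; [apply Rabs_triang|]. nra. }
    assert (Z : Rabs ea <= 2).
    { replace ea with ((ea - 1) + 1) by ring. eapply Rle_trans; [apply Rabs_triang|]. rewrite Rabs_R1. lra. }
    assert (T1 := Rabs_triang (ea - 1 - 1 * a) (ea * (cb - 1 - 0 * b))).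
    assert (T2 := Rabs_triang (ea * (sb - 0 - 1 * b)) ((ea - 1) * b)).
    rewrite Rabs_mult in T1. rewrite !Rabs_mult in T2.
    assert (P1 := Rabs_pos (cb - 1 - 0 * b)). assert (P2 := Rabs_pos (sb - 0 - 1 * b)).
    assert (P3 := Rabs_pos ea). assert (P4 := Rabs_pos (ea - 1)).
    assert (M1 : Rabs ea * Rabs (cb - 1 - 0 * b) <= 2 * (e * D)).
    { apply Rmult_le_compat; auto. eapply Rle_trans; [exact H2|]. apply Rmult_le_compat_l; lra. }
    assert (M2 : Rabs ea * Rabs (sb - 0 - 1 * b) <= 2 * (e * D)).
    { apply Rmult_le_compat; auto. eapply Rle_trans; [exact H3|]. apply Rmult_le_compat_l; lra. }
    assert (M3 : Rabs (ea - 1) * Rabs b <= e * D).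
    { apply Rmult_le_compat; auto. lra. }
    assert (M4 : e * Rabs a <= e * D) by (apply Rmult_le_compat_l; lra).
    lra. }
  assert (PD : 0 <= D) by apply Cmod_ge_0.
  apply Rle_trans with (Cmod (cexp z) * (6 * e * D)); [apply Rmult_le_compat_l; lra|].
  replace (Cmod (cexp z) * (6 * e * D)) with (Cmod (cexp z) * (6 * e) * D) by ring.
  apply Rmult_le_compat_r; auto.
Qed.

Lemma halfplane_quasiconvex (c : R) : quasiconvex_lip (fun z => fst z - c).
Proof.
  split.
  - intros a b s Hs. unfold seg_point; simpl.
    assert (X := Rmax_l (fst a - c) (fst b - c)). assert (Y := Rmax_r (fst a - c) (fst b - c)). nra.
  - intros a b. assert (X := Rabs_fst_le (a - b)). apply Rabs_le_between in X. simpl in X. lra.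
Qed.

Lemma curve_increment_const_le (g dg : R -> C) (B a b : R) :
  a <= b -> (forall t, a <= t <= b -> curve_deriv g t (dg t)) ->
  (forall t, a <= t <= b -> Cmod (dg t) <= B) -> Cmod (g b - g a) <= B * (b - a).
Proof.
  intros Hab Hg HB.
  replace (B * (b - a)) with (B * b - B * a) by ring.
  apply (curve_increment_le g dg (fun t => B * t) (fun _ => B) a b Hab Hg).
  - intros t _. auto_derive; auto; ring.
  - auto.
Qed.

Lemma Cmod_Ci_mult (z : C) : Cmod (Ci * z) = Cmod z.
Proof. rewrite Cmod_mult, Cmod_Ci. ring. Qed.

Lemma curve_deriv_vertical (f : C -> C) (x t : R) (l : C) :
  cderiv f (x, t) l -> curve_deriv (fun s => f (x, s)) t (Ci * l).
Proof.
  intros H. eapply curve_deriv_eq.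
  - apply (curve_deriv_comp f (fun s => (x, s)) t Ci l); auto.
    split; simpl; auto_derive; auto.
  - ring.
Qed.

Lemma curve_deriv_horizontal (f : C -> C) (x t : R) (l : C) :
  cderiv f (x, t) l -> curve_deriv (fun s => f (s, t)) x l.
Proof.
  intros H. eapply curve_deriv_eq.
  - apply (curve_deriv_comp f (fun s => (s, t)) x 1 l); auto.
    split; simpl; auto_derive; auto.
  - ring.
Qed.

Lemma curve_deriv_minus (f g : R -> C) t v w :
  curve_deriv f t v -> curve_deriv g t w -> curve_deriv (fun s => f s - g s)%C t (v - w).
Proof.
  intros [A1 A2] [B1 B2]; split.
  - apply (is_derive_minus (K := R_AbsRing) (V := R_NormedModule) _ _ _ _ _ A1 B1).
  - apply (is_derive_minus (K := R_AbsRing) (V := R_NormedModule) _ _ _ _ _ A2 B2).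
Qed.

(* [F] is [f (z0 + e^z)] times a power of [e^z]; its integral over a period does not depend
   on the abscissa and is computed at abscissa minus infinity. *)
Lemma periodic_loop (F dF P Q : C -> C) (c : R) (L : C) :
  (forall z, fst z < c -> cderiv F z (dF z)) ->
  (forall z, F (z + (0, 2 * PI)%R)%C = F z) ->
  (forall z, cderiv P z (Q z)) -> (forall z, P (z + (0, 2 * PI)%R)%C = P z) ->
  (forall eta, 0 < eta -> exists x, x < c /\ forall t, Cmod (F (x, t) - Q (x, t) - L) <= eta) ->
  exists W, (forall z, fst z < c -> cderiv W z (F z)) /\
    forall x, x < c -> (W (x, 2 * PI)%R - W (x, 0) = RtoC (2 * PI) * Ci * L)%C.
Proof.
  intros HF HFp HP HPp HL.
  destruct (primitive_exists (fun z => fst z - c) F dF (halfplane_quasiconvex c)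
    (fun z Hz => HF z ltac:(lra)) (RtoC (c - 1)) ltac:(simpl; lra)) as [W HW].
  exists W. assert (HW' : forall z, fst z < c -> cderiv W z (F z)) by (intros; apply HW; lra).
  split; auto. clear HW.
  assert (PI0 := PI_RGT_0).
  assert (Cst : forall x y, x <= y -> y < c -> (W (x, 2 * PI)%R - W (x, 0) = W (y, 2 * PI)%R - W (y, 0))%C).
  { intros x y Hxy Hy.
    assert (X := curve_increment_const_le (fun s => W (s, 2 * PI)%R - W (s, 0))%C
       (fun s => F (s, 2 * PI)%R - F (s, 0))%C 0 x y Hxy).
    assert (Y : Cmod (W (y, 2 * PI)%R - W (y, 0) - (W (x, 2 * PI)%R - W (x, 0))) <= 0 * (y - x)).
    { apply X.
      - intros t Ht. apply curve_deriv_minus; apply curve_deriv_horizontal; apply HW'; simpl; lra.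
      - intros t Ht. right.
        replace (F (t, 2 * PI)%R - F (t, 0))%C with (RtoC 0); [apply Cmod_0|].
        rewrite <- (HFp (t, 0)). replace ((t, 0) + (0, 2 * PI)%R)%C with ((t, 2 * PI)%R : C); [ring|].
        Cext; ring. }
    rewrite Rmult_0_l in Y.
    symmetry. rewrite <- (Cplus_0_r (W (x, 2 * PI)%R - W (x, 0))).
    rewrite <- (Cmod_eq_0 (W (y, 2 * PI)%R - W (y, 0) - (W (x, 2 * PI)%R - W (x, 0)))).
    - ring.
    - apply Rle_antisym; auto. apply Cmod_ge_0. }
  intros x0 Hx0.
  set (A := (W (x0, 2 * PI)%R - W (x0, 0))%C).
  assert (CstA : forall x, x < c -> (W (x, 2 * PI)%R - W (x, 0) = A)%C).
  { intros x Hx. unfold A. destruct (Rle_lt_dec x x0); [apply Cst; auto|symmetry; apply Cst; lra]. }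
  assert (Z : Cmod (A - RtoC (2 * PI) * Ci * L) = 0).
  { apply Rle_antisym; [|apply Cmod_ge_0]. apply Rnot_lt_le. intros Pos.
    set (k := Cmod (A - RtoC (2 * PI) * Ci * L)) in *.
    destruct (HL (k / (4 * PI))) as [x [Hx Hxt]]; [apply Rdiv_lt_0_compat; lra|].
    (* The part [Q] of [F], which need not be small, has the periodic primitive [P] and so
       contributes nothing over a period; the rest of [F] is within k / (4 pi) of [L], which over
       the length 2 pi gives only k / 2. *)
    assert (X := curve_increment_const_le (fun s => W (x, s) - P (x, s) - RtoC s * (Ci * L))%C
       (fun s => Ci * F (x, s) - Ci * Q (x, s) - Ci * L)%C (k / (4 * PI)) 0 (2 * PI) ltac:(lra)).
    cbv beta in X.
    assert (Y : (W (x, 2 * PI)%R - P (x, 2 * PI)%R - RtoC (2 * PI) * (Ci * L) - (W (x, 0) - P (x, 0) - RtoC 0 * (Ci * L))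
       = A - RtoC (2 * PI) * Ci * L)%C).
    { rewrite <- (CstA x Hx).
      replace (P (x, 2 * PI)%R) with (P (x, 0)); [ring|].
      rewrite <- (HPp (x, 0)). f_equal. Cext; ring. }
    rewrite Y in X.
    assert (B : k <= k / (4 * PI) * (2 * PI - 0)).
    { apply X.
      - intros t _. apply curve_deriv_minus; [apply curve_deriv_minus|].
        + apply curve_deriv_vertical. apply HW'; auto.
        + apply curve_deriv_vertical. apply HP.
        + split; simpl; auto_derive; auto; ring.
      - intros t _.
        replace (Ci * F (x, t) - Ci * Q (x, t) - Ci * L)%C with (Ci * (F (x, t) - Q (x, t) - L))%C by ring.
        rewrite Cmod_Ci_mult. apply Hxt. }
    replace (k / (4 * PI) * (2 * PI - 0)) with (k / 2) in B by (field; lra). lra. }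
  apply Cmod_eq_0 in Z. rewrite <- (Cplus_0_r (RtoC (2 * PI) * Ci * L)). rewrite <- Z. ring.
Qed.

Lemma Cmult_cancel_l (k a b : C) : k <> 0%C -> (k * a = k * b)%C -> a = b.
Proof.
  intros Hk E. transitivity (/ k * (k * a))%C; [field; auto|]. rewrite E. field; auto.
Qed.

Section centre.
Variables (f df : C -> C) (z0 : C) (R0 : R).
Hypothesis HR : 0 < R0.
Hypothesis Hf : forall z, Cmod (z - z0) < R0 -> cderiv f z (df z).

Lemma exp_in_disc (z : C) : fst z < ln R0 -> Cmod (z0 + cexp z - z0) < R0.
Proof.
  intros H. replace (z0 + cexp z - z0)%C with (cexp z) by ring. rewrite Cmod_cexp.
  rewrite <- (exp_ln R0 HR). apply exp_increasing; auto.
Qed.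

Lemma cderiv_f_exp (z : C) : fst z < ln R0 ->
  cderiv (fun z => f (z0 + cexp z)%C) z (df (z0 + cexp z)%C * cexp z).
Proof.
  intros H. apply (cderiv_comp (fun z => z0 + cexp z)%C f).
  - eapply cderiv_eq; [apply cderiv_plus; [apply cderiv_const|apply cderiv_cexp]|ring].
  - apply Hf, exp_in_disc; auto.
Qed.

Lemma exp_small (d : R) : 0 < d -> exists x, x < ln R0 /\ exp x < d.
Proof.
  intros Hd. exists (Rmin (ln R0) (ln d) - 1).
  assert (L1 := Rmin_l (ln R0) (ln d)). assert (L2 := Rmin_r (ln R0) (ln d)).
  split; [lra|]. rewrite <- (exp_ln d Hd) at 2. apply exp_increasing. lra.
Qed.

(** In the variable log (zeta - z0) the three loop lemmas are Cauchy's formulas for the Laurent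
    coefficients 0, -1 and 1 of f at z0: the increment of [W] is the integral of i f, i f e^z and i
    f e^-z over a period. *)
Lemma loop_0 : exists W,
  (forall z, fst z < ln R0 -> cderiv W z (f (z0 + cexp z)%C)) /\
  forall x, x < ln R0 -> (W (x, 2 * PI)%R - W (x, 0) = RtoC (2 * PI) * Ci * f z0)%C.
Proof.
  apply (periodic_loop (fun z => f (z0 + cexp z)%C) (fun z => df (z0 + cexp z) * cexp z)%C
    (fun _ => RtoC 0) (fun _ => RtoC 0) (ln R0) (f z0)).
  - exact cderiv_f_exp.
  - intros z. rewrite cexp_period; auto.
  - intros; apply cderiv_const.
  - auto.
  - intros eta He.
    destruct (cderiv_ccont f z0 (df z0)) with (eps := eta) as [d [Hd Hw]]; auto.
    { apply Hf. replace (z0 - z0)%C with (RtoC 0) by ring. rewrite Cmod_0; auto. }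
    destruct (exp_small d Hd) as [x [Hx Hxd]]. exists x; split; auto. intros t. left.
    replace (f (z0 + cexp (x, t)) - 0 - f z0)%C with (f (z0 + cexp (x, t)) - f z0)%C by ring.
    apply Hw. replace (z0 + cexp (x, t) - z0)%C with (cexp (x, t)) by ring. rewrite Cmod_cexp. auto.
Qed.

Lemma loop_1 : exists W,
  (forall z, fst z < ln R0 -> cderiv W z (f (z0 + cexp z) * cexp z)%C) /\
  forall x, x < ln R0 -> (W (x, 2 * PI)%R - W (x, 0) = RtoC (2 * PI) * Ci * 0)%C.
Proof.
  apply (periodic_loop (fun z => f (z0 + cexp z) * cexp z)%C (fun z => df (z0 + cexp z) * cexp z * cexp z + f (z0 + cexp z) * cexp z)%C
    (fun _ => RtoC 0) (fun _ => RtoC 0) (ln R0) 0).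
  - intros z Hz. exact (cderiv_mult _ _ _ _ _ (cderiv_f_exp z Hz) (cderiv_cexp z)).
  - intros z. rewrite cexp_period; auto.
  - intros; apply cderiv_const.
  - auto.
  - intros eta He.
    destruct (cderiv_ccont f z0 (df z0)) with (eps := 1) as [d [Hd Hw]]; [|lra|].
    { apply Hf. replace (z0 - z0)%C with (RtoC 0) by ring. rewrite Cmod_0; auto. }
    assert (P := Cmod_ge_0 (f z0)).
    destruct (exp_small (Rmin d (eta / (Cmod (f z0) + 1)))) as [x [Hx Hxd]].
    { apply Rmin_glb_lt; auto. apply Rdiv_lt_0_compat; lra. }
    assert (L1 := Rmin_l d (eta / (Cmod (f z0) + 1))). assert (L2 := Rmin_r d (eta / (Cmod (f z0) + 1))).
    exists x; split; auto. intros t.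
    replace (f (z0 + cexp (x, t)) * cexp (x, t) - 0 - 0)%C with (f (z0 + cexp (x, t)) * cexp (x, t))%C by ring.
    rewrite Cmod_mult, Cmod_cexp. simpl fst.
    assert (Y : Cmod (f (z0 + cexp (x, t))) <= Cmod (f z0) + 1).
    { assert (T := Cmod_triangle_inv (f (z0 + cexp (x, t))) (f z0)).
      assert (X := Hw (z0 + cexp (x, t))%C).
      replace (z0 + cexp (x, t) - z0)%C with (cexp (x, t)) in X by ring. rewrite Cmod_cexp in X.
      simpl fst in X. specialize (X ltac:(lra)). lra. }
    replace eta with ((Cmod (f z0) + 1) * (eta / (Cmod (f z0) + 1))) by (field; lra).
    apply Rmult_le_compat; auto; try lra. apply Cmod_ge_0. left; apply exp_pos.
Qed.

(** The quotient f (z0 + e^z) / e^z blows up like f z0 / e^z as the abscissa tends to minus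
    infinity; that term has the periodic primitive - f z0 / e^z and is removed, and df z0
    remains. *)
Lemma loop_m1 : exists W,
  (forall z, fst z < ln R0 -> cderiv W z (f (z0 + cexp z) * / cexp z)%C) /\
  forall x, x < ln R0 -> (W (x, 2 * PI)%R - W (x, 0) = RtoC (2 * PI) * Ci * df z0)%C.
Proof.
  assert (Dinv : forall z, cderiv (fun z => / cexp z)%C z (- / cexp z)%C).
  { intros z. eapply cderiv_eq.
    - apply cderiv_inv; [apply cderiv_cexp|apply cexp_neq_0].
    - field. apply cexp_neq_0. }
  apply (periodic_loop (fun z => f (z0 + cexp z) * / cexp z)%C (fun z => df (z0 + cexp z) * cexp z * / cexp z + f (z0 + cexp z) * - / cexp z)%C
    (fun z => - f z0 * / cexp z)%C (fun z => - f z0 * - / cexp z)%C (ln R0) (df z0)).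
  - intros z Hz. exact (cderiv_mult _ _ _ _ _ (cderiv_f_exp z Hz) (Dinv z)).
  - intros z. rewrite cexp_period; auto.
  - intros z. apply cderiv_scal. apply Dinv.
  - intros z. rewrite cexp_period; auto.
  - intros eta He.
    destruct (Hf z0) with (eps := eta) as [d [Hd Hw]]; auto.
    { replace (z0 - z0)%C with (RtoC 0) by ring. rewrite Cmod_0; auto. }
    destruct (exp_small d Hd) as [x [Hx Hxd]].
    exists x; split; auto. intros t.
    assert (N := cexp_neq_0 (x, t)).
    specialize (Hw (z0 + cexp (x, t))%C).
    replace (z0 + cexp (x, t) - z0)%C with (cexp (x, t)) in Hw by ring. rewrite Cmod_cexp in Hw.
    simpl fst in Hw. specialize (Hw Hxd).
    replace (f (z0 + cexp (x, t)) * / cexp (x, t) - - f z0 * - / cexp (x, t) - df z0)%C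
      with ((f (z0 + cexp (x, t)) - f z0 - df z0 * cexp (x, t)) * / cexp (x, t))%C by (field; auto).
    rewrite Cmod_mult, Cmod_inv, Cmod_cexp by auto. simpl fst.
    assert (E := exp_pos x).
    apply Rmult_le_reg_r with (exp x); auto. rewrite Rmult_assoc, Rinv_l, Rmult_1_r by lra. exact Hw.
Qed.

Lemma circle_param (r t : R) : 0 < r -> cexp (ln r, t) = (RtoC r * (cos t, sin t))%C.
Proof. intros Hr. unfold cexp, Cexp, Cscale; Cext; rewrite exp_ln by auto; ring. Qed.

Lemma mean_value_bound (r B : R) : 0 < r < R0 ->
  (forall t, 0 <= t <= 2 * PI -> Cmod (f (z0 + RtoC r * (cos t, sin t))%C) <= B) -> Cmod (f z0) <= B.
Proof.
  intros Hr HB. destruct loop_0 as [W [HW HA]].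
  assert (Hln : ln r < ln R0) by (apply ln_increasing; lra).
  specialize (HA (ln r) Hln). assert (PI0 := PI_RGT_0).
  assert (X := curve_increment_const_le (fun s => W (ln r, s)) (fun s => Ci * f (z0 + cexp (ln r, s)))%C B 0 (2 * PI) ltac:(lra)).
  cbv beta in X. rewrite HA in X.
  rewrite !Cmod_mult, Cmod_Ci, Cmod_R, Rabs_right in X by lra.
  apply Rmult_le_reg_l with (2 * PI); [lra|].
  eapply Rle_trans; [|eapply Rle_trans; [apply X|]].
  - right; ring.
  - intros t _. apply curve_deriv_vertical. apply HW; auto.
  - intros t Ht. rewrite Cmod_Ci_mult, circle_param by lra. auto.
  - right; ring.
Qed.

(** On the circle of radius r, Re f is averaged against the nonnegative kernel 1 - cos (t - arg ka),
    where the unimodular [ka] turns [df z0] into its modulus. By the three loops the average is Re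
    (f z0) - (r / 2) |df z0|, hence nonnegative. *)
Lemma deriv_le_Re : (forall z, Cmod (z - z0) < R0 -> 0 <= Re (f z)) ->
  R0 * Cmod (df z0) <= 2 * Re (f z0).
Proof.
  intros Hp.
  destruct (Req_dec (Cmod (df z0)) 0) as [Z|NZ].
  { rewrite Z, Rmult_0_r. assert (0 <= Re (f z0)); [|lra]. apply Hp.
    replace (z0 - z0)%C with (RtoC 0) by ring. rewrite Cmod_0; auto. }
  set (k := Cmod (df z0)) in *. assert (Pk : 0 < k) by (assert (X := Cmod_ge_0 (df z0)); fold k in X; lra).
  assert (Main : forall r, 0 < r < R0 -> r * k <= 2 * Re (f z0)).
  { intros r Hr.
    assert (Hln : ln r < ln R0) by (apply ln_increasing; lra). assert (PI0 := PI_RGT_0).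
    destruct loop_0 as [W0 [H0 A0]]. destruct loop_1 as [W1 [H1 A1]]. destruct loop_m1 as [W2 [H2 A2]].
    specialize (A0 _ Hln). specialize (A1 _ Hln). specialize (A2 _ Hln).
    set (ka := (Cconj (df z0) / RtoC k)%C).
    assert (ka1 : Cmod ka = 1).
    { unfold ka. rewrite Cmod_div, Cmod_conj, Cmod_R, Rabs_right by (try (intros X; injection X); lra).
      fold k. field. lra. }
    assert (kd : (ka * df z0 = RtoC k)%C).
    { unfold ka. assert (kn : RtoC k <> 0%C) by (intros X; injection X; lra).
      apply (Cmult_cancel_l (RtoC k)); auto.
      transitivity (df z0 * Cconj (df z0))%C; [field; auto|].
      rewrite <- Cmod2_conj. fold k. rewrite RtoC_pow. simpl. ring. }
    clearbody ka.
    (* The coefficients turn e^-z and e^z on the circle of radius r into the two exponentials of the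
       cosine in the kernel. *)
    set (M := fun s => (W0 (ln r, s) - (ka * RtoC (r / 2)) * W2 (ln r, s) - (Cconj ka * RtoC (/ (2 * r))) * W1 (ln r, s))%C).
    set (dM := fun s => (Ci * (f (z0 + cexp (ln r, s)) - (ka * RtoC (r / 2)) * (f (z0 + cexp (ln r, s)) * / cexp (ln r, s))
        - (Cconj ka * RtoC (/ (2 * r))) * (f (z0 + cexp (ln r, s)) * cexp (ln r, s))))%C).
    assert (DM : forall s, curve_deriv M s (dM s)).
    { intros s.
      apply (curve_deriv_vertical (fun z => W0 z - (ka * RtoC (r / 2)) * W2 z - (Cconj ka * RtoC (/ (2 * r))) * W1 z)%C).
      apply cderiv_minus; [apply cderiv_minus|]; [|apply cderiv_scal|apply cderiv_scal];
        [apply H0|apply H2|apply H1]; auto. }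
    assert (N1 : ka = (fst ka, snd ka)) by (destruct ka; auto).
    assert (Sq := Cmod_sqr ka). rewrite ka1 in Sq.
    assert (Mono : snd (M 0) <= snd (M (2 * PI))).
    { apply (derive_nonneg_le (fun s => snd (M s)) (fun s => snd (dM s)) 0 (2 * PI)); [lra| |].
      - intros t _. apply DM.
      - intros t _.
        assert (E : dM t = (Ci * (f (z0 + cexp (ln r, t)) * RtoC (1 - (fst ka * cos t + snd ka * sin t))))%C).
        { unfold dM. f_equal. rewrite !circle_param by lra.
          assert (S := sin2_cos2 t). unfold Rsqr in S.
          assert (I : (/ (RtoC r * (cos t, sin t)) = RtoC (/ r) * (cos t, - sin t)%R)%C).
          { rewrite RtoC_inv by lra.
            assert (U : ((cos t, sin t) * (cos t, - sin t)%R = RtoC 1)%C).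
            { Cext; [|ring]. rewrite <- S; ring. }
            assert (r0 : RtoC r <> 0%C) by (intros X; injection X; lra).
            assert (U0 : ((cos t, sin t) : C) <> 0%C).
            { intros X. rewrite X in U. rewrite Cmult_0_l in U. injection U; lra. }
            apply (Cmult_cancel_l (RtoC r * (cos t, sin t))); [apply Cmult_neq_0; auto|].
            rewrite Cinv_r by (apply Cmult_neq_0; auto).
            transitivity (RtoC r * / RtoC r * ((cos t, sin t) * (cos t, - sin t)%R))%C; [|ring].
            rewrite U. field; auto. }
          rewrite I.
          set (F := f (z0 + RtoC r * (cos t, sin t))%C).
          replace (F - ka * RtoC (r / 2) * (F * (RtoC (/ r) * (cos t, - sin t)%R))
             - Cconj ka * RtoC (/ (2 * r)) * (F * (RtoC r * (cos t, sin t))))%C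
            with (F * (1 - (RtoC (r / 2) * RtoC (/ r)) * (ka * (cos t, - sin t)%R)
               - (RtoC (/ (2 * r)) * RtoC r) * (Cconj ka * (cos t, sin t))))%C by ring.
          f_equal. rewrite <- !RtoC_mult.
          replace (r / 2 * / r) with (/ 2) by (field; lra). replace (/ (2 * r) * r) with (/ 2) by (field; lra).
          Cext; field. }
        rewrite E. simpl.
        set (F := f (z0 + cexp (ln r, t))%C).
        replace (0 * (fst F * 0 + snd F * (1 - (fst ka * cos t + snd ka * sin t)))
           + 1 * (fst F * (1 - (fst ka * cos t + snd ka * sin t)) - snd F * 0))
          with (fst F * (1 - (fst ka * cos t + snd ka * sin t))) by ring.
        apply Rmult_le_pos.
        + apply Hp. apply exp_in_disc. auto.
        + assert (S := sin2_cos2 t). unfold Rsqr in S.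
          assert (Q1 := Rle_0_sqr (fst ka - cos t)). assert (Q2 := Rle_0_sqr (snd ka - sin t)).
          unfold Rsqr in Q1, Q2. lra. }
    assert (Val : (M (2 * PI)%R - M 0 = RtoC (2 * PI) * Ci * (f z0 - ka * RtoC (r / 2) * df z0))%C).
    { unfold M.
      replace (W0 (ln r, 2 * PI)%R - ka * RtoC (r / 2) * W2 (ln r, 2 * PI)%R - Cconj ka * RtoC (/ (2 * r)) * W1 (ln r, 2 * PI)%R -
         (W0 (ln r, 0) - ka * RtoC (r / 2) * W2 (ln r, 0) - Cconj ka * RtoC (/ (2 * r)) * W1 (ln r, 0)))%C
        with ((W0 (ln r, 2 * PI)%R - W0 (ln r, 0)) - ka * RtoC (r / 2) * (W2 (ln r, 2 * PI)%R - W2 (ln r, 0))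
          - Cconj ka * RtoC (/ (2 * r)) * (W1 (ln r, 2 * PI)%R - W1 (ln r, 0)))%C by ring.
      rewrite A0, A1, A2. ring. }
    replace (ka * RtoC (r / 2) * df z0)%C with (RtoC (r / 2) * (ka * df z0))%C in Val by ring.
    rewrite kd in Val.
    assert (Val2 : snd (M (2 * PI)) - snd (M 0) = 2 * PI * (Re (f z0) - r / 2 * k)).
    { change (snd (M (2 * PI)) - snd (M 0)) with (snd (M (2 * PI)%R - M 0)%C). rewrite Val.
      unfold Re; simpl; ring. }
    assert (0 <= Re (f z0) - r / 2 * k); [|lra].
    apply Rmult_le_reg_l with (2 * PI); [lra|]. lra. }
  (* Passage from every r < R0 to R0: otherwise some r < R0 would exceed 2 Re (f z0) / k. *)
  apply Rnot_lt_le. intros N.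
  set (q := 2 * Re (f z0) / k).
  assert (Q : q < R0). { unfold q. apply Rmult_lt_reg_r with k; auto. unfold Rdiv. rewrite Rmult_assoc, Rinv_l by lra. lra. }
  assert (m := Rmax_l 0 q). assert (m' := Rmax_r 0 q). assert (Hm : Rmax 0 q < R0) by (apply Rmax_lub_lt; auto).
  specialize (Main ((Rmax 0 q + R0) / 2) ltac:(lra)).
  assert (X : q * k = 2 * Re (f z0)) by (unfold q; field; lra).
  nra.
Qed.

End centre.

(** * Harnack, Schwarz and Schwarz-Pick inequalities *)

Definition holo (U : C -> Prop) (f : C -> C) : Prop := forall z, U z -> exists l, cderiv f z l.

Lemma holo_deriv (U : C -> Prop) (f : C -> C) :
  holo U f -> exists df, forall z, U z -> cderiv f z (df z).
Proof.
  intros H. exists (fun z => epsilon (inhabits (RtoC 0)) (cderiv f z)).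
  intros z Hz. apply epsilon_spec. auto.
Qed.

Lemma cderiv_unique (f : C -> C) (z l m : C) : cderiv f z l -> cderiv f z m -> l = m.
Proof.
  intros H1 H2. apply NNPP. intros N.
  assert (P : 0 < Cmod (l - m)). { apply Cmod_gt_0. intros E. apply N. rewrite <- (Cplus_0_r m), <- E. ring. }
  set (k := Cmod (l - m)) in *.
  destruct (H1 (k / 4)) as [d1 [Hd1 K1]]; [lra|]. destruct (H2 (k / 4)) as [d2 [Hd2 K2]]; [lra|].
  set (d := Rmin d1 d2 / 2). assert (Hm : 0 < Rmin d1 d2) by (apply Rmin_glb_lt; auto).
  assert (L1 := Rmin_l d1 d2). assert (L2 := Rmin_r d1 d2).
  assert (E : Cmod (z + RtoC d - z) = d).
  { replace (z + RtoC d - z)%C with (RtoC d) by ring. rewrite Cmod_R, Rabs_right; unfold d; lra. }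
  specialize (K1 (z + RtoC d)%C). specialize (K2 (z + RtoC d)%C). rewrite E in K1, K2.
  specialize (K1 ltac:(unfold d; lra)). specialize (K2 ltac:(unfold d; lra)).
  assert (T := Cmod_minus_le (f (z + RtoC d) - f z - m * (z + RtoC d - z))%C (f (z + RtoC d) - f z - l * (z + RtoC d - z))%C).
  match type of T with Cmod ?a <= _ => replace a with ((l - m) * (z + RtoC d - z))%C in T by ring end.
  rewrite Cmod_mult, E in T. fold k in T. assert (0 < d) by (unfold d; lra). nra.
Qed.

Definition cdisc (z0 : C) (r : R) (z : C) : Prop := Cmod (z - z0) < r.

Lemma Cmod_lt_1_sqr (z : C) : Cmod z < 1 <-> fst z * fst z + snd z * snd z < 1.
Proof.
  rewrite <- Cmod_sqr. assert (P := Cmod_ge_0 z). split; intros H; nra.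
Qed.

Lemma one_plus_conj_neq_0 (a z : C) : Cmod a < 1 -> Cmod z < 1 -> (1 + Cconj a * z <> 0)%C.
Proof.
  intros Ha Hz E. assert (H : Cmod (Cconj a * z) = 1).
  { replace (Cconj a * z)%C with (- RtoC 1)%C. { rewrite Cmod_opp, Cmod_1; auto. }
    rewrite <- (Cplus_0_r (- RtoC 1)), <- E. ring. }
  rewrite Cmod_mult, Cmod_conj in H.
  assert (P := Cmod_ge_0 a). assert (Q := Cmod_ge_0 z). nra.
Qed.

Lemma one_minus_conj_neq_0 (a z : C) : Cmod a < 1 -> Cmod z < 1 -> (1 - Cconj a * z <> 0)%C.
Proof.
  intros Ha Hz. replace (1 - Cconj a * z)%C with (1 + Cconj (- a) * z)%C.
  - apply one_plus_conj_neq_0; auto. rewrite Cmod_opp; auto.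
  - rewrite Copp_conj. ring.
Qed.

Definition mobius (a z : C) : C := ((z + a) / (1 + Cconj a * z))%C.

Lemma blaschke_identity (a z : C) :
  Cmod (1 - Cconj a * z) * Cmod (1 - Cconj a * z) - Cmod (z - a) * Cmod (z - a)
  = (1 - Cmod z * Cmod z) * (1 - Cmod a * Cmod a).
Proof. rewrite !Cmod_sqr. simpl. ring. Qed.

Lemma Cmod_minus_opp_conj (a z : C) : (1 + Cconj a * z = 1 - Cconj (- a) * z)%C.
Proof. rewrite Copp_conj. ring. Qed.

Lemma mobius_identity (a z : C) : Cmod a < 1 -> Cmod z < 1 ->
  1 - Cmod (mobius a z) * Cmod (mobius a z)
  = (1 - Cmod z * Cmod z) * (1 - Cmod a * Cmod a) / (Cmod (1 + Cconj a * z) * Cmod (1 + Cconj a * z)).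
Proof.
  intros Ha Hz. assert (N := one_plus_conj_neq_0 a z Ha Hz).
  unfold mobius. rewrite Cmod_div by auto.
  assert (P : 0 < Cmod (1 + Cconj a * z)) by (apply Cmod_gt_0; auto).
  assert (B := blaschke_identity (- a) z). rewrite <- Cmod_minus_opp_conj, Cmod_opp in B.
  replace (z - - a)%C with (z + a)%C in B by ring.
  rewrite <- B. field. lra.
Qed.

Lemma mobius_disc (a z : C) : Cmod a < 1 -> Cmod z < 1 -> Cmod (mobius a z) < 1.
Proof.
  intros Ha Hz. assert (E := mobius_identity a z Ha Hz).
  assert (N := one_plus_conj_neq_0 a z Ha Hz). apply Cmod_gt_0 in N.
  assert (0 < (1 - Cmod z * Cmod z) * (1 - Cmod a * Cmod a) / (Cmod (1 + Cconj a * z) * Cmod (1 + Cconj a * z))).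
  { assert (P := Cmod_ge_0 a). assert (Q := Cmod_ge_0 z).
    apply Rdiv_lt_0_compat; [apply Rmult_lt_0_compat; nra | nra]. }
  assert (P := Cmod_ge_0 (mobius a z)). nra.
Qed.

Lemma cderiv_mobius (a z : C) : Cmod a < 1 -> Cmod z < 1 ->
  cderiv (mobius a) z ((1 - Cconj a * a) / ((1 + Cconj a * z) * (1 + Cconj a * z)))%C.
Proof.
  intros Ha Hz. assert (N := one_plus_conj_neq_0 a z Ha Hz). unfold mobius.
  eapply cderiv_eq.
  - apply (cderiv_div (fun z => z + a)%C (fun z => 1 + Cconj a * z)%C z 1 (Cconj a)); auto.
    + eapply cderiv_eq; [apply cderiv_plus; [apply cderiv_id|apply cderiv_const]|ring].
    + eapply cderiv_eq; [apply cderiv_plus; [apply cderiv_const|apply cderiv_scal, cderiv_id]|ring].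
  - cbv beta. field. auto.
Qed.

Lemma mobius_0 (a : C) : mobius a 0%C = a.
Proof.
  unfold mobius. replace (1 + Cconj a * 0)%C with (RtoC 1) by ring. field.
Qed.

Definition udisc (z : C) : Prop := Cmod z < 1.

(** The automorphism [mobius a] moves 0 to a with derivative 1 - |a|^2 at 0. *)
Lemma deriv_le_Re_udisc (f : C -> C) (a l : C) :
  holo udisc f -> (forall z, udisc z -> 0 <= Re (f z)) -> udisc a -> cderiv f a l ->
  (1 - Cmod a * Cmod a) * Cmod l <= 2 * Re (f a).
Proof.
  intros Hf Hp Ha Hl. destruct (holo_deriv _ _ Hf) as [df Hdf].
  assert (X := deriv_le_Re (fun z => f (mobius a z))
    (fun z => df (mobius a z) * ((1 - Cconj a * a) / ((1 + Cconj a * z) * (1 + Cconj a * z))))%C 0 1 Rlt_0_1).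
  cbv beta in X. rewrite mobius_0 in X.
  rewrite (cderiv_unique f a l (df a) Hl (Hdf a Ha)).
  replace (df a * ((1 - Cconj a * a) / ((1 + Cconj a * 0) * (1 + Cconj a * 0))))%C
    with (RtoC (1 - Cmod a * Cmod a) * df a)%C in X.
  - rewrite Cmod_mult, Cmod_R, Rabs_right in X.
    + rewrite <- (Rmult_1_l ((1 - _) * _)). apply X.
      * intros z Hz. replace (z - 0)%C with z in Hz by ring.
        apply (cderiv_comp (mobius a) f); [apply cderiv_mobius|apply Hdf, mobius_disc]; auto.
      * intros z Hz. replace (z - 0)%C with z in Hz by ring. apply Hp, mobius_disc; auto.
    + assert (P := Cmod_ge_0 a). unfold udisc in Ha. nra.
  - replace (1 + Cconj a * 0)%C with (RtoC 1) by ring.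
    replace (Cconj a * a)%C with (RtoC (Cmod a * Cmod a)).
    + rewrite RtoC_minus. field.
    + rewrite Cmult_comm, <- Cmod2_conj, RtoC_pow, RtoC_mult. simpl. ring.
Qed.

(** The differential inequality says that u (1 - s) / (1 + s) decreases and u (1 + s) / (1 - s)
    increases. *)
Lemma radial_harnack (u du : R -> R) (r : R) : 0 <= r < 1 ->
  (forall s, 0 <= s <= r -> is_derive u s (du s)) ->
  (forall s, 0 <= s <= r -> (1 - s * s) * Rabs (du s) <= 2 * u s) ->
  u r * (1 - r) <= u 0 * (1 + r) /\ u 0 * (1 - r) <= u r * (1 + r).
Proof.
  intros Hr Hd Hb.
  assert (Ex : forall s, 0 <= s <= r -> ex_derive u s) by (intros s Hs; eexists; eauto).
  assert (B : forall s, 0 <= s <= r -> - (2 * u s) <= (1 - s * s) * du s <= 2 * u s).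
  { intros s Hs. apply Rabs_le_between. rewrite Rabs_mult, (Rabs_right (1 - s * s)) by nra. auto. }
  split.
  - assert (X := derive_nonneg_le (fun s => - (u s * ((1 - s) / (1 + s))))
      (fun s => - (du s * ((1 - s) / (1 + s)) + u s * (-2 / ((1 + s) * (1 + s))))) 0 r (proj1 Hr)).
    assert (Y : - (u 0 * ((1 - 0) / (1 + 0))) <= - (u r * ((1 - r) / (1 + r)))).
    { apply X.
      - intros s Hs. auto_derive; [split; [auto|split; [lra|auto]]|].
        replace (Derive (fun x => u x) s) with (du s) by (symmetry; apply is_derive_unique; auto). field. lra.
      - intros s Hs. specialize (B s Hs).
        replace (- (du s * ((1 - s) / (1 + s)) + u s * (-2 / ((1 + s) * (1 + s)))))
          with ((2 * u s - (1 - s * s) * du s) * / ((1 + s) * (1 + s))) by (field; lra).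
        apply Rmult_le_pos; [lra|]. left. apply Rinv_0_lt_compat. nra. }
    replace (u 0 * ((1 - 0) / (1 + 0))) with (u 0) in Y by field.
    apply Rmult_le_reg_r with (/ (1 + r)); [apply Rinv_0_lt_compat; lra|].
    replace (u 0 * (1 + r) * / (1 + r)) with (u 0) by (field; lra). unfold Rdiv in Y. lra.
  - assert (X := derive_nonneg_le (fun s => u s * ((1 + s) / (1 - s)))
      (fun s => du s * ((1 + s) / (1 - s)) + u s * (2 / ((1 - s) * (1 - s)))) 0 r (proj1 Hr)).
    assert (Y : u 0 * ((1 + 0) / (1 - 0)) <= u r * ((1 + r) / (1 - r))).
    { apply X.
      - intros s Hs. auto_derive; [split; [auto|split; [lra|auto]]|].
        replace (Derive (fun x => u x) s) with (du s) by (symmetry; apply is_derive_unique; auto). field. lra.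
      - intros s Hs. specialize (B s Hs).
        replace (du s * ((1 + s) / (1 - s)) + u s * (2 / ((1 - s) * (1 - s))))
          with ((2 * u s + (1 - s * s) * du s) * / ((1 - s) * (1 - s))) by (field; lra).
        apply Rmult_le_pos; [lra|]. left. apply Rinv_0_lt_compat. nra. }
    replace (u 0 * ((1 + 0) / (1 - 0))) with (u 0) in Y by field.
    apply Rmult_le_reg_r with (/ (1 - r)); [apply Rinv_0_lt_compat; lra|].
    replace (u 0 * (1 - r) * / (1 - r)) with (u 0) by (field; lra). unfold Rdiv in Y. lra.
Qed.

Lemma harnack_udisc (f : C -> C) (z : C) :
  holo udisc f -> (forall z, udisc z -> 0 <= Re (f z)) -> udisc z ->
  Re (f z) * (1 - Cmod z) <= Re (f 0%C) * (1 + Cmod z) /\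
  Re (f 0%C) * (1 - Cmod z) <= Re (f z) * (1 + Cmod z).
Proof.
  intros Hf Hp Hz. destruct (holo_deriv _ _ Hf) as [df Hdf].
  assert (Pz := Cmod_ge_0 z). unfold udisc in Hz.
  destruct (Req_dec (Cmod z) 0) as [Z|NZ].
  { rewrite Z. apply Cmod_eq_0 in Z. rewrite Z. lra. }
  set (r := Cmod z) in *. set (e := (z / RtoC r)%C).
  assert (rn : RtoC r <> 0%C) by (intros X; injection X; auto).
  assert (e1 : Cmod e = 1). { unfold e. rewrite Cmod_div by auto. rewrite Cmod_R, Rabs_right by lra. fold r. field; auto. }
  assert (er : (RtoC r * e = z)%C) by (unfold e; field; auto).
  assert (In : forall s, 0 <= s <= r -> Cmod (RtoC s * e) = s).
  { intros s Hs. rewrite Cmod_mult, Cmod_R, Rabs_right, e1 by lra. ring. }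
  assert (X := radial_harnack (fun s => Re (f (0 + RtoC s * e)%C)) (fun s => Re (df (0 + RtoC s * e) * e)%C) r ltac:(lra)).
  cbv beta in X. replace (0 + RtoC r * e)%C with z in X by (rewrite er; ring).
  replace (0 + RtoC 0 * e)%C with (RtoC 0) in X by ring.
  apply X.
  - intros s Hs. apply (curve_deriv_comp f (fun s => 0 + RtoC s * e)%C s e).
    + apply curve_deriv_line.
    + apply Hdf. unfold udisc. rewrite Cplus_0_l, In by auto. lra.
  - intros s Hs. rewrite !Cplus_0_l.
    assert (U : udisc (RtoC s * e)%C) by (unfold udisc; rewrite In by auto; lra).
    assert (Y := deriv_le_Re_udisc f _ _ Hf Hp U (Hdf _ U)). rewrite In in Y by auto.
    eapply Rle_trans; [|exact Y]. apply Rmult_le_compat_l; [nra|].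
    eapply Rle_trans; [apply re_le_Cmod|]. rewrite Cmod_mult, e1. lra.
Qed.

Lemma harnack_disc (f : C -> C) (z0 z : C) (R0 : R) : 0 < R0 ->
  holo (cdisc z0 R0) f -> (forall z, cdisc z0 R0 z -> 0 <= Re (f z)) -> cdisc z0 R0 z ->
  Re (f z) * (R0 - Cmod (z - z0)) <= Re (f z0) * (R0 + Cmod (z - z0)) /\
  Re (f z0) * (R0 - Cmod (z - z0)) <= Re (f z) * (R0 + Cmod (z - z0)).
Proof.
  intros HR Hf Hp Hz. unfold cdisc in *.
  assert (rn : RtoC R0 <> 0%C) by (intros X; injection X; lra).
  assert (In : forall w, udisc w -> Cmod (z0 + RtoC R0 * w - z0) < R0).
  { intros w Hw. replace (z0 + RtoC R0 * w - z0)%C with (RtoC R0 * w)%C by ring.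
    rewrite Cmod_mult, Cmod_R, Rabs_right by lra. unfold udisc in Hw. nra. }
  assert (M : Cmod ((z - z0) / RtoC R0) = Cmod (z - z0) / R0).
  { rewrite Cmod_div, Cmod_R, Rabs_right by (auto; lra). auto. }
  destruct (harnack_udisc (fun w => f (z0 + RtoC R0 * w)%C) ((z - z0) / RtoC R0)%C) as [H1 H2].
  - intros w Hw. destruct (Hf _ (In w Hw)) as [l Hl]. eexists.
    apply (cderiv_comp (fun w => z0 + RtoC R0 * w)%C f); [|exact Hl].
    apply cderiv_plus; [apply cderiv_const|apply cderiv_scal, cderiv_id].
  - intros w Hw. apply Hp, In; auto.
  - unfold udisc. rewrite M. apply Rmult_lt_reg_r with R0; auto. unfold Rdiv. rewrite Rmult_assoc, Rinv_l; lra.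
  - rewrite M in H1, H2.
    replace (z0 + RtoC R0 * ((z - z0) / RtoC R0))%C with z in H1, H2 by (field; auto).
    replace (z0 + RtoC R0 * 0)%C with z0 in H1, H2 by ring.
    set (k := Cmod (z - z0)) in *.
    assert (E1 : forall x, x * (R0 - k) = x * (1 - k / R0) * R0) by (intros; field; lra).
    assert (E2 : forall x, x * (R0 + k) = x * (1 + k / R0) * R0) by (intros; field; lra).
    rewrite !E1, !E2. split; apply Rmult_le_compat_r; lra.
Qed.

(** Obtained from Harnack instead of a maximum principle: with [ka] turning g z into its modulus k,
    the function (1 + ka g) / (1 - ka g) has nonnegative real part, is 1 at 0 and (1 + k) / (1 - k)
    at z. *)
Lemma schwarz (g : C -> C) (z : C) :
  holo udisc g -> (forall z, udisc z -> udisc (g z)) -> g 0%C = 0%C -> udisc z -> Cmod (g z) <= Cmod z.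
Proof.
  intros Hg Hd H0 Hz.
  destruct (Req_dec (Cmod (g z)) 0) as [Z|NZ]; [rewrite Z; apply Cmod_ge_0|].
  set (k := Cmod (g z)) in *. assert (Pk : 0 < k) by (assert (X := Cmod_ge_0 (g z)); fold k in X; lra).
  set (ka := (Cconj (g z) / RtoC k)%C).
  assert (kn : RtoC k <> 0%C) by (intros X; injection X; lra).
  assert (ka1 : Cmod ka = 1).
  { unfold ka. rewrite Cmod_div, Cmod_conj, Cmod_R, Rabs_right by (auto; lra). fold k. field. lra. }
  assert (kg : (ka * g z = RtoC k)%C).
  { unfold ka. apply (Cmult_cancel_l (RtoC k)); auto.
    transitivity (g z * Cconj (g z))%C; [field; auto|].
    rewrite <- Cmod2_conj. fold k. rewrite RtoC_pow. simpl. ring. }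
  assert (Bd : forall w, udisc w -> Cmod (ka * g w) < 1).
  { intros w Hw. rewrite Cmod_mult, ka1. specialize (Hd w Hw). unfold udisc in Hd. lra. }
  assert (Nz : forall w, udisc w -> (1 - ka * g w <> 0)%C).
  { intros w Hw E. specialize (Bd w Hw).
    replace (ka * g w)%C with (RtoC 1) in Bd; [rewrite Cmod_1 in Bd; lra|].
    rewrite <- (Cplus_0_r (ka * g w)), <- E. ring. }
  destruct (harnack_udisc (fun w => (1 + ka * g w) / (1 - ka * g w))%C z) as [H1 _]; auto.
  - intros w Hw. destruct (Hg w Hw) as [l Hl]. eexists.
    apply (cderiv_div (fun w => 1 + ka * g w)%C (fun w => 1 - ka * g w)%C); auto.
    + apply cderiv_plus; [apply cderiv_const|apply cderiv_scal; exact Hl].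
    + apply cderiv_minus; [apply cderiv_const|apply cderiv_scal; exact Hl].
  - intros w Hw. specialize (Bd w Hw). specialize (Nz w Hw).
    set (q := (ka * g w)%C) in *. clearbody q.
    apply Cmod_lt_1_sqr in Bd.
    assert (P : 0 < (1 - fst q) * (1 - fst q) + snd q * snd q).
    { apply Cmod_gt_0 in Nz. assert (S := Cmod_sqr (1 - q)). simpl in S. nra. }
    unfold Re, Cdiv, Cinv, Cmult; simpl.
    match goal with |- 0 <= ?a => replace a with ((1 - (fst q * fst q + snd q * snd q)) / ((1 - fst q) * (1 - fst q) + snd q * snd q)) end.
    + apply Rdiv_le_0_compat; lra.
    + field. lra.
  - cbv beta in H1. rewrite kg, H0 in H1.
    replace ((1 + ka * 0) / (1 - ka * 0))%C with (RtoC 1) in H1.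
    2:{ replace (ka * 0)%C with (RtoC 0) by ring. field. }
    replace ((1 + RtoC k) / (1 - RtoC k))%C with (RtoC ((1 + k) / (1 - k))) in H1.
    2:{ assert (k < 1) by (apply (Hd z Hz)).
        rewrite RtoC_div by lra. rewrite RtoC_plus, RtoC_minus. auto. }
    rewrite !re_RtoC in H1. assert (k1 : k < 1) by (apply (Hd z Hz)).
    assert (Y : (1 + k) * (1 - Cmod z) <= (1 + Cmod z) * (1 - k)).
    { apply Rmult_le_reg_r with (/ (1 - k)); [apply Rinv_0_lt_compat; lra|].
      replace ((1 + Cmod z) * (1 - k) * / (1 - k)) with (1 * (1 + Cmod z)) by (field; lra).
      eapply Rle_trans; [|exact H1]. right. field. lra. }
    lra.
Qed.

Lemma schwarz_pick (f : C -> C) (a z : C) :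
  holo udisc f -> (forall z, udisc z -> udisc (f z)) -> udisc a -> udisc z ->
  Cmod (f z - f a) * Cmod (1 - Cconj a * z) <= Cmod (z - a) * Cmod (1 - Cconj (f a) * f z).
Proof.
  intros Hf Hd Ha Hz.
  assert (Hna : Cmod (- a) < 1) by (rewrite Cmod_opp; auto).
  assert (Hfa := Hd a Ha). assert (Hnfa : Cmod (- f a) < 1) by (rewrite Cmod_opp; auto).
  set (w := mobius (- a) z). assert (Hw : udisc w) by (apply mobius_disc; auto).
  assert (N1 := one_minus_conj_neq_0 a z Ha Hz).
  assert (mw : mobius a w = z).
  { unfold w, mobius. rewrite Copp_conj.
    replace (1 + - Cconj a * z)%C with (1 - Cconj a * z)%C by ring.
    assert (N2 : (1 - Cconj a * a <> 0)%C) by (apply one_minus_conj_neq_0; auto).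
    assert (N3 : (1 - Cconj a * z + Cconj a * (z + - a) <> 0)%C).
    { replace (1 - Cconj a * z + Cconj a * (z + - a))%C with (1 - Cconj a * a)%C by ring. auto. }
    field. split; auto. }
  assert (X := schwarz (fun w => mobius (- f a) (f (mobius a w))) w).
  cbv beta in X. rewrite mw in X.
  assert (Y : Cmod (mobius (- f a) (f z)) <= Cmod w).
  { apply X; auto.
    - intros v Hv. destruct (Hf _ (mobius_disc a v Ha Hv)) as [l Hl]. eexists.
      apply (cderiv_comp (fun w => f (mobius a w)) (mobius (- f a))).
      + apply (cderiv_comp (mobius a) f); [apply cderiv_mobius; auto|exact Hl].
      + apply cderiv_mobius; auto. apply Hd. apply mobius_disc; auto.
    - intros v Hv. apply mobius_disc; auto. apply Hd, mobius_disc; auto.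
    - rewrite mobius_0. unfold mobius. replace (f a + - f a)%C with (RtoC 0) by ring.
      field. rewrite Copp_conj. replace (1 + - Cconj (f a) * f a)%C with (1 - Cconj (f a) * f a)%C by ring.
      apply one_minus_conj_neq_0; auto. }
  unfold w, mobius in Y. rewrite !Copp_conj in Y.
  replace (1 + - Cconj a * z)%C with (1 - Cconj a * z)%C in Y by ring.
  replace (1 + - Cconj (f a) * f z)%C with (1 - Cconj (f a) * f z)%C in Y by ring.
  assert (N4 := one_minus_conj_neq_0 (f a) (f z) Hfa (Hd z Hz)).
  rewrite !Cmod_div in Y by auto.
  apply Cmod_gt_0 in N1. apply Cmod_gt_0 in N4.
  change (z + - a)%C with (z - a)%C in Y. change (f z + - f a)%C with (f z - f a)%C in Y.
  apply Rmult_le_compat_r with (r := Cmod (1 - Cconj a * z) * Cmod (1 - Cconj (f a) * f z)) in Y; [|nra].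
  eapply Rle_trans; [|eapply Rle_trans; [exact Y|]]; right; field; lra.
Qed.

Lemma schwarz_pick_sqr (f : C -> C) (a z : C) :
  holo udisc f -> (forall z, udisc z -> udisc (f z)) -> udisc a -> udisc z ->
  (1 - Cmod z * Cmod z) * (1 - Cmod a * Cmod a) * (Cmod (1 - Cconj (f a) * f z) * Cmod (1 - Cconj (f a) * f z))
  <= (1 - Cmod (f z) * Cmod (f z)) * (1 - Cmod (f a) * Cmod (f a)) * (Cmod (1 - Cconj a * z) * Cmod (1 - Cconj a * z)).
Proof.
  intros Hf Hd Ha Hz. assert (X := schwarz_pick f a z Hf Hd Ha Hz).
  rewrite <- !blaschke_identity.
  set (p := Cmod (f z - f a)) in *. set (q := Cmod (1 - Cconj a * z)) in *.
  set (r := Cmod (z - a)) in *. set (s := Cmod (1 - Cconj (f a) * f z)) in *.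
  assert (0 <= p * q) by (apply Rmult_le_pos; apply Cmod_ge_0).
  assert ((p * q) * (p * q) <= (r * s) * (r * s)) by (apply Rmult_le_compat; auto).
  lra.
Qed.

(** The limit of [schwarz_pick] between 0 and a small real d: the difference quotient and the
    continuity of f cost k / 3 each, less than the supposed gap k. *)
Lemma schwarz_pick_deriv_0 (f : C -> C) (l : C) :
  holo udisc f -> (forall z, udisc z -> udisc (f z)) -> cderiv f 0%C l ->
  Cmod l <= 1 - Cmod (f 0%C) * Cmod (f 0%C).
Proof.
  intros Hf Hd Hl.
  assert (U0 : udisc 0%C) by (unfold udisc; rewrite Cmod_0; lra).
  apply Rnot_lt_le. intros N.
  set (k := Cmod l - (1 - Cmod (f 0%C) * Cmod (f 0%C))). assert (Pk : 0 < k) by (unfold k; lra).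
  destruct (Hl (k / 3)) as [d1 [Hd1 H1]]; [lra|].
  destruct (cderiv_ccont f 0%C l Hl (k / 3)) as [d2 [Hd2 H2]]; [lra|].
  set (d := Rmin (1/2) (Rmin d1 d2) / 2).
  assert (L1 := Rmin_l (1/2) (Rmin d1 d2)). assert (L2 := Rmin_r (1/2) (Rmin d1 d2)).
  assert (L3 := Rmin_l d1 d2). assert (L4 := Rmin_r d1 d2).
  assert (Pd : 0 < Rmin (1/2) (Rmin d1 d2)) by (repeat apply Rmin_glb_lt; lra).
  assert (D0 : 0 < d) by (unfold d; lra).
  assert (M : Cmod (RtoC d) = d) by (rewrite Cmod_R, Rabs_right; lra).
  specialize (H1 (RtoC d)). specialize (H2 (RtoC d)).
  replace (RtoC d - 0)%C with (RtoC d) in H1, H2 by ring. rewrite M in H1, H2.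
  specialize (H1 ltac:(unfold d; lra)). specialize (H2 ltac:(unfold d; lra)).
  assert (X := schwarz_pick f 0%C (RtoC d) Hf Hd U0 ltac:(unfold udisc; rewrite M; unfold d; lra)).
  replace (Cconj 0) with (RtoC 0) in X by (Cext; ring).
  replace (1 - 0 * RtoC d)%C with (RtoC 1) in X by ring. rewrite Cmod_1, Rmult_1_r in X.
  replace (RtoC d - 0)%C with (RtoC d) in X by ring. rewrite M in X.
  assert (Y : Cmod (1 - Cconj (f 0%C) * f (RtoC d)) <= (1 - Cmod (f 0%C) * Cmod (f 0%C)) + k / 3).
  { replace (1 - Cconj (f 0) * f (RtoC d))%C with (RtoC (1 - Cmod (f 0%C) * Cmod (f 0%C)) + - (Cconj (f 0) * (f (RtoC d) - f 0)))%C.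
    2:{ rewrite RtoC_minus, RtoC_mult.
        replace (RtoC (Cmod (f 0)) * RtoC (Cmod (f 0)))%C with (f 0 * Cconj (f 0))%C; [ring|].
        rewrite <- Cmod2_conj, RtoC_pow. simpl. ring. }
    assert (Hf0 : Cmod (f 0%C) < 1) by (apply (Hd _ U0)). assert (P0 := Cmod_ge_0 (f 0%C)).
    eapply Rle_trans; [apply Cmod_triangle|]. rewrite Cmod_opp, Cmod_mult, Cmod_conj, Cmod_R, Rabs_right by nra.
    assert (P1 := Cmod_ge_0 (f (RtoC d) - f 0%C)). nra. }
  assert (Z := Cmod_triangle_inv (l * RtoC d) (f (RtoC d) - f 0%C)).
  rewrite (Cmod_minus_sym (l * RtoC d)), Cmod_mult, M in Z.
  assert (Cmod l <= (1 - Cmod (f 0%C) * Cmod (f 0%C)) + k / 3 + k / 3); [|unfold k in *; lra].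
  apply Rmult_le_reg_r with d; auto.
  assert (d * Cmod (1 - Cconj (f 0%C) * f (RtoC d)) <= d * ((1 - Cmod (f 0%C) * Cmod (f 0%C)) + k / 3)) by (apply Rmult_le_compat_l; lra).
  lra.
Qed.

(** The Schwarz lemma for the Cayley quotient (f - f 0) / (f + conj (f 0)), with |p + conj q|^2 - |p
    - q|^2 = 4 Re p Re q. *)
Lemma schwarz_pick_halfplane_0 (f : C -> C) (z : C) :
  holo udisc f -> (forall z, udisc z -> 0 < Re (f z)) -> udisc z ->
  Cmod (f z - f 0%C) * Cmod (f z - f 0%C) * (1 - Cmod z * Cmod z)
  <= 4 * (Cmod z * Cmod z) * (Re (f z) * Re (f 0%C)).
Proof.
  intros Hf Hp Hz.
  assert (U0 : udisc 0%C) by (unfold udisc; rewrite Cmod_0; lra).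
  assert (Id : forall p q : C, Cmod (p + Cconj q) * Cmod (p + Cconj q) = Cmod (p - q) * Cmod (p - q) + 4 * (Re p * Re q)).
  { intros p q. rewrite !Cmod_sqr. unfold Re; simpl. ring. }
  assert (Nz : forall w, udisc w -> (f w + Cconj (f 0%C) <> 0)%C).
  { intros w Hw E. assert (X := Hp w Hw). assert (Y := Hp _ U0).
    assert (Z : Re (f w + Cconj (f 0%C)) = 0) by (rewrite E; auto). unfold Re in *; simpl in *. lra. }
  assert (X := schwarz (fun w => (f w - f 0%C) / (f w + Cconj (f 0%C)))%C z).
  cbv beta in X. rewrite Cmod_div in X by auto.
  assert (Y : Cmod (f z - f 0%C) / Cmod (f z + Cconj (f 0%C)) <= Cmod z).
  { apply X; auto.
    - intros w Hw. destruct (Hf w Hw) as [l Hl]. eexists.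
      apply (cderiv_div (fun w => f w - f 0%C)%C (fun w => f w + Cconj (f 0%C))%C); auto.
      + apply cderiv_minus; [exact Hl|apply cderiv_const].
      + apply cderiv_plus; [exact Hl|apply cderiv_const].
    - intros w Hw. unfold udisc. rewrite Cmod_div by auto.
      assert (P : 0 < Cmod (f w + Cconj (f 0%C))) by (apply Cmod_gt_0; auto).
      apply Rmult_lt_reg_r with (Cmod (f w + Cconj (f 0%C))); auto.
      unfold Rdiv. rewrite Rmult_assoc, Rinv_l, Rmult_1_r, Rmult_1_l by lra.
      assert (I := Id (f w) (f 0%C)).
      assert (0 < Re (f w) * Re (f 0%C)) by (apply Rmult_lt_0_compat; auto).
      assert (Q := Cmod_ge_0 (f w - f 0%C)). nra.
    - replace (f 0 - f 0)%C with (RtoC 0) by ring. field. auto. }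
  assert (P : 0 < Cmod (f z + Cconj (f 0%C))) by (apply Cmod_gt_0; auto).
  assert (Y2 : Cmod (f z - f 0%C) <= Cmod z * Cmod (f z + Cconj (f 0%C))).
  { apply Rmult_le_reg_r with (/ Cmod (f z + Cconj (f 0%C))); [apply Rinv_0_lt_compat; auto|].
    rewrite Rmult_assoc, Rinv_r, Rmult_1_r by lra. exact Y. }
  assert (I := Id (f z) (f 0%C)).
  set (A := Cmod (f z - f 0%C)) in *. set (B := Cmod (f z + Cconj (f 0%C))) in *. set (r := Cmod z) in *.
  assert (PA : 0 <= A) by apply Cmod_ge_0.
  assert (A * A <= (r * B) * (r * B)) by (apply Rmult_le_compat; auto).
  replace ((r * B) * (r * B)) with (r * r * (B * B)) in H by ring. rewrite I in H. lra.
Qed.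

(** A real part that is only nonnegative could make the Cayley denominator vanish; adding e > 0 to f
    prevents this, and then e tends to 0. *)
Lemma schwarz_pick_halfplane (f : C -> C) (a z : C) :
  holo udisc f -> (forall z, udisc z -> 0 <= Re (f z)) -> udisc a -> udisc z ->
  Cmod (f z - f a) * Cmod (f z - f a) * ((1 - Cmod z * Cmod z) * (1 - Cmod a * Cmod a))
  <= 4 * (Cmod (z - a) * Cmod (z - a)) * (Re (f z) * Re (f a)).
Proof.
  intros Hf Hp Ha Hz.
  assert (Main : forall e, 0 < e ->
    Cmod (f z - f a) * Cmod (f z - f a) * ((1 - Cmod z * Cmod z) * (1 - Cmod a * Cmod a))
    <= 4 * (Cmod (z - a) * Cmod (z - a)) * ((Re (f z) + e) * (Re (f a) + e))).
  { intros e He.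
    assert (Hna : Cmod (- a) < 1) by (rewrite Cmod_opp; auto).
    set (w := mobius (- a) z). assert (Hw : udisc w) by (apply mobius_disc; auto).
    assert (N1 := one_minus_conj_neq_0 a z Ha Hz).
    assert (mw : mobius a w = z).
    { unfold w, mobius. rewrite Copp_conj.
      replace (1 + - Cconj a * z)%C with (1 - Cconj a * z)%C by ring.
      assert (N2 : (1 - Cconj a * a <> 0)%C) by (apply one_minus_conj_neq_0; auto).
      assert (N3 : (1 - Cconj a * z + Cconj a * (z + - a) <> 0)%C).
      { replace (1 - Cconj a * z + Cconj a * (z + - a))%C with (1 - Cconj a * a)%C by ring. auto. }
      field. split; auto. }
    assert (X := schwarz_pick_halfplane_0 (fun w => f (mobius a w) + RtoC e)%C w).
    cbv beta in X. rewrite mw, mobius_0 in X.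
    replace (f z + RtoC e - (f a + RtoC e))%C with (f z - f a)%C in X by ring.
    rewrite !re_plus, re_RtoC in X.
    assert (Y : Cmod (f z - f a) * Cmod (f z - f a) * (1 - Cmod w * Cmod w) <=
       4 * (Cmod w * Cmod w) * ((Re (f z) + e) * (Re (f a) + e))).
    { apply X; auto.
      - intros v Hv. destruct (Hf _ (mobius_disc a v Ha Hv)) as [l Hl]. eexists.
        apply cderiv_plus; [|apply cderiv_const].
        apply (cderiv_comp (mobius a) f); [apply cderiv_mobius; auto|exact Hl].
      - intros v Hv. rewrite re_plus, re_RtoC. specialize (Hp _ (mobius_disc a v Ha Hv)). lra. }
    unfold w in Y. rewrite mobius_identity in Y by auto.
    unfold mobius in Y. rewrite Copp_conj, Cmod_opp in Y.
    replace (1 + - Cconj a * z)%C with (1 - Cconj a * z)%C in Y by ring.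
    change (z + - a)%C with (z - a)%C in Y. rewrite Cmod_div in Y by auto.
    apply Cmod_gt_0 in N1. set (q := Cmod (1 - Cconj a * z)) in *.
    apply Rmult_le_compat_r with (r := q * q) in Y; [|nra].
    eapply Rle_trans; [|eapply Rle_trans; [exact Y|]]; right; field; lra. }
  set (L := Cmod (f z - f a) * Cmod (f z - f a) * ((1 - Cmod z * Cmod z) * (1 - Cmod a * Cmod a))) in *.
  assert (Pz := Hp z Hz). assert (Pa := Hp a Ha).
  set (b := 4 * (Cmod (z - a) * Cmod (z - a))) in *.
  assert (Pb : 0 <= b) by (unfold b; assert (Q := Cmod_ge_0 (z - a)); nra).
  apply Rnot_lt_le. intros N.
  set (k := L - b * (Re (f z) * Re (f a))). assert (Pk : 0 < k) by (unfold k; lra).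
  (* For e <= 1 the right side exceeds its value at e = 0 by at most e S; the final + 1 keeps S away
     from 0. *)
  set (S := b * (Re (f z) + Re (f a) + 1) + 1). assert (PS : 1 <= S).
  { unfold S. assert (0 <= b * (Re (f z) + Re (f a) + 1)) by (apply Rmult_le_pos; lra). lra. }
  assert (e1 : 0 < k / (2 * S)) by (apply Rdiv_lt_0_compat; lra).
  set (e := Rmin 1 (k / (2 * S))). assert (He : 0 < e) by (apply Rmin_glb_lt; lra).
  assert (L1 : e <= 1) by apply Rmin_l. assert (L2 : e <= k / (2 * S)) by apply Rmin_r.
  specialize (Main e He).
  assert (e * S <= k / 2).
  { apply Rle_trans with (k / (2 * S) * S); [apply Rmult_le_compat_r; lra|]. right. field. lra. }
  assert (b * ((Re (f z) + e) * (Re (f a) + e)) <= b * (Re (f z) * Re (f a)) + e * S); [|unfold k in *; lra].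
  unfold S.
  assert (b * (e * e) <= b * e) by (apply Rmult_le_compat_l; nra). nra.
Qed.

(** * Inverses of univalent functions *)

Lemma circle_min (f : C -> C) (z0 : C) (r : R) :
  (forall t, ccont f (z0 + RtoC r * (cos t, sin t))%C) ->
  (forall t, f (z0 + RtoC r * (cos t, sin t))%C <> 0%C) ->
  exists m, 0 < m /\ forall t, 0 <= t <= 2 * PI -> m <= Cmod (f (z0 + RtoC r * (cos t, sin t))%C).
Proof.
  intros Hc Hn. assert (PI0 := PI_RGT_0).
  set (g := fun t => Cmod (f (z0 + RtoC r * (cos t, sin t))%C)).
  assert (Cg : forall t, continuity_pt g t).
  { intros t. apply continuity_pt_filterlim. apply continuous_eps. intros eps He.
    destruct (Hc t eps He) as [d [Hd Hw]].
    assert (Pr := Rabs_pos r).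
    assert (D : curve_deriv (fun s => z0 + RtoC r * (cos s, sin s))%C t (RtoC r * (- sin t, cos t)%R)%C).
    { split; simpl; auto_derive; auto; ring. }
    destruct (proj1 (curve_deriv_eps _ _ _) D 1 Rlt_0_1) as [d1 [Hd1 H1]].
    assert (M : Cmod (RtoC r * (- sin t, cos t)%R) = Rabs r).
    { rewrite Cmod_mult, Cmod_R. replace (Cmod (- sin t, cos t)) with 1; [ring|].
      symmetry. unfold Cmod. simpl. replace (- sin t * (- sin t * 1) + cos t * (cos t * 1)) with 1; [apply sqrt_1|].
      assert (S := sin2_cos2 t). unfold Rsqr in S. lra. }
    exists (Rmin d1 (d / (Rabs r + 2))). split.
    { apply Rmin_glb_lt; auto. apply Rdiv_lt_0_compat; lra. }
    intros y Hy. assert (L1 := Rmin_l d1 (d / (Rabs r + 2))). assert (L2 := Rmin_r d1 (d / (Rabs r + 2))).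
    specialize (H1 y ltac:(lra)).
    set (A := (z0 + RtoC r * (cos y, sin y))%C) in *. set (B := (z0 + RtoC r * (cos t, sin t))%C) in *.
    set (V := (RtoC r * (- sin t, cos t)%R)%C) in *.
    assert (T := Cmod_triangle (A - B - V * RtoC (y - t)) (V * RtoC (y - t))).
    replace (A - B - V * RtoC (y - t) + V * RtoC (y - t))%C with (A - B)%C in T by ring.
    rewrite Cmod_mult, M, Cmod_R in T.
    assert (P := Rabs_pos (y - t)).
    assert (X : Cmod (A - B) < d).
    { apply Rle_lt_trans with ((Rabs r + 2) * Rabs (y - t)); [lra|].
      replace d with ((Rabs r + 2) * (d / (Rabs r + 2))) by (field; lra). apply Rmult_lt_compat_l; lra. }
    specialize (Hw A X). unfold g. fold A B.
    assert (T1 := Cmod_triangle_inv (f A) (f B)). assert (T2 := Cmod_triangle_inv (f B) (f A)).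
    rewrite (Cmod_minus_sym (f B)) in T2. apply Rabs_def1; lra. }
  destruct (continuity_ab_min g 0 (2 * PI)) as [t0 [Hm Ht]]; [lra|auto|].
  exists (g t0); split; [apply Cmod_gt_0, Hn|].
  exact Hm.
Qed.

Section univalent_function.
Variables (h : C -> C).
Hypothesis Hh : holo udisc h.
Hypothesis Hinj : forall z w, udisc z -> udisc w -> h z = h w -> z = w.

(** Open mapping without the argument principle. Injectivity gives |h - h z0| >= m > 0 on a circle
    about z0. If w with |w - h z0| < m / 2 were missed inside, 1 / (h - w) would be holomorphic
    there and at most 2 / m on the circle, hence at z0 as well, which contradicts the choice of
    w. *)
Lemma univalent_open (z0 : C) (eps : R) : udisc z0 -> 0 < eps ->
  exists d, 0 < d /\ forall w, Cmod (w - h z0) < d -> exists z, udisc z /\ Cmod (z - z0) < eps /\ h z = w.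
Proof.
  intros Hz He. unfold udisc in Hz.
  set (R0 := Rmin eps (1 - Cmod z0)).
  assert (PR : 0 < R0) by (apply Rmin_glb_lt; lra).
  assert (L1 : R0 <= eps) by apply Rmin_l. assert (L2 : R0 <= 1 - Cmod z0) by apply Rmin_r.
  assert (InD : forall z, Cmod (z - z0) < R0 -> udisc z).
  { intros z Hzz. assert (T := Cmod_triangle_inv z z0). unfold udisc. lra. }
  assert (OnC : forall t, Cmod (z0 + RtoC (R0 / 2) * (cos t, sin t) - z0) = R0 / 2).
  { intros t. replace (z0 + RtoC (R0 / 2) * (cos t, sin t) - z0)%C with (RtoC (R0 / 2) * (cos t, sin t))%C by ring.
    rewrite Cmod_mult, Cmod_R, Rabs_right by lra. replace (Cmod (cos t, sin t)) with 1; [ring|].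
    symmetry. unfold Cmod; simpl. replace (cos t * (cos t * 1) + sin t * (sin t * 1)) with 1; [apply sqrt_1|].
    assert (S := sin2_cos2 t). unfold Rsqr in S. lra. }
  destruct (holo_deriv _ _ Hh) as [dh Hdh].
  destruct (circle_min (fun z => h z - h z0)%C z0 (R0 / 2)) as [m [Hm Hmin]].
  - intros t. eapply cderiv_ccont. apply cderiv_minus; [apply Hdh, InD; rewrite OnC; lra|apply cderiv_const].
  - intros t E.
    assert (z0 + RtoC (R0 / 2) * (cos t, sin t) = z0)%C as Eq.
    { apply Hinj; [apply InD; rewrite OnC; lra|auto|].
      rewrite <- (Cplus_0_l (h z0)), <- E. ring. }
    specialize (OnC t). rewrite Eq in OnC. replace (z0 - z0)%C with (RtoC 0) in OnC by ring.
    rewrite Cmod_0 in OnC. lra.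
  - exists (m / 2); split; [lra|]. intros w Hw. apply NNPP. intros N.
    assert (Nw : forall z, Cmod (z - z0) < R0 -> (h z - w <> 0)%C).
    { intros z Hzz E. apply N. exists z. split; [auto|split; [lra|]].
      rewrite <- (Cplus_0_l w), <- E. ring. }
    assert (X := mean_value_bound (fun z => / (h z - w))%C
      (fun z => - (dh z - 0) / ((h z - w) * (h z - w)))%C z0 R0 PR).
    assert (Y : Cmod (/ (h z0 - w)) <= / (m / 2)).
    { apply X with (r := R0 / 2); [|lra|].
      - intros z Hzz. apply (cderiv_inv (fun z => h z - w)%C); auto.
        apply cderiv_minus; [apply Hdh; auto|apply cderiv_const].
      - intros t Ht. assert (Nt : (h (z0 + RtoC (R0 / 2) * (cos t, sin t)) - w <> 0)%C) by (apply Nw; rewrite OnC; lra).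
        rewrite Cmod_inv by auto. apply Rinv_le_contravar; [lra|].
        specialize (Hmin t Ht). cbv beta in Hmin.
        assert (T := Cmod_minus_triangle (h (z0 + RtoC (R0 / 2) * (cos t, sin t))%C) w (h z0)). lra. }
    assert (N0 : (h z0 - w <> 0)%C).
    { apply Nw. replace (z0 - z0)%C with (RtoC 0) by ring. rewrite Cmod_0; auto. }
    rewrite Cmod_inv in Y by auto.
    assert (P0 : 0 < Cmod (h z0 - w)) by (apply Cmod_gt_0; auto).
    rewrite Cmod_minus_sym in Hw.
    apply Rinv_lt_contravar in Hw; [lra|nra].
Qed.

(** The value outside the range of h is arbitrary, so membership in the range accompanies every
    use. *)
Definition finv (w : C) : C := epsilon (inhabits (RtoC 0)) (fun z => udisc z /\ h z = w).

Lemma finv_spec (w : C) : (exists z, udisc z /\ h z = w) -> udisc (finv w) /\ h (finv w) = w.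
Proof. intros H. exact (epsilon_spec _ _ H). Qed.

Lemma finv_h (z : C) : udisc z -> finv (h z) = z.
Proof.
  intros Hz. destruct (finv_spec (h z)) as [H1 H2]; [eauto|]. apply Hinj; auto.
Qed.

Lemma finv_cont (w : C) : (exists z, udisc z /\ h z = w) -> ccont finv w.
Proof.
  intros Hw eps He. destruct (finv_spec w Hw) as [U E].
  destruct (univalent_open (finv w) eps U He) as [d [Hd H]].
  exists d; split; auto. intros w' Hw'. rewrite <- E in Hw' at 1.
  destruct (H w') as [z [Uz [Hz Ez]]].
  - rewrite E in *. auto.
  - rewrite <- Ez at 1. rewrite finv_h; auto.
Qed.

Lemma finv_range_open (w : C) : (exists z, udisc z /\ h z = w) ->
  exists d, 0 < d /\ forall w', Cmod (w' - w) < d -> exists z, udisc z /\ h z = w'.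
Proof.
  intros [z [Uz <-]]. destruct (univalent_open z 1 Uz Rlt_0_1) as [d [Hd H]].
  exists d; split; auto. intros w' Hw'. destruct (H w' Hw') as [z' [U [_ E]]]. eauto.
Qed.

(** The condition on [l] is met later by [h_deriv_neq_0], from the flow equation rather than from
    univalence. *)
Lemma cderiv_finv (w l : C) : (exists z, udisc z /\ h z = w) ->
  cderiv h (finv w) l -> l <> 0%C -> cderiv finv w (/ l)%C.
Proof.
  intros Hw Hl Nl eps He. destruct (finv_spec w Hw) as [U E].
  assert (Pl : 0 < Cmod l) by (apply Cmod_gt_0; auto).
  set (k := Cmod l) in *.
  (* The first bound makes the inverse Lipschitz at w with constant 2 / k; the second compensates
     for this constant and for the factor 1 / k. *)
  set (eta := Rmin (k / 2) (eps * (k * k) / 2)).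
  assert (Heta : 0 < eta). { apply Rmin_glb_lt; [lra|]. assert (0 < k * k) by nra. nra. }
  assert (L1 : eta <= k / 2) by apply Rmin_l. assert (L2 : eta <= eps * (k * k) / 2) by apply Rmin_r.
  destruct (Hl eta Heta) as [d1 [Hd1 H1]].
  destruct (finv_cont w Hw d1 Hd1) as [d2 [Hd2 H2]].
  destruct (finv_range_open w Hw) as [d3 [Hd3 H3]].
  exists (Rmin d2 d3); split; [apply Rmin_glb_lt; auto|]. intros w' Hw'.
  assert (M1 := Rmin_l d2 d3). assert (M2 := Rmin_r d2 d3).
  specialize (H1 (finv w') (H2 w' ltac:(lra))).
  destruct (finv_spec w' (H3 w' ltac:(lra))) as [U' E'].
  rewrite E, E' in H1.
  set (D := (finv w' - finv w)%C) in *.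
  assert (B : k * Cmod D <= 2 * Cmod (w' - w)).
  { assert (T := Cmod_triangle_inv (l * D) (w' - w)).
    rewrite (Cmod_minus_sym (l * D)), Cmod_mult in T. fold k in T.
    assert (P := Cmod_ge_0 D). nra. }
  replace (D - / l * (w' - w))%C with (- / l * (w' - w - l * D))%C.
  2:{ unfold D. field. auto. }
  rewrite Cmod_mult, Cmod_opp, Cmod_inv by auto. fold k.
  apply Rmult_le_reg_l with (k * k); [nra|].
  replace (k * k * (/ k * Cmod (w' - w - l * D))) with (k * Cmod (w' - w - l * D)) by (field; lra).
  apply Rle_trans with (k * (eta * Cmod D)); [apply Rmult_le_compat_l; lra|].
  assert (P := Cmod_ge_0 (w' - w)).
  apply Rle_trans with (eta * (2 * Cmod (w' - w))); [nra|].
  assert (eta * (2 * Cmod (w' - w)) <= eps * (k * k) / 2 * (2 * Cmod (w' - w))); [apply Rmult_le_compat_r; lra|]. lra.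
Qed.

(** If w0 = h z0, openness near z0 makes h (s x) for s near 1 a value taken close to z0; by
    injectivity s x itself is close to z0, whereas |s x| tends to 1. *)
Lemma radial_limit_not_in_range (x w0 : C) : Cmod x = 1 ->
  (forall eps, 0 < eps -> exists s0, s0 < 1 /\ forall s, s0 < s < 1 -> Cmod (h (RtoC s * x)%C - w0) < eps) ->
  ~ exists z, udisc z /\ h z = w0.
Proof.
  intros Hx Hlim [z0 [Uz <-]].
  assert (U := Uz). unfold udisc in U.
  destruct (univalent_open z0 ((1 - Cmod z0) / 2) Uz ltac:(lra)) as [d [Hd H]].
  destruct (Hlim d Hd) as [s0 [Hs0 Hs]].
  set (s := Rmax (Rmax s0 0) (1 - (1 - Cmod z0) / 2)).
  assert (P0 := Cmod_ge_0 z0).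
  assert (M1 := Rmax_l (Rmax s0 0) (1 - (1 - Cmod z0) / 2)). assert (M2 := Rmax_r (Rmax s0 0) (1 - (1 - Cmod z0) / 2)).
  assert (M3 := Rmax_l s0 0). assert (M4 := Rmax_r s0 0).
  assert (Ls : s < 1) by (unfold s; repeat apply Rmax_lub_lt; lra). fold s in M1, M2.
  set (s' := (s + 1) / 2).
  assert (N : Cmod (RtoC s' * x) = s') by (rewrite Cmod_mult, Hx, Cmod_R, Rabs_right by (unfold s'; lra); ring).
  destruct (H _ (Hs s' ltac:(unfold s'; lra))) as [z [Uz' [Hz Ez]]].
  assert (E : z = (RtoC s' * x)%C). { apply Hinj; auto. unfold udisc. rewrite N. unfold s'; lra. }
  subst z. assert (T := Cmod_triangle_inv (RtoC s' * x) z0). rewrite N in T. unfold s' in *. lra.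
Qed.

End univalent_function.

(** * Semigroups and horocycles *)

Definition sqmod (z : C) : R := fst z * fst z + snd z * snd z.

Lemma sqmod_Cmod (z : C) : sqmod z = Cmod z * Cmod z.
Proof. symmetry. apply Cmod_sqr. Qed.

Lemma sqmod_pos (z : C) : 0 <= sqmod z.
Proof. unfold sqmod. nra. Qed.

Lemma udisc_sqmod (z : C) : udisc z <-> sqmod z < 1.
Proof. apply Cmod_lt_1_sqr. Qed.

Lemma conj_factor_pos (tau z : C) : Cmod tau <= 1 -> udisc z -> 0 < sqmod (1 - Cconj tau * z)%C.
Proof.
  intros Ht Hz. rewrite sqmod_Cmod. unfold udisc in Hz.
  assert (T := Cmod_triangle_inv 1 (Cconj tau * z)). rewrite Cmod_1, Cmod_mult, Cmod_conj in T.
  assert (P := Cmod_ge_0 tau). assert (Q := Cmod_ge_0 z).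
  assert (Cmod tau * Cmod z < 1) by nra. nra.
Qed.

Lemma conj_factor_neq_0 (tau z : C) : Cmod tau <= 1 -> udisc z -> (1 - Cconj tau * z <> 0)%C.
Proof.
  intros Ht Hz E. assert (P := conj_factor_pos tau z Ht Hz). rewrite E in P. unfold sqmod in P. simpl in P. lra.
Qed.

Lemma sqmod_cont (a z : C) (eps : R) : 0 < eps ->
  exists d, 0 < d /\ forall w, Cmod (w - z) < d -> Rabs (sqmod (1 - Cconj w * a) - sqmod (1 - Cconj z * a)) < eps.
Proof.
  intros He. assert (P := Cmod_ge_0 a). assert (Q := Cmod_ge_0 (1 - Cconj z * a)).
  set (B := 2 * Cmod (1 - Cconj z * a) + Cmod a + 1).
  assert (HB : 0 < B * (Cmod a + 1)) by (apply Rmult_lt_0_compat; unfold B; lra).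
  exists (Rmin 1 (eps / (B * (Cmod a + 1)))). split.
  { apply Rmin_glb_lt; [lra|]. apply Rdiv_lt_0_compat; auto. }
  intros w Hw. assert (L1 := Rmin_l 1 (eps / (B * (Cmod a + 1)))). assert (L2 := Rmin_r 1 (eps / (B * (Cmod a + 1)))).
  rewrite !sqmod_Cmod.
  set (p := Cmod (1 - Cconj w * a)). set (q := Cmod (1 - Cconj z * a)) in *.
  assert (D : Rabs (p - q) <= Cmod a * Cmod (w - z)).
  { assert (E : Cmod ((1 - Cconj w * a) - (1 - Cconj z * a)) = Cmod a * Cmod (w - z)).
    { replace ((1 - Cconj w * a) - (1 - Cconj z * a))%C with (- (a * Cconj (w - z)))%C by (rewrite Cminus_conj; ring).
      rewrite Cmod_opp, Cmod_mult, Cmod_conj. auto. }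
    rewrite <- E. assert (T1 := Cmod_triangle_inv (1 - Cconj w * a) (1 - Cconj z * a)).
    assert (T2 := Cmod_triangle_inv (1 - Cconj z * a) (1 - Cconj w * a)).
    rewrite (Cmod_minus_sym (1 - Cconj z * a)) in T2. fold p q in T1, T2. apply Rabs_le_between; lra. }
  replace (p * p - q * q) with ((p - q) * (p + q)) by ring. rewrite Rabs_mult.
  assert (Pw := Cmod_ge_0 (w - z)).
  assert (P1 : Rabs (p + q) <= B).
  { assert (0 <= p) by apply Cmod_ge_0. rewrite Rabs_right by lra. apply Rabs_le_between in D. unfold B.
    assert (Cmod a * Cmod (w - z) <= Cmod a * 1) by (apply Rmult_le_compat_l; lra). lra. }
  apply Rle_lt_trans with (Cmod a * Cmod (w - z) * B).
  { apply Rmult_le_compat; auto; apply Rabs_pos. }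
  assert (PB : 0 < B) by (unfold B; lra).
  apply Rle_lt_trans with (Cmod (w - z) * (B * (Cmod a + 1))); [nra|].
  replace eps with (eps / (B * (Cmod a + 1)) * (B * (Cmod a + 1))) by (field; nra).
  apply Rmult_lt_compat_r; lra.
Qed.

Lemma bernoulli_growth (q : nat -> R) (e : R) : 0 <= e -> 0 < q 0%nat ->
  (forall n, (1 + e) * q n <= q (S n)) -> forall n, (1 + INR n * e) * q 0%nat <= q n.
Proof.
  intros He H0 Hs. assert (P : forall n, 0 < q n).
  { induction n; auto. specialize (Hs n). nra. }
  induction n; [simpl; lra|].
  specialize (Hs n). rewrite S_INR. assert (X := pos_INR n).
  assert (0 <= INR n * e * e * q 0%nat). { repeat apply Rmult_le_pos; lra. }
  assert ((1 + e) * ((1 + INR n * e) * q 0%nat) <= (1 + e) * q n) by (apply Rmult_le_compat_l; lra). nra.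
Qed.

Section semigroup.
Variables (phi : R -> C -> C) (G : C -> C) (tau : C).
Hypothesis phi_holo : forall t, 0 <= t -> holo udisc (phi t).
Hypothesis phi_disc : forall t z, 0 <= t -> udisc z -> udisc (phi t z).
Hypothesis phi_add : forall s t z, 0 <= s -> 0 <= t -> udisc z -> phi (s + t) z = phi s (phi t z).
Hypothesis phi_0 : forall z, udisc z -> phi 0 z = z.
Hypothesis G_holo : holo udisc G.
Hypothesis gen_0 : forall z eps, udisc z -> 0 < eps -> exists d, 0 < d /\
  forall s, 0 < s < d -> Cmod (phi s z - z - RtoC s * G z) <= eps * s.
Hypothesis gen_t : forall z t, udisc z -> 0 < t -> curve_deriv (fun s => phi s z) t (G (phi t z)).
Hypothesis tau_le : Cmod tau <= 1.
Hypothesis dw : forall z eps, udisc z -> 0 < eps -> exists T, forall t, T <= t -> Cmod (phi t z - tau) < eps.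

(* Schwarz-Pick between [z] and the orbit of [0], which tends to [tau]: along that orbit
   [1 - |z|^2] cannot grow geometrically for ever. *)
Lemma horocycle_monotone (t : R) (z : C) : 0 <= t -> udisc z ->
  sqmod (1 - Cconj tau * phi t z)%C * (1 - sqmod z)
  <= sqmod (1 - Cconj tau * z)%C * (1 - sqmod (phi t z)).
Proof.
  intros Ht Hz. destruct Ht as [Ht|<-]; [|rewrite phi_0 by auto; lra].
  assert (U0 : udisc 0%C) by (unfold udisc; rewrite Cmod_0; lra).
  set (a := fun n => phi (INR n * t) 0%C).
  assert (Pn : forall n, 0 <= INR n * t) by (intros; apply Rmult_le_pos; [apply pos_INR|lra]).
  assert (Ua : forall n, udisc (a n)) by (intros; apply phi_disc; auto).
  assert (aS : forall n, phi t (a n) = a (S n)).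
  { intros n. unfold a. rewrite <- phi_add by (auto; lra). f_equal. rewrite S_INR. ring. }
  set (q := fun n => 1 - sqmod (a n)).
  assert (Pq : forall n, 0 < q n) by (intros n; unfold q; assert (X := proj1 (udisc_sqmod _) (Ua n)); lra).
  assert (q1 : forall n, q n <= 1) by (intros n; unfold q; assert (X := sqmod_pos (a n)); lra).
  assert (Uf := phi_disc t z ltac:(lra) Hz).
  assert (Pz := proj1 (udisc_sqmod _) Hz). assert (Pf := proj1 (udisc_sqmod _) Uf).
  set (w := phi t z) in *.
  assert (SP : forall n, (1 - sqmod z) * q n * sqmod (1 - Cconj (a (S n)) * w)%C
     <= (1 - sqmod w) * q (S n) * sqmod (1 - Cconj (a n) * z)%C).
  { intros n. assert (X := schwarz_pick_sqr (phi t) (a n) z (phi_holo t ltac:(lra))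
      (fun z Hz => phi_disc t z ltac:(lra) Hz) (Ua n) Hz).
    rewrite aS, <- !sqmod_Cmod in X. fold w in X. exact X. }
  apply Rnot_lt_le. intros N.
  set (A := sqmod (1 - Cconj tau * w)%C * (1 - sqmod z)) in *.
  set (B := sqmod (1 - Cconj tau * z)%C * (1 - sqmod w)) in *.
  assert (PB : 0 < B) by (unfold B; apply Rmult_lt_0_compat; [apply conj_factor_pos; auto|lra]).
  set (k := (A - B) / 4). assert (Pk : 0 < k) by (unfold k; lra).
  destruct (sqmod_cont w tau k Pk) as [d1 [Hd1 H1]].
  destruct (sqmod_cont z tau k Pk) as [d2 [Hd2 H2]].
  destruct (dw 0%C (Rmin d1 d2) U0 ltac:(apply Rmin_glb_lt; auto)) as [T HT].
  destruct (INR_unbounded (T / t)) as [N0 HN0].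
  assert (Near : forall n, (N0 <= n)%nat -> Cmod (a n - tau) < Rmin d1 d2).
  { intros n Hn. apply HT. apply Rle_trans with (INR N0 * t).
    - apply Rmult_lt_compat_r with (r := t) in HN0; auto. unfold Rdiv in HN0.
      rewrite Rmult_assoc, Rinv_l in HN0 by lra. lra.
    - apply Rmult_le_compat_r; [lra|]. apply le_INR; auto. }
  assert (L1 := Rmin_l d1 d2). assert (L2 := Rmin_r d1 d2).
  (* If A > B, then [SP], with both points of the orbit of 0 close to tau, multiplies q by at least
     1 + e at each step, although q stays at most 1. *)
  set (e := (A - k) / (B + k) - 1).
  assert (Pe : 0 < e).
  { unfold e. assert (1 < (A - k) / (B + k)); [|lra].
    apply Rmult_lt_reg_r with (B + k); [lra|]. unfold Rdiv. rewrite Rmult_assoc, Rinv_l by lra. unfold k; lra. }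
  assert (Grow : forall n, (N0 <= n)%nat -> (1 + e) * q n <= q (S n)).
  { intros n Hn. specialize (SP n).
    assert (X1 := H1 (a (S n)) ltac:(specialize (Near (S n) ltac:(lia)); lra)).
    assert (X2 := H2 (a n) ltac:(specialize (Near n Hn); lra)).
    apply Rabs_def2 in X1. apply Rabs_def2 in X2.
    assert (Sz := sqmod_pos z). assert (Sw := sqmod_pos w).
    assert (Y1 : A - k <= (1 - sqmod z) * sqmod (1 - Cconj (a (S n)) * w)%C) by (unfold A; nra).
    assert (Y2 : (1 - sqmod w) * sqmod (1 - Cconj (a n) * z)%C <= B + k) by (unfold B; nra).
    assert (Pq0 := Pq n). assert (Pq1 := Pq (S n)).
    assert (Z : (A - k) * q n <= (B + k) * q (S n)) by nra.
    apply Rmult_le_reg_l with (B + k); [lra|].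
    replace ((B + k) * ((1 + e) * q n)) with ((A - k) * q n) by (unfold e; field; lra). exact Z. }
  assert (Bn := bernoulli_growth (fun n => q (N0 + n)%nat) e ltac:(lra)).
  cbv beta in Bn. rewrite Nat.add_0_r in Bn.
  specialize (Bn (Pq N0)).
  assert (Bn' : forall n, (1 + INR n * e) * q N0 <= q (N0 + n)%nat).
  { apply Bn. intros n. rewrite Nat.add_succ_r. apply Grow. lia. }
  destruct (INR_unbounded (/ (e * q N0))) as [m Hm].
  specialize (Bn' m). specialize (q1 (N0 + m)%nat). assert (PN := Pq N0).
  assert (Peq : 0 < e * q N0) by (apply Rmult_lt_0_compat; auto).
  apply Rmult_lt_compat_r with (r := e * q N0) in Hm; auto. rewrite Rinv_l in Hm by lra. nra.
Qed.

(** Up to the factor -2 / (1 - |z|^2)^2, [hfac] is the complex gradient of [horo] (see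
    [is_derive_horo]); its product with [cfac] is real and nonnegative, which links it to the
    Berkson-Porta quotient [pgen]. *)
Definition hfac (z : C) : C := (Cconj (1 - Cconj tau * z) * (Cconj tau - Cconj z))%C.
Definition cfac (z : C) : C := ((tau - z) * (1 - Cconj tau * z))%C.
Definition pgen (z : C) : C := (G z / cfac z)%C.
(** One function for both positions of tau: its sublevel sets are horodiscs at tau when |tau| = 1
    and hyperbolic discs about tau when |tau| < 1. *)
Definition horo (z : C) : R := sqmod (1 - Cconj tau * z)%C / (1 - sqmod z).

Lemma horo_mono (t : R) (z : C) : 0 <= t -> udisc z -> horo (phi t z) <= horo z.
Proof.
  intros Ht Hz. unfold horo. assert (X := horocycle_monotone t z Ht Hz).
  assert (P1 := proj1 (udisc_sqmod _) Hz). assert (P2 := proj1 (udisc_sqmod _) (phi_disc t z Ht Hz)).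
  apply Rmult_le_reg_r with ((1 - sqmod (phi t z)) * (1 - sqmod z)); [nra|].
  eapply Rle_trans; [|eapply Rle_trans; [exact X|]]; right; field; lra.
Qed.

(** With d = phi s z - z, horocycle monotonicity reads 2 Re (hfac z * d) >= a nonnegative multiple
    of |d|^2, so the sign of Re (hfac z * d) is exact for each s; dividing by s -> 0 passes it to
    G. *)
Lemma hfac_G_pos (z : C) : udisc z -> 0 <= Re (hfac z * G z).
Proof.
  intros Hz.
  assert (K : forall s, 0 <= s -> 0 <= Re (hfac z * (phi s z - z))).
  { intros s Hs. assert (X := horocycle_monotone s z Hs Hz).
    set (d := (phi s z - z)%C). replace (phi s z) with (z + d)%C in X by (unfold d; ring). clearbody d.
    assert (P1 := proj1 (udisc_sqmod _) Hz).
    assert (E : sqmod (1 - Cconj tau * z)%C * (1 - sqmod (z + d)%C) - sqmod (1 - Cconj tau * (z + d))%C * (1 - sqmod z)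
      = 2 * Re (hfac z * d) - (sqmod (1 - Cconj tau * z)%C + sqmod tau * (1 - sqmod z)) * sqmod d).
    { unfold sqmod, hfac, Re. simpl. ring. }
    assert (Q1 := sqmod_pos (1 - Cconj tau * z)%C). assert (Q2 := sqmod_pos tau). assert (Q3 := sqmod_pos d).
    assert (0 <= (sqmod (1 - Cconj tau * z)%C + sqmod tau * (1 - sqmod z)) * sqmod d).
    { apply Rmult_le_pos; auto. assert (0 <= sqmod tau * (1 - sqmod z)) by (apply Rmult_le_pos; lra). lra. }
    lra. }
  apply Rnot_lt_le. intros N. set (k := - Re (hfac z * G z)). assert (Pk : 0 < k) by (unfold k; lra).
  assert (Ph := Cmod_ge_0 (hfac z)).
  assert (He : 0 < k / (2 * (Cmod (hfac z) + 1))) by (apply Rdiv_lt_0_compat; lra).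
  destruct (gen_0 z _ Hz He) as [d [Hd Hs]].
  specialize (Hs (d / 2) ltac:(lra)). specialize (K (d / 2) ltac:(lra)).
  set (s := d / 2) in *. assert (Ps : 0 < s) by (unfold s; lra).
  assert (Y := re_le_Cmod (hfac z * (phi s z - z - RtoC s * G z))). rewrite Cmod_mult in Y.
  replace (hfac z * (phi s z - z - RtoC s * G z))%C with (hfac z * (phi s z - z) + - (RtoC s * (hfac z * G z)))%C in Y by ring.
  rewrite re_plus, re_opp, re_scal_l in Y.
  apply Rabs_le_between in Y.
  assert (Z : Cmod (hfac z) * Cmod (phi s z - z - RtoC s * G z) <= (Cmod (hfac z) + 1) * (k / (2 * (Cmod (hfac z) + 1)) * s)).
  { apply Rmult_le_compat; auto; try apply Cmod_ge_0. lra. }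
  replace ((Cmod (hfac z) + 1) * (k / (2 * (Cmod (hfac z) + 1)) * s)) with (k * s / 2) in Z by (field; lra).
  unfold k in *. nra.
Qed.

Lemma cfac_neq_0 (z : C) : udisc z -> z <> tau -> cfac z <> 0%C.
Proof.
  intros Hz Hn. apply Cmult_neq_0; [|apply conj_factor_neq_0; auto].
  intros E. apply Hn. rewrite <- (Cplus_0_r z), <- E. ring.
Qed.

Lemma hfac_cfac (z : C) : (hfac z * cfac z = RtoC (sqmod (1 - Cconj tau * z) * sqmod (tau - z)))%C.
Proof. unfold hfac, cfac, sqmod. Cext; ring. Qed.

Lemma hfac_G (z : C) : udisc z -> z <> tau ->
  Re (hfac z * G z) = sqmod (1 - Cconj tau * z)%C * sqmod (tau - z)%C * Re (pgen z).
Proof.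
  intros Hz Hn. assert (N := cfac_neq_0 z Hz Hn).
  replace (hfac z * G z)%C with (hfac z * cfac z * pgen z)%C by (unfold pgen; field; auto).
  rewrite hfac_cfac, re_scal_l. auto.
Qed.

Lemma pgen_pos (z : C) : udisc z -> z <> tau -> 0 <= Re (pgen z).
Proof.
  intros Hz Hn. assert (X := hfac_G_pos z Hz). rewrite hfac_G in X by auto.
  assert (P1 := conj_factor_pos tau z tau_le Hz).
  assert (P2 : 0 < sqmod (tau - z)%C).
  { rewrite sqmod_Cmod. assert (0 < Cmod (tau - z)); [|nra]. apply Cmod_gt_0.
    intros E. apply Hn. rewrite <- (Cplus_0_r z), <- E. ring. }
  assert (0 < sqmod (1 - Cconj tau * z)%C * sqmod (tau - z)%C) by (apply Rmult_lt_0_compat; auto). nra.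
Qed.

Lemma is_derive_horo (g : R -> C) (t : R) (v : C) : udisc (g t) -> curve_deriv g t v ->
  is_derive (fun s => horo (g s)) t (- 2 * Re (hfac (g t) * v) / ((1 - sqmod (g t)) * (1 - sqmod (g t)))).
Proof.
  intros Hz [D1 D2]. assert (P := proj1 (udisc_sqmod _) Hz). unfold sqmod in P.
  assert (M : forall (a b : R -> R) (a' b' : R), is_derive a t a' -> is_derive b t b' ->
    a t * a t + b t * b t < 1 ->
    is_derive (fun s => horo (a s, b s)) t
      (- 2 * Re (hfac (a t, b t) * (a', b')) / ((1 - sqmod (a t, b t)) * (1 - sqmod (a t, b t))))).
  { intros a b a' b' Da Db Hab. unfold horo, sqmod. simpl. auto_derive.
    - repeat split; try (eexists; eassumption); try lra.
    - replace (Derive (fun x => a x) t) with a' by (symmetry; apply is_derive_unique; auto).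
      replace (Derive (fun x => b x) t) with b' by (symmetry; apply is_derive_unique; auto).
      unfold hfac, Re; simpl. field. lra. }
  specialize (M (fun s => fst (g s)) (fun s => snd (g s)) (fst v) (snd v) D1 D2 P).
  cbv beta in M. rewrite <- !surjective_pairing in M.
  eapply is_derive_ext; [|exact M]. intros s. cbv beta. rewrite <- surjective_pairing. reflexivity.
Qed.

End semigroup.

(** * The orbit issuing from the boundary point *)

Definition near_one (P : R -> Prop) : Prop := exists s0, s0 < 1 /\ forall s, s0 < s < 1 -> P s.

Lemma near_one_and (P Q : R -> Prop) : near_one P -> near_one Q -> near_one (fun s => P s /\ Q s).
Proof.
  intros [s0 [H0 H]] [s1 [H1 H']]. exists (Rmax s0 s1). split; [apply Rmax_lub_lt; auto|].
  intros s Hs. assert (L1 := Rmax_l s0 s1). assert (L2 := Rmax_r s0 s1). split; [apply H|apply H']; lra.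
Qed.

Lemma near_one_ex (P : R -> Prop) : near_one P -> exists s, 0 < s < 1 /\ P s.
Proof.
  intros [s0 [H0 H]]. assert (L1 := Rmax_l s0 0). assert (L2 := Rmax_r s0 0).
  assert (L3 : Rmax s0 0 < 1) by (apply Rmax_lub_lt; lra).
  exists ((Rmax s0 0 + 1) / 2). split; [lra|apply H; lra].
Qed.

Lemma near_one_gt (a : R) : a < 1 -> near_one (fun s => a < s).
Proof. intros H. exists a; split; auto. intros; lra. Qed.

(* [sh] is the linear model of the semigroup in the image of the Koenigs function [h], with
   vector field [X]: translations ([X = 1]) when [tau] is on the circle, [w -> e^(lambda t) w]
   ([X w = lambda w]) when [tau] is inside. *)
Record linear_model (phi : R -> C -> C) (tau : C) (h : C -> C) (sh : R -> C -> C) (X : C -> C) : Prop := {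
  model_holo : holo udisc h;
  model_inj : forall z w, udisc z -> udisc w -> h z = h w -> z = w;
  model_conj : forall t z, 0 <= t -> udisc z -> h (phi t z) = sh t (h z);
  model_flow : forall t w, curve_deriv (fun s => sh s w) t (X (sh t w));
  model_0 : forall w, sh 0 w = w;
  model_add : forall s t w, sh (s + t) w = sh s (sh t w);
  model_cont : forall t w, ccont (sh t) w;
  model_lip : exists La, 0 < La /\ forall a b, Cmod (X a - X b) <= La * Cmod (a - b);
  model_neq : forall z, udisc z -> z <> tau -> X (h z) <> 0%C;
  model_tau : forall l, udisc tau -> cderiv h tau l -> l <> 0%C }.
Arguments model_holo {phi tau h sh X}.
Arguments model_inj {phi tau h sh X}.
Arguments model_conj {phi tau h sh X}.
Arguments model_flow {phi tau h sh X}.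
Arguments model_0 {phi tau h sh X}.
Arguments model_add {phi tau h sh X}.
Arguments model_cont {phi tau h sh X}.
Arguments model_lip {phi tau h sh X}.
Arguments model_neq {phi tau h sh X}.
Arguments model_tau {phi tau h sh X}.

(** It has to be the first such time: the later arguments need all earlier values below [m]. *)
Lemma first_hit (f : R -> R) (m T : R) : 0 <= T ->
  (forall t eps, 0 <= t <= T -> 0 < eps -> exists d, 0 < d /\
     forall s, 0 <= s <= T -> Rabs (s - t) < d -> Rabs (f s - f t) < eps) ->
  f 0 < m <= f T -> exists c, 0 < c <= T /\ f c = m /\ forall u, 0 <= u < c -> f u < m.
Proof.
  intros HT Hc [H0 Hm].
  destruct (completeness (fun u => 0 <= u <= T /\ forall v, 0 <= v <= u -> f v < m)) as [c [Hub Hlub]].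
  - exists T. intros u [Hu _]. lra.
  - exists 0. split; [lra|]. intros v Hv. replace v with 0 by lra. auto.
  - assert (c0 : 0 <= c). { apply Hub. split; [lra|]. intros v Hv. replace v with 0 by lra. auto. }
    assert (cT : c <= T). { apply Hlub. intros u [Hu _]. lra. }
    assert (Before : forall u, 0 <= u < c -> f u < m).
    { intros u Hu. apply NNPP. intros N.
      assert (c <= u); [|lra]. apply Hlub. intros v [Hv Hvv]. apply Rnot_lt_le. intros L. apply N, Hvv. lra. }
    assert (Ge : m <= f c).
    { apply Rnot_lt_le. intros L.
      destruct (Hc c (m - f c) ltac:(lra) ltac:(lra)) as [d [Hd Hs]].
      assert (cT' : c < T). { destruct (Rle_lt_or_eq_dec _ _ cT); auto. subst. lra. }
      set (u := Rmin T (c + d / 2)).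
      assert (u1 : u <= T) by apply Rmin_l. assert (u2 : u <= c + d / 2) by apply Rmin_r.
      assert (u3 : c < u) by (apply Rmin_glb_lt; lra).
      assert (u <= c); [|lra]. apply Hub. split; [lra|]. intros v Hv.
      destruct (Rlt_le_dec v c); [apply Before; lra|].
      assert (X := Hs v ltac:(lra) ltac:(rewrite Rabs_right; lra)). apply Rabs_def2 in X. lra. }
    assert (cpos : 0 < c). { destruct c0 as [|E]; auto. rewrite <- E in Ge. lra. }
    exists c. split; [lra|split; auto].
    apply Rle_antisym; auto. apply Rnot_lt_le. intros L.
    destruct (Hc c (f c - m) ltac:(lra) ltac:(lra)) as [d [Hd Hs]].
    set (u := Rmax 0 (c - d / 2)).
    assert (u1 : 0 <= u) by apply Rmax_l. assert (u2 : c - d / 2 <= u) by apply Rmax_r.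
    assert (u3 : u < c) by (apply Rmax_lub_lt; lra).
    assert (X := Hs u ltac:(lra) ltac:(rewrite Rabs_left; lra)). apply Rabs_def2 in X.
    specialize (Before u ltac:(lra)). lra.
Qed.

Lemma trig_period_Z (k : Z) (t : R) : cos (t + 2 * IZR k * PI) = cos t /\ sin (t + 2 * IZR k * PI) = sin t.
Proof.
  destruct (Z.le_gt_cases 0 k) as [H|H].
  - rewrite <- (Z2Nat.id k) by auto. rewrite <- INR_IZR_INZ. split; [apply cos_period|apply sin_period].
  - assert (E : t = (t + 2 * IZR k * PI) + 2 * INR (Z.to_nat (- k)) * PI).
    { rewrite INR_IZR_INZ, Z2Nat.id by lia. rewrite opp_IZR. ring. }
    split; [rewrite E at 2; rewrite cos_period; auto|rewrite E at 2; rewrite sin_period; auto].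
Qed.

Lemma unit_polar (e : C) (a : R) : Cmod e = 1 -> exists t, a <= t < a + 2 * PI /\ e = (cos t, sin t).
Proof.
  intros He. assert (PI0 := PI_RGT_0).
  assert (S := Cmod_sqr e). rewrite He in S.
  assert (B : -1 <= fst e <= 1) by nra.
  assert (T : exists t, e = (cos t, sin t)).
  { assert (Q := sin2_cos2 (acos (fst e))). unfold Rsqr in Q. rewrite cos_acos in Q by lra.
    assert (Ps : 0 <= sin (acos (fst e))). { apply sin_ge_0; apply acos_bound. }
    destruct (Rle_lt_dec 0 (snd e)).
    - exists (acos (fst e)). Cext; [rewrite cos_acos; lra|]. apply Rsqr_inj; auto. unfold Rsqr. lra.
    - exists (- acos (fst e)). rewrite cos_neg, sin_neg. Cext; [rewrite cos_acos; lra|].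
      assert (- snd e = sin (acos (fst e))); [|lra]. apply Rsqr_inj; auto; [lra|]. unfold Rsqr. lra. }
  destruct T as [t Et].
  destruct (archimed ((a - t) / (2 * PI))) as [A1 A2].
  set (k := up ((a - t) / (2 * PI))) in *.
  assert (Q : (a - t) = (a - t) / (2 * PI) * (2 * PI)) by (field; lra).
  set (q := (a - t) / (2 * PI)) in *.
  assert (Eq : forall j, e = (cos (t + 2 * IZR j * PI), sin (t + 2 * IZR j * PI))).
  { intros j. destruct (trig_period_Z j t) as [-> ->]. auto. }
  destruct (Rle_lt_dec (IZR k - q) 0); [lra|].
  (* [up q] equals q + 1 when q is an integer; then k - 1 gives the angle in the half-open
     interval. *)
  destruct (Req_dec (IZR k - q) 1) as [E1|E1].
  - exists (t + 2 * IZR (k - 1) * PI). split; [rewrite minus_IZR; nra|apply Eq].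
  - exists (t + 2 * IZR k * PI). split; [|apply Eq].
    assert (IZR k - q < 1) by lra. nra.
Qed.

Lemma max_quasiconvex (g1 g2 : C -> R) :
  quasiconvex_lip g1 -> quasiconvex_lip g2 -> quasiconvex_lip (fun z => Rmax (g1 z) (g2 z)).
Proof.
  intros [A1 A2] [B1 B2]. split.
  - intros a b s Hs. apply Rmax_lub.
    + eapply Rle_trans; [apply A1; auto|]. apply Rmax_lub.
      * eapply Rle_trans; [apply Rmax_l|apply Rmax_l].
      * eapply Rle_trans; [apply Rmax_l|apply Rmax_r].
    + eapply Rle_trans; [apply B1; auto|]. apply Rmax_lub.
      * eapply Rle_trans; [apply Rmax_r|apply Rmax_l].
      * eapply Rle_trans; [apply Rmax_r|apply Rmax_r].
  - intros a b. apply Rmax_lub.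
    + eapply Rle_trans; [apply A2|]. apply Rplus_le_compat_r, Rmax_l.
    + eapply Rle_trans; [apply B2|]. apply Rplus_le_compat_r, Rmax_r.
Qed.

Lemma disc_quasiconvex (c : C) (r : R) : quasiconvex_lip (fun z => Cmod (z - c) - r).
Proof.
  split.
  - intros a b s Hs.
    assert (X := seg_point_close a b c s (Rmax (Cmod (a - c)) (Cmod (b - c))) Hs (Rmax_l _ _) (Rmax_r _ _)).
    destruct (Rle_lt_dec (Cmod (a - c)) (Cmod (b - c))).
    + rewrite Rmax_right in X by auto. assert (Y := Rmax_r (Cmod (a - c) - r) (Cmod (b - c) - r)). lra.
    + rewrite Rmax_left in X by lra. assert (Y := Rmax_l (Cmod (a - c) - r) (Cmod (b - c) - r)). lra.
  - intros a b. assert (T := Cmod_minus_triangle a b c). lra.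
Qed.

Section orbit.
Variables (phi : R -> C -> C) (G : C -> C) (tau : C).
Hypothesis phi_holo : forall t, 0 <= t -> holo udisc (phi t).
Hypothesis phi_disc : forall t z, 0 <= t -> udisc z -> udisc (phi t z).
Hypothesis phi_add : forall s t z, 0 <= s -> 0 <= t -> udisc z -> phi (s + t) z = phi s (phi t z).
Hypothesis phi_0 : forall z, udisc z -> phi 0 z = z.
Hypothesis G_holo : holo udisc G.
Hypothesis gen_0 : forall z eps, udisc z -> 0 < eps -> exists d, 0 < d /\
  forall s, 0 < s < d -> Cmod (phi s z - z - RtoC s * G z) <= eps * s.
Hypothesis gen_t : forall z t, udisc z -> 0 < t -> curve_deriv (fun s => phi s z) t (G (phi t z)).
Hypothesis tau_le : Cmod tau <= 1.
Hypothesis dw : forall z eps, udisc z -> 0 < eps -> exists T, forall t, T <= t -> Cmod (phi t z - tau) < eps.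
Variables (h : C -> C) (sh : R -> C -> C) (X : C -> C).
Hypothesis M : linear_model phi tau h sh X.

(** The conjugacy [h (phi t z) = sh t (h z)], differentiated at t = 0 from the right. *)
Lemma h_deriv_G (z l : C) : udisc z -> cderiv h z l -> (l * G z = X (h z))%C.
Proof.
  intros Hz Hl. apply NNPP. intros N.
  set (k := Cmod (l * G z - X (h z))).
  assert (Pk : 0 < k).
  { apply Cmod_gt_0. intros E. apply N. rewrite <- (Cplus_0_r (X (h z))), <- E. ring. }
  assert (Pl := Cmod_ge_0 l). assert (PG := Cmod_ge_0 (G z)).
  set (e := Rmin 1 (k / (2 * (Cmod l + Cmod (G z) + 2)))).
  assert (He : 0 < e). { apply Rmin_glb_lt; [lra|]. apply Rdiv_lt_0_compat; lra. }
  assert (e1 : e <= 1) by apply Rmin_l.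
  assert (e2 : e * (Cmod l + Cmod (G z) + 2) <= k / 2).
  { apply Rle_trans with (k / (2 * (Cmod l + Cmod (G z) + 2)) * (Cmod l + Cmod (G z) + 2)).
    - apply Rmult_le_compat_r; [lra|apply Rmin_r].
    - right; field; lra. }
  destruct (gen_0 z e Hz He) as [d1 [Hd1 H1]].
  destruct (Hl e He) as [d2 [Hd2 H2]].
  destruct (proj1 (curve_deriv_eps _ _ _) (model_flow M 0 (h z)) e He) as [d3 [Hd3 H3]].
  set (s := Rmin d1 (Rmin (d2 / (Cmod (G z) + 1)) d3) / 2).
  assert (L1 := Rmin_l d1 (Rmin (d2 / (Cmod (G z) + 1)) d3)).
  assert (L2 := Rmin_r d1 (Rmin (d2 / (Cmod (G z) + 1)) d3)).
  assert (L3 := Rmin_l (d2 / (Cmod (G z) + 1)) d3). assert (L4 := Rmin_r (d2 / (Cmod (G z) + 1)) d3).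
  assert (P0 : 0 < Rmin d1 (Rmin (d2 / (Cmod (G z) + 1)) d3)).
  { repeat apply Rmin_glb_lt; auto. apply Rdiv_lt_0_compat; lra. }
  assert (Ps : 0 < s) by (unfold s; lra).
  specialize (H1 s ltac:(unfold s in *; lra)).
  specialize (H3 s). rewrite Rminus_0_r, Rabs_right in H3 by lra. specialize (H3 ltac:(unfold s in *; lra)).
  rewrite (model_0 M), <- (model_conj M) in H3 by (auto; lra).
  set (d := (phi s z - z)%C) in *.
  assert (Bd : Cmod d <= (Cmod (G z) + 1) * s).
  { assert (T := Cmod_triangle (d - RtoC s * G z) (RtoC s * G z)).
    replace (d - RtoC s * G z + RtoC s * G z)%C with d in T by ring.
    rewrite Cmod_mult, Cmod_R, Rabs_right in T by lra. nra. }
  specialize (H2 (phi s z)). fold d in H2.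
  assert (Hd : Cmod d < d2).
  { eapply Rle_lt_trans; [exact Bd|].
    replace d2 with ((Cmod (G z) + 1) * (d2 / (Cmod (G z) + 1))) by (field; lra).
    apply Rmult_lt_compat_l; unfold s in *; lra. }
  specialize (H2 Hd).
  assert (E : ((l * G z - X (h z)) * RtoC s = (h (phi s z) - h z - X (h z) * RtoC s)
     + - (h (phi s z) - h z - l * d) + - (l * (d - RtoC s * G z)))%C) by ring.
  assert (F : k * s <= e * s + e * Cmod d + Cmod l * (e * s)).
  { unfold k. rewrite <- (Rabs_right s) at 1 by lra. rewrite <- Cmod_R, <- Cmod_mult, E.
    eapply Rle_trans; [apply Cmod_triangle|]. rewrite Cmod_opp, Cmod_mult.
    apply Rplus_le_compat; [|apply Rmult_le_compat_l; auto].
    eapply Rle_trans; [apply Cmod_triangle|]. rewrite Cmod_opp. apply Rplus_le_compat; auto. }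
  assert (e * Cmod d <= e * ((Cmod (G z) + 1) * s)) by (apply Rmult_le_compat_l; lra).
  assert (k * s <= k / 2 * s); [|nra].
  apply Rle_trans with (e * (Cmod l + Cmod (G z) + 2) * s); [lra|]. apply Rmult_le_compat_r; lra.
Qed.

(** Away from tau, l = 0 would force X (h z) = 0; at tau the normalisation of h decides. *)
Lemma h_deriv_neq_0 (z l : C) : udisc z -> cderiv h z l -> l <> 0%C.
Proof.
  intros Hz Hl. destruct (classic (z = tau)) as [->|N].
  - apply (model_tau M); auto.
  - intros E. apply (model_neq M z Hz N). rewrite <- (h_deriv_G z l Hz Hl), E. ring.
Qed.

Lemma G_neq_0 (z : C) : udisc z -> z <> tau -> G z <> 0%C.
Proof.
  intros Hz N E. destruct (model_holo M z Hz) as [l Hl].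
  apply (model_neq M z Hz N). rewrite <- (h_deriv_G z l Hz Hl), E. ring.
Qed.

Lemma G_finv (w : C) : (exists z, udisc z /\ h z = w) ->
  exists l : C, l <> 0%C /\ cderiv (finv h) w (/ l)%C /\ (/ l * X w = G (finv h w))%C.
Proof.
  intros Hw. destruct (finv_spec h w Hw) as [U E].
  destruct (model_holo M _ U) as [l Hl].
  assert (N := h_deriv_neq_0 _ _ U Hl).
  exists l. split; [auto|split].
  - apply (cderiv_finv h (model_holo M) (model_inj M)); auto.
  - rewrite <- E at 1. rewrite <- (h_deriv_G _ l U Hl). field. auto.
Qed.

Variables (x w0 : C).
Hypothesis x1 : Cmod x = 1.
Hypothesis radial_limit : forall eps, 0 < eps -> near_one (fun s => Cmod (h (RtoC s * x)%C - w0) < eps).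

Lemma udisc_radius (s : R) : 0 <= s < 1 -> udisc (RtoC s * x)%C.
Proof. intros Hs. unfold udisc. rewrite Cmod_mult, x1, Cmod_R, Rabs_right by lra. lra. Qed.

Lemma backward_not_in_range (t : R) : 0 <= t -> ~ exists z, udisc z /\ h z = sh (- t) w0.
Proof.
  intros Ht [z [Uz E]].
  apply (radial_limit_not_in_range h (model_holo M) (model_inj M) x w0 x1 radial_limit).
  exists (phi t z). split; auto. rewrite (model_conj M), E, <- (model_add M) by auto.
  replace (t + - t) with 0 by ring. apply (model_0 M).
Qed.

Variable t1 : R.
Hypothesis t1_pos : 0 < t1.
Hypothesis forward : forall t, 0 < t < t1 -> exists z, udisc z /\ h z = sh t w0.

Definition orb (t : R) : C := finv h (sh t w0).

Lemma orb_disc (t : R) : 0 < t < t1 -> udisc (orb t).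
Proof. intros Ht. apply (finv_spec h). auto. Qed.

Lemma orb_deriv (t : R) : 0 < t < t1 -> curve_deriv orb t (G (orb t)).
Proof.
  intros Ht. destruct (G_finv (sh t w0) (forward t Ht)) as [l [N [D E]]].
  eapply curve_deriv_eq; [|exact E].
  apply (curve_deriv_comp (finv h) (fun t => sh t w0)); auto. apply (model_flow M).
Qed.

(** The transfer device: whatever is proved for the orbits of s x inside the disc passes to [orb] as
    s -> 1. *)
Lemma orb_limit (t eps : R) : 0 < t < t1 -> 0 < eps ->
  near_one (fun s => Cmod (phi t (RtoC s * x)%C - orb t) < eps).
Proof.
  intros Ht He.
  destruct (finv_cont h (model_holo M) (model_inj M) (sh t w0) (forward t Ht) eps He) as [d [Hd H]].
  destruct (model_cont M t w0 d Hd) as [d' [Hd' H']].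
  assert (A := near_one_and _ _ (radial_limit d' Hd') (near_one_gt 0 Rlt_0_1)).
  destruct A as [s0 [Hs0 HA]]. exists s0. split; auto. intros s Hs. destruct (HA s Hs) as [B P].
  assert (U : udisc (RtoC s * x)%C) by (apply udisc_radius; lra).
  specialize (H _ (H' _ B)). rewrite <- (model_conj M) in H by (auto; lra).
  rewrite finv_h in H; auto. apply (model_inj M). apply phi_disc; auto; lra.
Qed.

Lemma horo_cont (z : C) (eps : R) : udisc z -> 0 < eps ->
  exists d, 0 < d /\ forall w, udisc w -> Cmod (w - z) < d -> Rabs (horo tau w - horo tau z) < eps.
Proof.
  intros Hz He.
  assert (C1 : forall e, 0 < e -> exists d, 0 < d /\ forall w, Cmod (w - z) < d -> Rabs (horo tau w - horo tau z) < e).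
  { intros e Hee.
    assert (P := proj1 (udisc_sqmod _) Hz). unfold sqmod in P.
    assert (Cf : continuity_2d_pt (fun a b => horo tau (a, b)) (fst z) (snd z)).
    { unfold horo, sqmod; simpl.
      apply (continuity_2d_pt_mult _ (fun a b => / (1 - (a * a + b * b)))).
      - repeat (first [apply continuity_2d_pt_plus | apply continuity_2d_pt_mult | apply continuity_2d_pt_opp
          | apply continuity_2d_pt_const | apply continuity_2d_pt_id1 | apply continuity_2d_pt_id2]).
      - apply continuity_2d_pt_inv; [|lra].
        unfold Rminus.
        repeat (first [apply continuity_2d_pt_plus | apply continuity_2d_pt_mult | apply continuity_2d_pt_opp
          | apply continuity_2d_pt_const | apply continuity_2d_pt_id1 | apply continuity_2d_pt_id2]). }
    destruct (Cf (mkposreal e Hee)) as [d Hd]. exists d. split; [apply cond_pos|].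
    intros w Hw. rewrite (surjective_pairing w), (surjective_pairing z) at 1.
    rewrite (surjective_pairing z). apply Hd.
    - eapply Rle_lt_trans; [|exact Hw]. apply (Rabs_fst_le (w - z)).
    - eapply Rle_lt_trans; [|exact Hw]. apply (Rabs_snd_le (w - z)). }
  destruct (C1 eps He) as [d [Hd H]]. exists d; split; auto.
Qed.

Lemma horo_orb_limit (t eps : R) : 0 < t < t1 -> 0 < eps ->
  near_one (fun s => Rabs (horo tau (phi t (RtoC s * x)%C) - horo tau (orb t)) < eps).
Proof.
  intros Ht He. destruct (horo_cont (orb t) eps (orb_disc t Ht) He) as [d [Hd H]].
  assert (A := near_one_and _ _ (orb_limit t d Ht Hd) (near_one_gt 0 Rlt_0_1)).
  destruct A as [s0 [Hs0 HA]]. exists s0. split; auto. intros s Hs. destruct (HA s Hs) as [B P].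
  apply H; auto. apply phi_disc; [lra|]. apply udisc_radius. lra.
Qed.

(* Horocycle monotonicity: on the radius to [tau] the horocycle function tends to [0]. *)
Lemma x_neq_tau : x <> tau.
Proof.
  intros E.
  assert (Ht : 0 < t1 / 2 < t1) by lra.
  assert (U := orb_disc _ Ht).
  assert (P : 0 < horo tau (orb (t1 / 2))).
  { unfold horo. apply Rdiv_lt_0_compat; [apply conj_factor_pos; auto|]. apply udisc_sqmod in U. lra. }
  set (k := horo tau (orb (t1 / 2))) in *.
  assert (H1 := horo_orb_limit (t1 / 2) (k / 2) Ht ltac:(lra)).
  assert (K := Rmax_l 0 (1 - k / 2)).
  destruct (near_one_ex _ (near_one_and _ _ H1 (near_one_gt (1 - k / 2) ltac:(lra)))) as [s [Hs [A B]]].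
  fold k in A. apply Rabs_def2 in A.
  assert (Us : udisc (RtoC s * x)%C) by (apply udisc_radius; lra).
  assert (Mo := horo_mono phi tau phi_holo phi_disc phi_add phi_0 tau_le dw (t1 / 2) _ ltac:(lra) Us).
  assert (V : horo tau (RtoC s * x)%C = (1 - s) / (1 + s)).
  { unfold horo. subst tau.
    assert (S := Cmod_sqr x). rewrite x1 in S.
    replace (1 - Cconj x * (RtoC s * x))%C with (RtoC (1 - s)).
    2:{ rewrite RtoC_minus. replace (Cconj x * (RtoC s * x))%C with (RtoC s * (x * Cconj x))%C by ring.
        rewrite <- Cmod2_conj, x1. simpl. rewrite !Rmult_1_r. ring. }
    rewrite (sqmod_Cmod (RtoC s * x)%C), Cmod_mult, x1, Cmod_R, Rabs_right by lra.
    unfold sqmod; simpl. field. split; nra. }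
  rewrite V in Mo.
  assert ((1 - s) / (1 + s) <= 1 - s).
  { apply Rmult_le_reg_r with (1 + s); [lra|]. unfold Rdiv. rewrite Rmult_assoc, Rinv_l by lra. nra. }
  lra.
Qed.

Lemma phi_cont (z : C) (t eps : R) : udisc z -> 0 <= t -> 0 < eps -> exists d, 0 < d /\
  forall s, 0 <= s -> Rabs (s - t) < d -> Cmod (phi s z - phi t z) < eps.
Proof.
  intros Hz Ht He. destruct Ht as [Ht|<-].
  - destruct (proj1 (curve_deriv_eps _ _ _) (gen_t z t Hz Ht) 1 Rlt_0_1) as [d [Hd H]].
    set (v := G (phi t z)) in *. assert (Pv := Cmod_ge_0 v).
    exists (Rmin d (eps / (Cmod v + 2))). split.
    { apply Rmin_glb_lt; auto. apply Rdiv_lt_0_compat; lra. }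
    intros s _ Hs. assert (L1 := Rmin_l d (eps / (Cmod v + 2))). assert (L2 := Rmin_r d (eps / (Cmod v + 2))).
    specialize (H s ltac:(lra)). cbv beta in H.
    assert (T := Cmod_triangle (phi s z - phi t z - v * RtoC (s - t)) (v * RtoC (s - t))).
    replace (phi s z - phi t z - v * RtoC (s - t) + v * RtoC (s - t))%C with (phi s z - phi t z)%C in T by ring.
    rewrite Cmod_mult, Cmod_R in T. assert (P := Rabs_pos (s - t)).
    apply Rle_lt_trans with ((Cmod v + 2) * Rabs (s - t)); [lra|].
    replace eps with ((Cmod v + 2) * (eps / (Cmod v + 2))) by (field; lra). apply Rmult_lt_compat_l; lra.
  - destruct (gen_0 z 1 Hz Rlt_0_1) as [d [Hd H]].
    set (v := G z) in *. assert (Pv := Cmod_ge_0 v).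
    exists (Rmin d (eps / (Cmod v + 2))). split.
    { apply Rmin_glb_lt; auto. apply Rdiv_lt_0_compat; lra. }
    intros s Hs0 Hs. assert (L1 := Rmin_l d (eps / (Cmod v + 2))). assert (L2 := Rmin_r d (eps / (Cmod v + 2))).
    rewrite phi_0 by auto. rewrite Rminus_0_r, Rabs_right in Hs by lra.
    destruct Hs0 as [Hs0|<-].
    2:{ rewrite phi_0 by auto. replace (z - z)%C with (RtoC 0) by ring. rewrite Cmod_0; auto. }
    specialize (H s ltac:(lra)).
    assert (T := Cmod_triangle (phi s z - z - RtoC s * v) (RtoC s * v)).
    replace (phi s z - z - RtoC s * v + RtoC s * v)%C with (phi s z - z)%C in T by ring.
    rewrite Cmod_mult, Cmod_R, Rabs_right in T by lra.
    apply Rle_lt_trans with ((Cmod v + 2) * s); [lra|].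
    replace eps with ((Cmod v + 2) * (eps / (Cmod v + 2))) by (field; lra). apply Rmult_lt_compat_l; lra.
Qed.

(** * The annulus next to the circle and the primitive of 1 / p *)

Variable Rr : R.
Hypothesis Rr_bounds : 0 < Rr <= 1/2.
Hypothesis annulus_tau : forall z, 1 - 2 * Rr < Cmod z < 1 -> z <> tau.

(** It avoids tau and contains every disc of radius [Rr] internally tangent to the unit circle;
    Harnack is applied in these discs. *)
Definition annulus (z : C) : Prop := 1 - 2 * Rr < Cmod z < 1.

(** For |z| <= 1 - 2 Rr the numerator of [horo] is at most 4 and its denominator at least 1 - (1 - 2
    Rr)^2. *)
Lemma horo_annulus (z : C) : udisc z -> 4 / (1 - (1 - 2 * Rr) * (1 - 2 * Rr)) < horo tau z -> annulus z.
Proof.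
  intros Hz Hh. split; auto. apply Rnot_le_lt. intros L.
  assert (Pz := Cmod_ge_0 z). assert (Pt := Cmod_ge_0 tau).
  assert (Q : sqmod z <= (1 - 2 * Rr) * (1 - 2 * Rr)) by (rewrite sqmod_Cmod; apply Rmult_le_compat; auto).
  assert (Q2 : sqmod (1 - Cconj tau * z)%C <= 4).
  { rewrite sqmod_Cmod. assert (T := Cmod_minus_le 1 (Cconj tau * z)). rewrite Cmod_1, Cmod_mult, Cmod_conj in T.
    unfold udisc in Hz. assert (Cmod tau * Cmod z <= 1 * 1) by (apply Rmult_le_compat; lra).
    assert (P := Cmod_ge_0 (1 - Cconj tau * z)). nra. }
  assert (D : 0 < 1 - (1 - 2 * Rr) * (1 - 2 * Rr)) by nra.
  assert (horo tau z <= 4 / (1 - (1 - 2 * Rr) * (1 - 2 * Rr))); [|lra].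
  unfold horo. apply Rmult_le_compat; try lra.
  - apply sqmod_pos.
  - left. apply Rinv_0_lt_compat. lra.
  - apply Rinv_le_contravar; lra.
Qed.

(** Since x differs from tau, |1 - conj tau s x| stays above half of |x - tau| while 1 - s^2 tends
    to 0. *)
Lemma horo_radius_large (B : R) : near_one (fun s => B < horo tau (RtoC s * x)%C).
Proof.
  assert (N := x_neq_tau).
  set (de := Cmod (x - tau)).
  assert (Pd : 0 < de). { apply Cmod_gt_0. intros E. apply N. rewrite <- (Cplus_0_r tau), <- E. ring. }
  assert (Ed : Cmod (1 - Cconj tau * x) = de).
  { replace (1 - Cconj tau * x)%C with (x * Cconj (x - tau))%C.
    - rewrite Cmod_mult, Cmod_conj, x1. unfold de; ring.
    - rewrite Cminus_conj. replace (x * (Cconj x - Cconj tau))%C with (x * Cconj x - Cconj tau * x)%C by ring.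
      rewrite <- Cmod2_conj, x1. f_equal. simpl. Cext; ring. }
  set (B' := Rabs B + 1). assert (PB : 0 < B') by (unfold B'; assert (X0 := Rabs_pos B); lra).
  assert (BB : B < B') by (unfold B'; assert (X0 := Rle_abs B); lra).
  assert (Pk : 0 < de * de / (8 * B')) by (apply Rdiv_lt_0_compat; nra).
  exists (Rmax 0 (Rmax (1 - de / 2) (1 - de * de / (8 * B')))). split.
  { repeat apply Rmax_lub_lt; lra. }
  intros s Hs.
  assert (L1 := Rmax_l 0 (Rmax (1 - de / 2) (1 - de * de / (8 * B')))).
  assert (L2 := Rmax_r 0 (Rmax (1 - de / 2) (1 - de * de / (8 * B')))).
  assert (L3 := Rmax_l (1 - de / 2) (1 - de * de / (8 * B'))). assert (L4 := Rmax_r (1 - de / 2) (1 - de * de / (8 * B'))).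
  assert (T : de / 2 <= Cmod (1 - Cconj tau * (RtoC s * x))).
  { assert (T := Cmod_triangle_inv (1 - Cconj tau * x) (- (RtoC (1 - s) * (Cconj tau * x)))).
    replace (1 - Cconj tau * x - - (RtoC (1 - s) * (Cconj tau * x)))%C with (1 - Cconj tau * (RtoC s * x))%C in T
      by (rewrite RtoC_minus; ring).
    rewrite Ed, Cmod_opp, !Cmod_mult, Cmod_conj, x1, Cmod_R, Rabs_right in T by lra.
    assert (Pt := Cmod_ge_0 tau). nra. }
  unfold horo. rewrite (sqmod_Cmod (RtoC s * x)%C), Cmod_mult, x1, Cmod_R, Rabs_right by lra.
  rewrite sqmod_Cmod. rewrite !Rmult_1_r.
  assert (D : 0 < 1 - s * s) by nra.
  apply Rlt_trans with B'; auto.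
  apply Rmult_lt_reg_r with (1 - s * s); auto. unfold Rdiv. rewrite Rmult_assoc, Rinv_l, Rmult_1_r by lra.
  assert (de / 2 * (de / 2) <= Cmod (1 - Cconj tau * (RtoC s * x)) * Cmod (1 - Cconj tau * (RtoC s * x))) by (apply Rmult_le_compat; lra).
  assert ((1 - s) * (8 * B') < de * de).
  { apply Rlt_le_trans with (de * de / (8 * B') * (8 * B')); [apply Rmult_lt_compat_r; lra|right; field; lra]. }
  assert (B' * (1 - s * s) <= B' * (2 * (1 - s))) by (apply Rmult_le_compat_l; nra). lra.
Qed.

(* If [Re p] vanished near the circle, horocycle values would be constant along orbits near the
   circle, whereas [phi_t (s x)] leaves every horocycle neighbourhood of the circle as [s -> 1]. *)
Lemma pgen_nondegenerate : exists z, annulus z /\ 0 < Re (pgen G tau z).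
Proof.
  apply NNPP. intros N.
  assert (Z : forall z, annulus z -> Re (hfac tau z * G z) = 0).
  { intros z Hz. assert (U : udisc z) by (unfold udisc; apply Hz). assert (Nt := annulus_tau z Hz).
    rewrite (hfac_G G tau tau_le z U Nt).
    assert (P := pgen_pos phi G tau phi_holo phi_disc phi_add phi_0 gen_0 tau_le dw z U Nt).
    destruct P as [P|P]; [exfalso; apply N; eauto|]. rewrite <- P. ring. }
  set (t0 := t1 / 2). assert (Ht0 : 0 < t0 < t1) by (unfold t0; lra).
  set (K := 4 / (1 - (1 - 2 * Rr) * (1 - 2 * Rr))).
  set (U0 := horo tau (orb t0)). set (m := Rmax K (U0 + 1)).
  assert (m1 : K <= m) by apply Rmax_l. assert (m2 : U0 + 1 <= m) by apply Rmax_r.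
  destruct (near_one_ex _ (near_one_and _ _ (horo_radius_large (m + 1)) (horo_orb_limit t0 1 Ht0 Rlt_0_1))) as [s [Hs [A B]]].
  apply Rabs_def2 in B. fold U0 in B.
  set (z := (RtoC s * x)%C) in *. assert (Uz : udisc z) by (apply udisc_radius; lra).
  (* [horo] starts above m + 1 and is below U0 + 1 <= m at time t0. The sign is reversed because
     [first_hit] detects upward crossings. *)
  destruct (first_hit (fun t => - horo tau (phi t z)) (- (m + 1)) t0) as [c [Hc [Ec Hb]]]; [lra| | |].
  - intros t eps Ht He.
    destruct (horo_cont (phi t z) eps (phi_disc t z ltac:(lra) Uz) He) as [d [Hd H]].
    destruct (phi_cont z t d Uz ltac:(lra) Hd) as [d' [Hd' H']].
    exists d'; split; auto. intros u Hu Hut.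
    replace (- horo tau (phi u z) - - horo tau (phi t z)) with (- (horo tau (phi u z) - horo tau (phi t z))) by ring.
    rewrite Rabs_Ropp. apply H; [apply phi_disc; auto; lra|apply H'; auto; lra].
  - rewrite phi_0 by auto. lra.
  (* Up to time c the orbit stays in the annulus, where the derivative of [horo] vanishes by
     assumption, yet [horo] drops between c / 2 and c. The start is c / 2 because [gen_t] concerns
     positive times. *)
  - assert (Bc := Hb (c / 2) ltac:(lra)).
    assert (Ann : forall t, c / 2 <= t <= c -> annulus (phi t z)).
    { intros t Ht. apply horo_annulus; [apply phi_disc; auto; lra|]. fold K.
      destruct (Rle_lt_or_eq_dec t c (proj2 Ht)) as [L|Eq]; [|rewrite Eq; lra].
      specialize (Hb t ltac:(lra)). lra. }
    assert (Mo := derive_nonneg_le (fun t => horo tau (phi t z)) (fun _ => 0) (c / 2) c ltac:(lra)).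
    assert (horo tau (phi (c / 2) z) <= horo tau (phi c z)); [|lra].
    apply Mo; [|intros; lra].
    intros t Ht.
    assert (D := is_derive_horo tau (fun t => phi t z) t (G (phi t z)) (phi_disc t z ltac:(lra) Uz) (gen_t z t Uz ltac:(lra))).
    cbv beta in D. rewrite (Z _ (Ann t Ht)) in D.
    replace (-2 * 0 / _) with 0 in D; [exact D|].
    unfold Rdiv. ring.
Qed.

(** This is 1 / p. If W' = [Vfun], then W along an orbit has derivative [cfac], which no longer
    involves G. *)
Definition Vfun (z : C) : C := (cfac tau z / G z)%C.

Lemma annulus_udisc (z : C) : annulus z -> udisc z.
Proof. intros [_ H]; exact H. Qed.

Lemma Vfun_holo : holo annulus Vfun.
Proof.
  intros z Hz. assert (U := annulus_udisc z Hz). destruct (G_holo z U) as [l Hl].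
  eexists. apply (cderiv_div (cfac tau) G).
  - unfold cfac. apply (cderiv_mult (fun z => tau - z)%C (fun z => 1 - Cconj tau * z)%C).
    + apply cderiv_minus; [apply cderiv_const|apply cderiv_id].
    + apply cderiv_minus; [apply cderiv_const|apply cderiv_scal, cderiv_id].
  - exact Hl.
  - apply G_neq_0; auto.
Qed.

Lemma Re_inv (z : C) : z <> 0%C -> Re (/ z) = Re z / sqmod z.
Proof. intros Hz. unfold Re, Cinv, sqmod; simpl. f_equal. ring. Qed.

Lemma sqmod_gt_0 (z : C) : z <> 0%C -> 0 < sqmod z.
Proof. intros Hz. apply Cmod_gt_0 in Hz. rewrite sqmod_Cmod. nra. Qed.

Lemma Vfun_Re (z : C) : annulus z -> pgen G tau z <> 0%C /\ Re (Vfun z) = Re (pgen G tau z) / sqmod (pgen G tau z).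
Proof.
  intros Hz. assert (U := annulus_udisc z Hz). assert (Nt := annulus_tau z Hz).
  assert (N1 := G_neq_0 z U Nt). assert (N2 := cfac_neq_0 tau tau_le z U Nt).
  assert (N : pgen G tau z <> 0%C).
  { unfold pgen. intros E. apply N1. replace (G z) with (G z / cfac tau z * cfac tau z)%C by (field; auto). rewrite E. ring. }
  split; auto. rewrite <- Re_inv by auto. f_equal. unfold Vfun, pgen. field. auto.
Qed.

Lemma Vfun_pos (z : C) : annulus z -> 0 <= Re (Vfun z).
Proof.
  intros Hz. destruct (Vfun_Re z Hz) as [N E0]; rewrite E0; clear E0.
  apply Rdiv_le_0_compat; [|apply sqmod_gt_0; auto].
  apply (pgen_pos phi G tau phi_holo phi_disc phi_add phi_0 gen_0 tau_le dw z (annulus_udisc z Hz) (annulus_tau z Hz)).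
Qed.

Lemma disc_in_annulus (e z : C) : Cmod e = 1 -> Cmod (z - RtoC (1 - Rr) * e) < Rr -> annulus z.
Proof.
  intros He Hz. assert (M1 : Cmod (RtoC (1 - Rr) * e) = 1 - Rr).
  { rewrite Cmod_mult, He, Cmod_R, Rabs_right by lra. ring. }
  assert (T1 := Cmod_triangle_inv z (RtoC (1 - Rr) * e)). assert (T2 := Cmod_triangle_inv (RtoC (1 - Rr) * e) z).
  rewrite (Cmod_minus_sym (RtoC (1 - Rr) * e)) in T2. unfold annulus. lra.
Qed.

Lemma radial_dist (z : C) : z <> 0%C -> Cmod (z - RtoC (1 - Rr) * (z / RtoC (Cmod z))) = Rabs (Cmod z - (1 - Rr)) /\
  Cmod (z / RtoC (Cmod z)) = 1.
Proof.
  intros Hz. assert (P : 0 < Cmod z) by (apply Cmod_gt_0; auto).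
  assert (Nc : RtoC (Cmod z) <> 0%C) by (intros E; injection E; lra).
  assert (M1 : Cmod (z / RtoC (Cmod z)) = 1).
  { rewrite Cmod_div, Cmod_R, Rabs_right by (auto; lra). field. lra. }
  split; auto.
  replace (z - RtoC (1 - Rr) * (z / RtoC (Cmod z)))%C with (RtoC (Cmod z - (1 - Rr)) * (z / RtoC (Cmod z)))%C.
  - rewrite Cmod_mult, M1, Cmod_R. ring.
  - rewrite !RtoC_minus. field. auto.
Qed.

(** Positivity spreads from one point in three moves: Harnack to the centre of its tangent disc, a
    Gronwall argument along the circle of centres |z| = 1 - Rr, and Harnack from each centre out
    towards the unit circle. *)
Lemma Vfun_lower_bound : exists ka, 0 < ka /\
  forall z, 1 - Rr <= Cmod z < 1 -> ka * (1 - Cmod z * Cmod z) <= Re (Vfun z).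
Proof.
  destruct pgen_nondegenerate as [zs [Hs Ps]].
  assert (Pv : 0 < Re (Vfun zs)).
  { destruct (Vfun_Re zs Hs) as [N E0]; rewrite E0; clear E0. apply Rdiv_lt_0_compat; auto. apply sqmod_gt_0; auto. }
  assert (HV : forall e, Cmod e = 1 -> holo (cdisc (RtoC (1 - Rr) * e)%C Rr) Vfun).
  { intros e He z Hz. apply Vfun_holo. eapply disc_in_annulus; eauto. }
  assert (HP : forall e, Cmod e = 1 -> forall z, cdisc (RtoC (1 - Rr) * e)%C Rr z -> 0 <= Re (Vfun z)).
  { intros e He z Hz. apply Vfun_pos. eapply disc_in_annulus; eauto. }
  assert (Nzs : zs <> 0%C). { intros E. unfold annulus in Hs. rewrite E, Cmod_0 in Hs. lra. }
  destruct (radial_dist zs Nzs) as [D1 D2]. set (es := (zs / RtoC (Cmod zs))%C) in *.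
  assert (Ds : Cmod (zs - RtoC (1 - Rr) * es) < Rr).
  { rewrite D1. unfold annulus in Hs. apply Rabs_def1; lra. }
  destruct (harnack_disc Vfun (RtoC (1 - Rr) * es)%C zs Rr ltac:(lra) (HV es D2) (HP es D2) Ds) as [Ha _].
  assert (Pc : 0 < Re (Vfun (RtoC (1 - Rr) * es)%C)).
  { assert (Q := Cmod_ge_0 (zs - RtoC (1 - Rr) * es)).
    assert (0 < Re (Vfun zs) * (Rr - Cmod (zs - RtoC (1 - Rr) * es))) by (apply Rmult_lt_0_compat; lra). nra. }
  destruct (unit_polar es 0 D2) as [ts [_ Es]].
  set (f := fun t => Re (Vfun (RtoC (1 - Rr) * (cos t, sin t))%C)).
  assert (Un : forall t, Cmod (cos t, sin t) = 1).
  { intros t. unfold Cmod; simpl. replace (cos t * (cos t * 1) + sin t * (sin t * 1)) with 1; [apply sqrt_1|].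
    assert (S := sin2_cos2 t). unfold Rsqr in S. lra. }
  destruct (holo_deriv _ _ Vfun_holo) as [dV HdV].
  assert (Ctr : forall t, annulus (RtoC (1 - Rr) * (cos t, sin t))%C).
  { intros t. apply (disc_in_annulus (cos t, sin t)); auto.
    replace (RtoC (1 - Rr) * (cos t, sin t) - RtoC (1 - Rr) * (cos t, sin t))%C with (RtoC 0) by ring.
    rewrite Cmod_0; lra. }
  set (df := fun t => Re (dV (RtoC (1 - Rr) * (cos t, sin t)) * (RtoC (1 - Rr) * (- sin t, cos t)%R))%C).
  assert (Df : forall t, is_derive f t (df t)).
  { intros t. apply (curve_deriv_comp Vfun (fun t => RtoC (1 - Rr) * (cos t, sin t))%C t).
    - split; simpl; auto_derive; auto; ring.
    - apply HdV, Ctr. }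
  assert (Bf : forall t, Rabs (df t) <= 2 / Rr * f t).
  { intros t. unfold df. eapply Rle_trans; [apply re_le_Cmod|]. rewrite !Cmod_mult, Cmod_R, Rabs_right by lra.
    assert (E1 : Cmod (- sin t, cos t) = 1).
    { unfold Cmod; simpl. replace (- sin t * (- sin t * 1) + cos t * (cos t * 1)) with 1; [apply sqrt_1|].
      assert (S := sin2_cos2 t). unfold Rsqr in S. lra. }
    rewrite E1.
    assert (Y := deriv_le_Re Vfun dV (RtoC (1 - Rr) * (cos t, sin t))%C Rr ltac:(lra)).
    specialize (Y (fun z Hz => HdV z (disc_in_annulus _ z (Un t) Hz)) (fun z Hz => HP _ (Un t) z Hz)).
    set (q := Cmod (dV (RtoC (1 - Rr) * (cos t, sin t))%C)) in *.
    assert (Q := Cmod_ge_0 (dV (RtoC (1 - Rr) * (cos t, sin t))%C)). fold q in Q.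
    change (Rr * q <= 2 * f t) in Y.
    apply Rmult_le_reg_l with Rr; [lra|].
    replace (Rr * (2 / Rr * f t)) with (2 * f t) by (field; lra). nra. }
  (* Because |f'| <= (2 / Rr) f, the product f e^(2 t / Rr) increases; one turn costs at most the
     stated exponential. *)
  assert (Gr : forall t, ts <= t <= ts + 2 * PI -> f ts * exp (- (2 / Rr) * (2 * PI)) <= f t).
  { intros t Ht.
    assert (Mo : f ts * exp (2 / Rr * ts) <= f t * exp (2 / Rr * t)).
    { apply (derive_nonneg_le (fun u => f u * exp (2 / Rr * u)) (fun u => (df u + 2 / Rr * f u) * exp (2 / Rr * u)) ts t ltac:(lra)).
      - intros u _. auto_derive; [repeat split; exists (df u); exact (Df u)|].
        replace (Derive (fun x => f x) u) with (df u) by (symmetry; exact (is_derive_unique f u (df u) (Df u))). ring.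
      - intros u _. specialize (Bf u). apply Rabs_le_between in Bf.
        apply Rmult_le_pos; [lra|left; apply exp_pos]. }
    assert (P0 : 0 < 2 / Rr) by (apply Rdiv_lt_0_compat; lra).
    assert (Pf : 0 <= f ts). { unfold f. apply Vfun_pos, Ctr. }
    apply Rmult_le_reg_r with (exp (2 / Rr * t)); [apply exp_pos|].
    eapply Rle_trans; [|exact Mo]. rewrite Rmult_assoc, <- exp_plus.
    apply Rmult_le_compat_l; auto.
    destruct (Rle_lt_or_eq_dec (- (2 / Rr) * (2 * PI) + 2 / Rr * t) (2 / Rr * ts)) as [L|E]; [nra| |].
    - left; apply exp_increasing; auto.
    - rewrite E; lra. }
  assert (Fs : 0 < f ts) by (unfold f; rewrite <- Es; auto).
  set (mn := f ts * exp (- (2 / Rr) * (2 * PI))) in *.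
  assert (Pm : 0 < mn) by (apply Rmult_lt_0_compat; [auto|apply exp_pos]).
  (* Harnack gives mn (1 - r) <= 2 Rr Re V, and 1 - r^2 <= 2 (1 - r) accounts for the other factor
     2. *)
  exists (mn / (4 * Rr)). split; [apply Rdiv_lt_0_compat; lra|].
  intros z Hz. assert (Nz : z <> 0%C). { intros E. rewrite E, Cmod_0 in Hz. lra. }
  destruct (radial_dist z Nz) as [E1 E2].
  destruct (unit_polar _ ts E2) as [t [Ht Et]]. rewrite Et in E1.
  rewrite Rabs_right in E1 by lra.
  destruct (harnack_disc Vfun (RtoC (1 - Rr) * (cos t, sin t))%C z Rr ltac:(lra) (HV _ (Un t)) (HP _ (Un t))) as [_ Hb].
  { unfold cdisc. rewrite E1. lra. }
  rewrite E1 in Hb. change (Re (Vfun (RtoC (1 - Rr) * (cos t, sin t))%C)) with (f t) in Hb.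
  specialize (Gr t ltac:(lra)).
  assert (PV : 0 <= Re (Vfun z)).
  { apply (HP _ (Un t)). unfold cdisc. rewrite E1. lra. }
  set (r := Cmod z) in *.
  assert (H1 : mn * (1 - r) <= Re (Vfun z) * (2 * Rr)).
  { apply Rle_trans with (f t * (Rr - (r - (1 - Rr)))); [nra|]. eapply Rle_trans; [exact Hb|].
    apply Rmult_le_compat_l; lra. }
  apply Rmult_le_reg_r with (4 * Rr); [lra|].
  replace (mn / (4 * Rr) * (1 - r * r) * (4 * Rr)) with (mn * (1 - r) * (1 + r)) by (field; lra).
  apply Rle_trans with (Re (Vfun z) * (2 * Rr) * (1 + r)); [apply Rmult_le_compat_r; lra|].
  assert (0 <= Re (Vfun z) * Rr) by (apply Rmult_le_pos; lra). nra.
Qed.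

Lemma near_x_annulus (z : C) : udisc z -> Cmod (z - x) < Rr -> 1 - Rr < Cmod z < 1.
Proof.
  intros Hz Hx. split; auto. assert (T := Cmod_triangle_inv x z). rewrite x1, Cmod_minus_sym in T. lra.
Qed.

(** The annulus is not simply connected; its part within [Rr] of x is an intersection of two discs,
    hence convex. *)
Lemma near_x_primitive : exists W, forall z, udisc z -> Cmod (z - x) < Rr -> cderiv W z (Vfun z).
Proof.
  destruct (holo_deriv _ _ Vfun_holo) as [dV HdV].
  destruct (primitive_exists (fun z => Rmax (Cmod (z - 0) - 1) (Cmod (z - x) - Rr)) Vfun dV
    (max_quasiconvex _ _ (disc_quasiconvex 0%C 1) (disc_quasiconvex x Rr))) with (z0 := (RtoC (1 - Rr / 2) * x)%C)
    as [W HW].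
  - intros z Hz. assert (L1 := Rmax_l (Cmod (z - 0) - 1) (Cmod (z - x) - Rr)).
    assert (L2 := Rmax_r (Cmod (z - 0) - 1) (Cmod (z - x) - Rr)).
    replace (z - 0)%C with z in * by ring.
    apply HdV. assert (Y := near_x_annulus z ltac:(unfold udisc; lra) ltac:(lra)). unfold annulus. lra.
  - apply Rmax_lub_lt.
    + replace (RtoC (1 - Rr / 2) * x - 0)%C with (RtoC (1 - Rr / 2) * x)%C by ring.
      rewrite Cmod_mult, x1, Cmod_R, Rabs_right by lra. lra.
    + replace (RtoC (1 - Rr / 2) * x - x)%C with (- (RtoC (Rr / 2) * x))%C by (rewrite RtoC_minus; ring).
      rewrite Cmod_opp, Cmod_mult, x1, Cmod_R, Rabs_right by lra. lra.
  - exists W. intros z Hz Hx. apply HW. replace (z - 0)%C with z by ring. unfold udisc in Hz.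
    apply Rmax_lub_lt; lra.
Qed.

Variables (W : C -> C) (ka : R).
Hypothesis W_prim : forall z, udisc z -> Cmod (z - x) < Rr -> cderiv W z (Vfun z).
Hypothesis ka_pos : 0 < ka.
Hypothesis V_low : forall z, 1 - Rr <= Cmod z < 1 -> ka * (1 - Cmod z * Cmod z) <= Re (Vfun z).

(* [W (z2) - W (z1)] is [z2 - z1] times the average of [V] over the chord, and the depth
   [1 - |z|^2] is a strictly concave function on the chord. *)
Lemma chord_estimate (z1 z2 : C) : udisc z1 -> udisc z2 -> Cmod (z1 - x) < Rr -> Cmod (z2 - x) < Rr ->
  ka * (Cmod (z2 - z1) * ((1 - sqmod z2) / 2 + sqmod (z2 - z1)%C / 6)) <= Cmod (W z2 - W z1).
Proof.
  intros U1 U2 N1 N2. set (e := (z2 - z1)%C). set (g := fun s => (z1 + RtoC s * e)%C).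
  set (D2 := 1 - sqmod z2). set (q := sqmod e).
  assert (Gin : forall s, 0 <= s <= 1 -> udisc (g s) /\ Cmod (g s - x) < Rr).
  { intros s Hs. unfold udisc in *. change (g s) with (seg_point z1 z2 s). split.
    - replace (seg_point z1 z2 s) with (seg_point z1 z2 s - 0)%C by ring.
      eapply Rle_lt_trans; [apply (seg_point_close z1 z2 0%C s (Rmax (Cmod z1) (Cmod z2)) Hs)|apply Rmax_lub_lt; auto].
      + replace (z1 - 0)%C with z1 by ring. apply Rmax_l.
      + replace (z2 - 0)%C with z2 by ring. apply Rmax_r.
    - eapply Rle_lt_trans; [apply (seg_point_close z1 z2 x s (Rmax (Cmod (z1 - x)) (Cmod (z2 - x))) Hs)|apply Rmax_lub_lt; auto].
      + apply Rmax_l.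
      + apply Rmax_r. }
  assert (D1p := proj1 (udisc_sqmod _) U1).
  assert (Depth : forall s, 0 <= s <= 1 -> s * D2 + s * (1 - s) * q <= 1 - sqmod (g s)).
  { intros s Hs.
    assert (E : 1 - sqmod (g s) = (1 - s) * (1 - sqmod z1) + s * D2 + s * (1 - s) * q).
    { unfold D2, q, g, e, sqmod; simpl. ring. }
    rewrite E. assert (0 <= (1 - s) * (1 - sqmod z1)) by (apply Rmult_le_pos; lra). lra. }
  (* The increment of W is projected on e; the subtracted polynomial is the primitive of the lower
     bound along the chord, and its value at s = 1 yields D2 / 2 + q / 6. *)
  set (A := fun s => (fst (W (g s)) * fst e + snd (W (g s)) * snd e) - ka * (q * (s * s / 2 * D2 + q * (s * s / 2 - s * s * s / 3)))).
  assert (Mo : A 0 <= A 1).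
  { apply (derive_nonneg_le A (fun s => (fst (Vfun (g s) * e)%C * fst e + snd (Vfun (g s) * e)%C * snd e)
        - ka * (q * (s * D2 + s * (1 - s) * q))) 0 1 Rle_0_1).
    - intros s Hs. destruct (Gin s Hs) as [Ug Ng]. unfold A.
      apply (is_derive_minus (K := R_AbsRing) (V := R_NormedModule)).
      + apply (is_derive_dot (fun s => W (g s))).
        apply (curve_deriv_comp W g). apply curve_deriv_line. apply W_prim; auto.
      + auto_derive; auto. field.
    - intros s Hs. destruct (Gin s Hs) as [Ug Ng].
      assert (Y := near_x_annulus _ Ug Ng). assert (Z := V_low (g s) ltac:(lra)).
      rewrite <- sqmod_Cmod in Z. specialize (Depth s Hs).
      replace (fst (Vfun (g s) * e)%C * fst e + snd (Vfun (g s) * e)%C * snd e) with (q * Re (Vfun (g s))).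
      2:{ unfold q, sqmod, Re; simpl. ring. }
      assert (Pq : 0 <= q) by apply sqmod_pos.
      assert (ka * (s * D2 + s * (1 - s) * q) <= Re (Vfun (g s))).
      { eapply Rle_trans; [|exact Z]. apply Rmult_le_compat_l; lra. }
      assert (q * (ka * (s * D2 + s * (1 - s) * q)) <= q * Re (Vfun (g s))) by (apply Rmult_le_compat_l; auto). lra. }
  unfold A in Mo.
  replace (g 1) with z2 in Mo by (unfold g, e; ring). replace (g 0) with z1 in Mo by (unfold g; ring).
  assert (B : (fst (W z2) - fst (W z1)) * fst e + (snd (W z2) - snd (W z1)) * snd e <= Cmod (W z2 - W z1) * Cmod e)
    by exact (dot_le_Cmod (W z2 - W z1) e).
  assert (Eq : q = Cmod e * Cmod e) by apply sqmod_Cmod.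
  assert (Pe := Cmod_ge_0 e).
  assert (F : ka * (q * (D2 / 2 + q / 6)) <= Cmod (W z2 - W z1) * Cmod e) by lra.
  destruct Pe as [Pe|Ze].
  - apply Rmult_le_reg_r with (Cmod e); auto. eapply Rle_trans; [|exact F]. right. rewrite Eq at 2. ring.
  - rewrite <- Ze. rewrite Rmult_0_l, Rmult_0_r. apply Cmod_ge_0.
Qed.

Lemma cfac_bound (z : C) : udisc z -> Cmod (cfac tau z) <= 4.
Proof.
  intros Hz. unfold udisc in Hz. unfold cfac. rewrite Cmod_mult.
  assert (T1 := Cmod_minus_le tau z). assert (T2 := Cmod_minus_le 1 (Cconj tau * z)).
  rewrite Cmod_1, Cmod_mult, Cmod_conj in T2. assert (P1 := Cmod_ge_0 tau). assert (P2 := Cmod_ge_0 z).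
  assert (P3 := Cmod_ge_0 (tau - z)). assert (P4 := Cmod_ge_0 (1 - Cconj tau * z)).
  assert (Cmod tau * Cmod z <= 1) by nra.
  replace 4 with (2 * 2) by ring. apply Rmult_le_compat; auto; lra.
Qed.

(** Along the orbit W has velocity V G = [cfac], of modulus at most 4. *)
Lemma flow_W (z : C) (t : R) : udisc z -> 0 < t -> (forall u, 0 <= u <= t -> Cmod (phi u z - x) < Rr) ->
  Cmod (W (phi t z) - W z) <= 4 * t.
Proof.
  intros Hz Ht Hn.
  assert (Main : forall a, 0 < a <= t -> Cmod (W (phi t z) - W (phi a z)) <= 4 * t).
  { intros a Ha.
    apply Rle_trans with (4 * (t - a)); [|lra].
    apply (curve_increment_const_le (fun u => W (phi u z)) (fun u => Vfun (phi u z) * G (phi u z))%C 4 a t ltac:(lra)).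
    - intros u Hu. assert (U : udisc (phi u z)) by (apply phi_disc; auto; lra).
      apply (curve_deriv_comp W (fun u => phi u z)).
      + apply gen_t; auto; lra.
      + apply W_prim; auto. apply Hn; lra.
    - intros u Hu. assert (U : udisc (phi u z)) by (apply phi_disc; auto; lra).
      assert (Y := near_x_annulus _ U (Hn u ltac:(lra))).
      assert (NG : G (phi u z) <> 0%C) by (apply G_neq_0; auto; apply annulus_tau; lra).
      replace (Vfun (phi u z) * G (phi u z))%C with (cfac tau (phi u z)) by (unfold Vfun; field; auto).
      apply cfac_bound; auto. }
  (* The starting time 0 is reached by continuity, since [gen_t] concerns positive times. *)
  apply Rnot_lt_le. intros L.
  assert (Hz0 : Cmod (z - x) < Rr) by (specialize (Hn 0 ltac:(lra)); rewrite phi_0 in Hn; auto).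
  destruct (cderiv_ccont _ _ _ (W_prim z Hz Hz0) (Cmod (W (phi t z) - W z) - 4 * t)) as [d [Hd H]]; [lra|].
  destruct (phi_cont z 0 d Hz (Rle_refl 0) Hd) as [d' [Hd' H']].
  set (a := Rmin t (d' / 2)). assert (a1 : a <= t) by apply Rmin_l. assert (a2 : a <= d' / 2) by apply Rmin_r.
  assert (a0 : 0 < a) by (apply Rmin_glb_lt; lra).
  specialize (H' a ltac:(lra) ltac:(rewrite Rminus_0_r, Rabs_right; lra)). rewrite phi_0 in H' by auto.
  specialize (H _ H'). specialize (Main a ltac:(lra)).
  assert (T := Cmod_minus_triangle (W (phi t z)) (W (phi a z)) (W z)). lra.
Qed.

(** To move by Rr / 4 an orbit needs a time t with ka (Rr / 4)^3 <= 24 t, by [flow_W] and the q / 6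
    term of [chord_estimate]; 48 leaves a margin of 2. *)
Definition t2 : R := Rmin t1 (ka * (Rr / 4 * (Rr / 4) * (Rr / 4)) / 48).

Lemma t2_pos : 0 < t2.
Proof.
  apply Rmin_glb_lt; auto. apply Rdiv_lt_0_compat; [|lra].
  apply Rmult_lt_0_compat; auto. repeat apply Rmult_lt_0_compat; lra.
Qed.

(** A bootstrap: up to the first time at distance Rr / 2 from x both estimates apply, and they show
    that a displacement of Rr / 4 takes longer than t2. *)
Lemma path_stays (t : R) : 0 < t < t2 ->
  near_one (fun s => forall u, 0 <= u <= t -> Cmod (phi u (RtoC s * x)%C - x) < Rr).
Proof.
  intros Ht. exists (1 - Rr / 4). split; [lra|]. intros s Hs u Hu.
  assert (L2 : t2 <= ka * (Rr / 4 * (Rr / 4) * (Rr / 4)) / 48) by apply Rmin_r.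
  set (z := (RtoC s * x)%C). assert (Uz : udisc z) by (apply udisc_radius; lra).
  assert (Nz : Cmod (z - x) < Rr / 4).
  { unfold z. replace (RtoC s * x - x)%C with (- (RtoC (1 - s) * x))%C by (rewrite RtoC_minus; ring).
    rewrite Cmod_opp, Cmod_mult, x1, Cmod_R, Rabs_right by lra. lra. }
  apply Rnot_le_lt. intros L.
  destruct (first_hit (fun v => Cmod (phi v z - x)) (Rr / 2) u) as [c [Hc [Ec Hb]]]; [lra| | |].
  - intros v eps Hv He. destruct (phi_cont z v eps Uz ltac:(lra) He) as [d [Hd H]].
    exists d; split; auto. intros w Hw Hwv. specialize (H w ltac:(lra) Hwv).
    assert (T1 := Cmod_triangle_inv (phi w z - x) (phi v z - x)).
    assert (T2 := Cmod_triangle_inv (phi v z - x) (phi w z - x)).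
    replace (phi w z - x - (phi v z - x))%C with (phi w z - phi v z)%C in T1 by ring.
    replace (phi v z - x - (phi w z - x))%C with (phi v z - phi w z)%C in T2 by ring.
    rewrite (Cmod_minus_sym (phi v z) (phi w z)) in T2. apply Rabs_def1; lra.
  - rewrite phi_0 by auto. lra.
  - assert (In : forall v, 0 <= v <= c -> Cmod (phi v z - x) < Rr).
    { intros v Hv. destruct (Rle_lt_or_eq_dec v c (proj2 Hv)) as [Lv|Ev].
      - specialize (Hb v ltac:(lra)). cbv beta in Hb. lra.
      - rewrite Ev, Ec. lra. }
    assert (F := flow_W z c Uz (proj1 Hc) In).
    assert (Uc : udisc (phi c z)) by (apply phi_disc; auto; lra).
    assert (Ch := chord_estimate z (phi c z) Uz Uc ltac:(lra) ltac:(apply In; lra)).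
    assert (Dd : Rr / 4 <= Cmod (phi c z - z)).
    { assert (T := Cmod_triangle_inv (phi c z - x) (z - x)).
      replace (phi c z - x - (z - x))%C with (phi c z - z)%C in T by ring. lra. }
    rewrite (sqmod_Cmod (phi c z - z)%C) in Ch. assert (P := proj1 (udisc_sqmod _) Uc).
    set (d := Cmod (phi c z - z)) in *.
    assert (C3 : Rr / 4 * (Rr / 4) * (Rr / 4) <= d * d * d).
    { apply Rmult_le_compat; try lra; [nra|]. apply Rmult_le_compat; lra. }
    assert (ka * (Rr / 4 * (Rr / 4) * (Rr / 4)) <= ka * (d * d * d)) by (apply Rmult_le_compat_l; lra).
    assert (0 <= ka * d * (1 - sqmod (phi c z))) by (apply Rmult_le_pos; [apply Rmult_le_pos; lra|lra]).
    assert (0 < ka * (Rr / 4 * (Rr / 4) * (Rr / 4))).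
    { apply Rmult_lt_0_compat; auto. repeat apply Rmult_lt_0_compat; lra. }
    lra.
Qed.

(** [chord_estimate] against [flow_W] for the orbit of s x with s near 1. The two nonnegative terms
    on the left are used separately: the chord term gives the cube, the depth term gives the
    product. *)
Lemma orb_estimates (t : R) : 0 < t < t2 ->
  let d := Cmod (orb t - x) in
  d * d * d <= 192 / ka * t /\ d * (1 - sqmod (orb t)) <= 32 / ka * t.
Proof.
  intros Ht d. assert (L1 : t2 <= t1) by apply Rmin_l.
  assert (Uo := orb_disc t ltac:(lra)). assert (Po := proj1 (udisc_sqmod _) Uo).
  assert (Pd : 0 < d).
  { unfold d. apply Cmod_gt_0. intros E. unfold udisc in Uo.
    replace (orb t) with x in Uo; [lra|]. rewrite <- (Cplus_0_l x), <- E. ring. }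
  set (D := 1 - sqmod (orb t)).
  (* Close enough to keep half of the distance d and half of the depth D, whence 192 = 24 * 8 and 32
     = 8 * 4. *)
  set (e := Rmin (d / 4) (D / 8)).
  assert (e1 : e <= d / 4) by apply Rmin_l. assert (e2 : e <= D / 8) by apply Rmin_r.
  assert (e0 : 0 < e) by (apply Rmin_glb_lt; unfold D; lra).
  assert (A := near_one_and _ _ (path_stays t Ht) (near_one_and _ _ (orb_limit t e ltac:(lra) e0)
    (near_one_gt (1 - e) ltac:(lra)))).
  destruct (near_one_ex _ A) as [s [Hs [St [Lm Hse]]]].
  set (z := (RtoC s * x)%C) in *. assert (Uz : udisc z) by (apply udisc_radius; lra).
  assert (Nz : Cmod (z - x) < e).
  { unfold z. replace (RtoC s * x - x)%C with (- (RtoC (1 - s) * x))%C by (rewrite RtoC_minus; ring).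
    rewrite Cmod_opp, Cmod_mult, x1, Cmod_R, Rabs_right by lra. lra. }
  assert (Uc : udisc (phi t z)) by (apply phi_disc; auto; lra).
  assert (F := flow_W z t Uz (proj1 Ht) St).
  assert (Sz := St 0 ltac:(lra)). rewrite phi_0 in Sz by auto.
  assert (Ch := chord_estimate z (phi t z) Uz Uc Sz (St t ltac:(lra))).
  rewrite (sqmod_Cmod (phi t z - z)%C) in Ch.
  assert (Dd : d / 2 <= Cmod (phi t z - z)).
  { assert (T1 := Cmod_minus_triangle (orb t) (phi t z) x). assert (T2 := Cmod_minus_triangle (phi t z) z x).
    rewrite (Cmod_minus_sym (orb t) (phi t z)) in T1. fold d in T1. lra. }
  assert (DD : D / 2 <= 1 - sqmod (phi t z)).
  { assert (T := Cmod_triangle_inv (phi t z) (orb t)). unfold D in *.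
    rewrite !sqmod_Cmod in *. assert (P1 := Cmod_ge_0 (phi t z)). assert (P2 := Cmod_ge_0 (orb t)).
    unfold udisc in *. nra. }
  set (c := Cmod (phi t z - z)) in *. set (Dc := 1 - sqmod (phi t z)) in *.
  assert (Pk : 0 < D) by (unfold D; lra).
  assert (Q1 : ka * (c * Dc) <= 8 * t).
  { assert (0 <= ka * (c * (c * c))) by (apply Rmult_le_pos; [lra|]; repeat apply Rmult_le_pos; lra). lra. }
  assert (Q2 : ka * (c * c * c) <= 24 * t).
  { assert (0 <= ka * (c * Dc)) by (apply Rmult_le_pos; [lra|]; apply Rmult_le_pos; lra). lra. }
  split.
  - apply Rmult_le_reg_l with ka; auto. replace (ka * (192 / ka * t)) with (192 * t) by (field; lra).
    assert (d / 2 * (d / 2) * (d / 2) <= c * c * c).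
    { apply Rmult_le_compat; try lra; [nra|]. apply Rmult_le_compat; lra. }
    assert (ka * (d / 2 * (d / 2) * (d / 2)) <= ka * (c * c * c)) by (apply Rmult_le_compat_l; lra). lra.
  - apply Rmult_le_reg_l with ka; auto. replace (ka * (32 / ka * t)) with (32 * t) by (field; lra).
    assert (d / 2 * (D / 2) <= c * Dc) by (apply Rmult_le_compat; lra).
    assert (ka * (d / 2 * (D / 2)) <= ka * (c * Dc)) by (apply Rmult_le_compat_l; lra). fold D. lra.
Qed.

(** * Speed of the orbit from Schwarz-Pick on a slit-like region *)

(** For q = 1 this maps the disc onto the right half-plane and its square onto the slit plane; q < 1
    keeps the square bounded and at a positive angle from the slit. *)
Definition koebe_half (q : R) (e : C) : C := ((1 + RtoC q * e) / (1 - RtoC q * e))%C.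

Lemma koebe_denominator (q : R) (e : C) : 0 < q < 1 -> udisc e -> (1 - RtoC q * e <> 0)%C.
Proof.
  intros Hq He E. assert (T := Cmod_triangle_inv 1 (RtoC q * e)). rewrite E, Cmod_0, Cmod_1, Cmod_mult, Cmod_R, Rabs_right in T by lra.
  unfold udisc in He. assert (P := Cmod_ge_0 e). nra.
Qed.

(** [psi] sends 0 to w = sh t w0 with derivative 4 q (w - w0). Schwarz-Pick at 0 for h^-1 after psi
    bounds the derivative of h^-1 at w, and multiplication by X w turns that derivative into G. *)
Lemma G_orb_bound (t q : R) : 0 < t < t1 -> 0 < q < 1 ->
  (forall e, udisc e -> exists z, udisc z /\
     h z = (w0 + (sh t w0 - w0) * (koebe_half q e * koebe_half q e))%C) ->
  4 * q * Cmod (sh t w0 - w0) * Cmod (G (orb t)) <= (1 - sqmod (orb t)) * Cmod (X (sh t w0)).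
Proof.
  intros Ht Hq Hpsi. set (w := sh t w0) in *.
  set (psi := fun e => (w0 + (w - w0) * (koebe_half q e * koebe_half q e))%C).
  assert (q0 : forall e, udisc e -> (1 - RtoC q * e <> 0)%C) by (intros; apply koebe_denominator; auto).
  assert (Dpsi : forall e, udisc e -> exists l, cderiv psi e l /\ (e = 0%C -> l = ((w - w0) * RtoC (4 * q))%C)).
  { intros e He.
    assert (D : cderiv (koebe_half q) e ((RtoC q * (1 - RtoC q * e) - (1 + RtoC q * e) * (- RtoC q)) / ((1 - RtoC q * e) * (1 - RtoC q * e)))%C).
    { unfold koebe_half. eapply cderiv_eq.
      - apply (cderiv_div (fun e => 1 + RtoC q * e)%C (fun e => 1 - RtoC q * e)%C); auto.
        + apply cderiv_plus; [apply cderiv_const|apply cderiv_scal, cderiv_id].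
        + apply cderiv_minus; [apply cderiv_const|apply cderiv_scal, cderiv_id].
      - cbv beta. field. auto. }
    eexists. split.
    - unfold psi. apply cderiv_plus; [apply cderiv_const|]. apply cderiv_scal. apply cderiv_mult; exact D.
    - intros ->. unfold koebe_half. rewrite RtoC_mult. replace (RtoC q * 0)%C with (RtoC 0) by ring.
      field. }
  assert (P0 : psi 0%C = w).
  { unfold psi, koebe_half. replace (RtoC q * 0)%C with (RtoC 0) by ring. field. }
  assert (U0 : udisc 0%C) by (unfold udisc; rewrite Cmod_0; lra).
  destruct (G_finv w (forward t Ht)) as [l [Nl [Dl El]]].
  destruct (Dpsi 0%C U0) as [l0 [D0 E0]]. rewrite (E0 eq_refl) in D0.
  assert (Sp := schwarz_pick_deriv_0 (fun e => finv h (psi e)) (/ l * ((w - w0) * RtoC (4 * q)))%C).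
  cbv beta in Sp. rewrite P0 in Sp.
  assert (Sp' : Cmod (/ l * ((w - w0) * RtoC (4 * q))) <= 1 - Cmod (finv h w) * Cmod (finv h w)).
  { apply Sp.
    - intros e He. destruct (Dpsi e He) as [m [Dm _]].
      destruct (G_finv (psi e) (Hpsi e He)) as [l' [_ [Dl' _]]].
      eexists. apply (cderiv_comp psi (finv h)); eauto.
    - intros e He. apply (finv_spec h). exact (Hpsi e He).
    - apply (cderiv_comp psi (finv h)); auto. rewrite P0. exact Dl. }
  unfold orb. fold w. rewrite <- El, sqmod_Cmod. rewrite !Cmod_mult, Cmod_R, (Rabs_right (4 * q)) in Sp' by lra.
  rewrite Cmod_mult. assert (P := Cmod_ge_0 (X w)).
  apply Rle_trans with (Cmod (/ l) * (Cmod (w - w0) * (4 * q)) * Cmod (X w)); [right; ring|].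
  apply Rmult_le_compat_r; auto.
Qed.

End orbit.

(** * The Dini-smooth corner *)

Lemma Cnorm_Cmod (z : C) : Cnorm z = Cmod z.
Proof. unfold Cnorm, Cmod. f_equal. simpl. ring. Qed.

Lemma Csub_Cminus (z w : C) : Csub z w = (z - w)%C.
Proof. reflexivity. Qed.

Lemma Cscale_Cmult (a : R) (z : C) : Cscale a z = (RtoC a * z)%C.
Proof. unfold Cscale. Cext; ring. Qed.

Definition cunit (a : R) : C := (cos a, sin a).

Lemma cunit_plus (a b : R) : cunit (a + b) = (cunit a * cunit b)%C.
Proof. unfold cunit. Cext; rewrite ?cos_plus, ?sin_plus; ring. Qed.

(** The third clause measures the angle to the imaginary axis: Re g / |g| = cos a = sin (pi / 2 -
    |a|) <= pi / 2 - |a|. The last one is atan y <= y. *)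
Lemma polar_right (g : C) : 0 < Re g -> exists a, g = (RtoC (Cmod g) * cunit a)%C /\
  Rabs a < PI / 2 /\ Re g / Cmod g <= PI / 2 - Rabs a /\ Rabs a <= Rabs (Im g) / Re g.
Proof.
  intros Hg. unfold Re, Im in *. set (p := fst g) in *. set (q := snd g) in *.
  set (a := atan (q / p)). exists a.
  assert (Ba := atan_bound (q / p)). fold a in Ba.
  assert (Pc : 0 < cos a) by (apply cos_gt_0; lra).
  assert (Ta : sin a = q / p * cos a).
  { assert (E := atan_right_inv (q / p)). fold a in E. unfold tan in E. rewrite <- E. field. lra. }
  assert (S := sin2_cos2 a). unfold Rsqr in S.
  assert (Pm : 0 < Cmod g). { assert (X := Rabs_fst_le g). fold p in X. rewrite Rabs_right in X by lra. lra. }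
  assert (Sq := Cmod_sqr g). fold p q in Sq.
  assert (Mc : Cmod g * cos a = p).
  { apply Rsqr_inj; [nra|lra|]. unfold Rsqr. rewrite Ta in S.
    transitivity ((Cmod g * Cmod g) * (cos a * cos a)); [ring|]. rewrite Sq.
    transitivity (p * p * (q / p * cos a * (q / p * cos a) + cos a * cos a)); [field; lra|]. rewrite S. ring. }
  assert (Bnd : Rabs a < PI / 2) by (apply Rabs_def1; lra).
  split; [|split; [auto|split]].
  - Cext.
    + rewrite Rmult_0_l, Rminus_0_r, Mc. auto.
    + rewrite Rmult_0_l, Rplus_0_r, Ta. fold q. transitivity (q / p * (Cmod g * cos a)); [rewrite Mc; field; lra|ring].
  - replace (p / Cmod g) with (cos a) by (rewrite <- Mc; field; lra).
    replace (cos a) with (sin (PI / 2 - Rabs a)).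
    + assert (P := Rabs_pos a). left. apply sin_lt_x. lra.
    + rewrite sin_shift. unfold Rabs. destruct (Rcase_abs a); auto. apply cos_neg.
  - assert (At : forall y, 0 <= y -> atan y <= y).
    { intros y Hy. assert (X := derive_nonneg_le (fun y => y - atan y) (fun y => 1 - / (1 + y * y)) 0 y Hy).
      cbv beta in X. rewrite atan_0 in X. assert (0 - 0 <= y - atan y); [|lra]. apply X.
      - intros u _. auto_derive; auto. field. nra.
      - intros u _. assert (/ (1 + u * u) <= / 1); [|lra]. apply Rinv_le_contravar; nra. }
    assert (Eq : Rabs q / p = Rabs (q / p)).
    { unfold Rdiv. rewrite Rabs_mult, (Rabs_right (/ p)); auto. left; apply Rinv_0_lt_compat; auto. }
    rewrite Eq. unfold a, Rabs. destruct (Rcase_abs (q / p)).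
    + assert (X := At (- (q / p)) ltac:(lra)). rewrite atan_opp in X.
      destruct (Rcase_abs (atan (q / p))); [auto|].
      assert (Y := atan_increasing (q / p) 0 r). rewrite atan_0 in Y. lra.
    + assert (X := At (q / p) ltac:(lra)). destruct (Rcase_abs (atan (q / p))); [|auto].
      destruct (Rge_le _ _ r) as [L|L].
      * assert (Y := atan_increasing 0 (q / p) L). rewrite atan_0 in Y. lra.
      * rewrite <- L, atan_0 in r0. lra.
Qed.

Lemma polar_near_one (k : C) (e : R) : Cmod (k - 1) <= e -> e <= 1 / 2 ->
  exists a, k = (RtoC (Cmod k) * cunit a)%C /\ Rabs a <= 2 * e.
Proof.
  intros H He.
  assert (A := Rabs_fst_le (k - 1)). assert (B := Rabs_snd_le (k - 1)). simpl in A, B.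
  replace (snd k + - 0) with (snd k) in B by ring.
  apply Rabs_le_between in A.
  destruct (polar_right k) as [a [E [_ [_ Ba]]]]; [unfold Re; lra|].
  exists a; split; auto. eapply Rle_trans; [exact Ba|]. unfold Re, Im.
  apply Rmult_le_reg_r with (fst k); [lra|]. unfold Rdiv. rewrite Rmult_assoc, Rinv_l by lra.
  assert (P := Rabs_pos (snd k)). nra.
Qed.

Section corner.
Variables (gamma : R -> C) (Omega : C -> Prop) (w0 v : C) (p : R -> C).
Hypothesis v_neq : v <> 0%C.
Hypothesis p_deriv : curve_deriv p 0 (- v)%C.
Hypothesis p_0 : p 0 = w0.
Hypothesis p_out : forall t, 0 < t -> ~ Omega (p t).
Hypothesis corner : dini_smooth_corner gamma Omega w0 (2 * PI).

(* The curve [p] leaves [w0] in the direction [-v] outside [Omega], so the bisector of the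
   corner points in the direction [v]. *)
Lemma corner_sector : exists e0 (om : R -> R),
  0 < e0 /\
  (forall t, 0 <= t -> 0 <= om t) /\
  (forall t t', 0 <= t <= t' -> om t <= om t') /\
  (forall e, 0 < e -> exists d, 0 < d /\ forall t, 0 < t < d -> om t < e) /\
  (exists B, forall d, 0 < d < e0 ->
     exists pr : Riemann_integrable (fun t => om t / t) d e0, RiemannInt pr <= B) /\
  (forall rho b, 0 < rho < e0 -> Rabs b < PI - om rho ->
     Omega (w0 + RtoC rho * ((v / RtoC (Cmod v)) * cunit b))%C).
Proof.
  destruct corner as [_ (e0 & gp & gm & ap & am & om & He0 & _ & _ & _ & om_pos & om_mono & om_0 & Hmod & Hint & Hin & Hth)].
  exists e0, om. split; [auto|]. split; [auto|]. split; [auto|]. split; [auto|]. split; [auto|].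
  assert (PI0 := PI_RGT_0).
  assert (Pv : 0 < Cmod v) by (apply Cmod_gt_0; auto).
  assert (vn : RtoC (Cmod v) <> 0%C) by (intros E; injection E; lra).
  set (vh := (v / RtoC (Cmod v))%C).
  assert (vh1 : Cmod vh = 1). { unfold vh. rewrite Cmod_div, Cmod_R, Rabs_right by (auto; lra). field. lra. }
  assert (Bd : forall rho, 0 < rho < e0 -> am rho <= am 0 + om rho /\ ap 0 - om rho <= ap rho).
  { intros rho Hr. destruct (Hmod rho 0 ltac:(lra) ltac:(lra)) as [H1 H2].
    rewrite Rminus_0_r, (Rabs_right rho) in H1, H2 by lra.
    apply Rabs_le_between in H1. apply Rabs_le_between in H2. lra. }
  assert (In : forall rho a, 0 < rho < e0 -> am 0 + om rho < a < am 0 + 2 * PI - om rho ->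
    Omega (w0 + RtoC rho * cunit a)%C).
  { intros rho a Hr Ha. destruct (Bd rho Hr) as [B1 B2]. destruct (Hin rho Hr) as [_ H].
    specialize (H a ltac:(lra)). rewrite Cscale_Cmult in H. exact H. }
  destruct (unit_polar (- vh)%C (am 0)) as [a [Ha Ea]]; [rewrite Cmod_opp; auto|].
  (* With opening 2 pi both sides of the corner leave w0 in the direction [am 0]; the claim is that
     this is the direction of -v. *)
  assert (Eq : a = am 0).
  { apply NNPP. intros N.
    (* Otherwise -v points strictly inside the corner and p t enters Omega. Of the angular distance
       [mu] to the sides, om uses at most a quarter and the deviation of p from its tangent another
       quarter. *)
    set (mu := Rmin (a - am 0) (am 0 + 2 * PI - a)).
    assert (m1 : mu <= a - am 0) by apply Rmin_l. assert (m2 : mu <= am 0 + 2 * PI - a) by apply Rmin_r.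
    assert (m0 : 0 < mu) by (apply Rmin_glb_lt; lra).
    destruct (om_0 (mu / 4)) as [d0 [Hd0 Hom]]; [lra|].
    set (ep := Rmin (1 / 2) (mu / 8)).
    assert (ep1 : ep <= 1 / 2) by apply Rmin_l. assert (ep2 : ep <= mu / 8) by apply Rmin_r.
    assert (ep0 : 0 < ep) by (apply Rmin_glb_lt; lra).
    destruct (proj1 (curve_deriv_eps _ _ _) p_deriv (ep * Cmod v)) as [d1 [Hd1 H1]]; [nra|].
    assert (P2 : 0 < Rmin d0 e0 / (4 * Cmod v)). { apply Rdiv_lt_0_compat; [apply Rmin_glb_lt; auto|lra]. }
    set (t := Rmin d1 (Rmin d0 e0 / (4 * Cmod v)) / 2).
    assert (L1 := Rmin_l d1 (Rmin d0 e0 / (4 * Cmod v))). assert (L2 := Rmin_r d1 (Rmin d0 e0 / (4 * Cmod v))).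
    assert (L3 := Rmin_l d0 e0). assert (L4 := Rmin_r d0 e0).
    assert (Pt : 0 < Rmin d1 (Rmin d0 e0 / (4 * Cmod v))) by (apply Rmin_glb_lt; auto).
    assert (t0 : 0 < t) by (unfold t; lra).
    specialize (H1 t). rewrite Rminus_0_r, Rabs_right in H1 by lra.
    specialize (H1 ltac:(unfold t; lra)). rewrite p_0 in H1.
    assert (tn : RtoC t <> 0%C) by (intros E; injection E; lra).
    set (k := ((p t - w0) / (- v * RtoC t))%C).
    assert (K : Cmod (k - 1) <= ep).
    { replace (k - 1)%C with ((p t - w0 - - v * RtoC t) / (- v * RtoC t))%C.
      2:{ unfold k. field. split; auto. }
      rewrite Cmod_div by (apply Cmult_neq_0; auto; intros E; apply v_neq; replace v with (- - v)%C by ring; rewrite E; ring).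
      rewrite (Cmod_mult (- v)), Cmod_opp, Cmod_R, (Rabs_right t) by lra.
      apply Rmult_le_reg_r with (Cmod v * t); [nra|]. unfold Rdiv. rewrite Rmult_assoc, Rinv_l by nra. lra. }
    destruct (polar_near_one k ep K ep1) as [s [Es Hs]].
    set (rho := Cmod k * (Cmod v * t)).
    assert (Ep : p t = (w0 + RtoC rho * cunit (a + s))%C).
    { rewrite cunit_plus. change (cunit a) with ((cos a, sin a) : C). rewrite <- Ea.
      unfold rho. rewrite !RtoC_mult.
      replace (w0 + RtoC (Cmod k) * (RtoC (Cmod v) * RtoC t) * (- vh * cunit s))%C
        with (w0 + (RtoC (Cmod k) * cunit s) * (- (RtoC (Cmod v) * vh) * RtoC t))%C by ring.
      rewrite <- Es. replace (RtoC (Cmod v) * vh)%C with v by (unfold vh; field; auto).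
      unfold k. field. split; auto. }
    assert (Mk : 1/2 <= Cmod k <= 2).
    { assert (T1 := Cmod_triangle_inv k 1). assert (T2 := Cmod_triangle_inv 1 k).
      rewrite (Cmod_minus_sym 1 k) in T2. rewrite Cmod_1 in *. lra. }
    assert (R0 : 0 < rho) by (unfold rho; apply Rmult_lt_0_compat; nra).
    assert (R1 : rho < Rmin d0 e0).
    { assert (t < Rmin d0 e0 / (4 * Cmod v)) by (unfold t; lra).
      assert (Cmod v * t < Rmin d0 e0 / 4).
      { replace (Rmin d0 e0 / 4) with (Cmod v * (Rmin d0 e0 / (4 * Cmod v))) by (field; lra). apply Rmult_lt_compat_l; auto. }
      assert (0 < Cmod v * t) by nra. unfold rho. nra. }
    apply (p_out t t0). rewrite Ep. apply In; [lra|].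
    specialize (Hom rho ltac:(lra)). apply Rabs_le_between in Hs. lra. }
  intros rho b Hr Hb.
  replace (vh * cunit b)%C with (cunit (am 0 + (PI + b))).
  - apply In; auto. apply Rabs_def2 in Hb. lra.
  - rewrite !cunit_plus. rewrite <- Eq. change (cunit a) with ((cos a, sin a) : C). rewrite <- Ea.
    unfold cunit. rewrite cos_PI, sin_PI. Cext; ring.
Qed.

End corner.

(** * The Dini condition *)

(** J k is the integral of om t / t from 2^-k to e0. On the dyadic block [a / 2, a] the integrand is
    at least om (a / 2) / a, so the block contributes at least om (a / 2) / 2. The telescoping form
    replaces a convergent series. *)
Lemma dini_sum (om : R -> R) (e0 B : R) : 0 < e0 ->
  (forall t, 0 <= t -> 0 <= om t) -> (forall t t', 0 <= t <= t' -> om t <= om t') ->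
  (forall d, 0 < d < e0 -> exists pr : Riemann_integrable (fun t => om t / t) d e0, RiemannInt pr <= B) ->
  exists k0 (J : nat -> R), (forall k, (k0 <= k)%nat -> J k <= B) /\
    forall k, (k0 <= k)%nat -> om ((/ 2) ^ (S k)) <= 2 * (J (S k) - J k).
Proof.
  intros He Hp Hm Hi.
  destruct (pow_lt_1_zero (/ 2) ltac:(rewrite Rabs_right; lra) e0 He) as [k0 Hk0].
  assert (Pk : forall k, 0 < (/ 2) ^ k) by (intros; apply pow_lt; lra).
  assert (Lk : forall k, (k0 <= k)%nat -> (/ 2) ^ k < e0).
  { intros k Hk. specialize (Hk0 k Hk). rewrite Rabs_right in Hk0; auto. left; apply Pk. }
  assert (Ex : forall d, 0 < d < e0 -> ex_RInt (fun t => om t / t) d e0 /\ RInt (fun t => om t / t) d e0 <= B).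
  { intros d Hd. destruct (Hi d Hd) as [pr Hpr]. split; [apply ex_RInt_Reals_1; auto|].
    rewrite RInt_Reals with (pr := pr). auto. }
  exists k0, (fun k => RInt (fun t => om t / t) ((/ 2) ^ k) e0). split.
  - intros k Hk. apply Ex. split; auto.
  - intros k Hk. set (a := (/ 2) ^ k). assert (Pa := Pk k). fold a in Pa. assert (La := Lk k Hk). fold a in La.
    replace ((/ 2) ^ S k) with (a / 2) by (simpl; fold a; field).
    destruct (Ex (a / 2) ltac:(lra)) as [E1 _]. destruct (Ex a ltac:(lra)) as [E2 _].
    assert (E3 : ex_RInt (fun t => om t / t) (a / 2) a).
    { apply (ex_RInt_Chasles_1 (V := R_CompleteNormedModule) _ _ _ e0); auto. lra. }
    assert (Ch := RInt_Chasles (V := R_CompleteNormedModule) _ _ _ _ E3 E2).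
    unfold plus in Ch; simpl in Ch. rewrite <- Ch.
    assert (X := RInt_le (fun _ => om (a / 2) / a) (fun t => om t / t) (a / 2) a ltac:(lra)).
    rewrite RInt_const in X. unfold scal in X; simpl in X; unfold mult in X; simpl in X.
    assert (Y : (a - a / 2) * (om (a / 2) / a) <= RInt (fun t => om t / t) (a / 2) a).
    { apply X; auto.
      - apply ex_RInt_const.
      - intros t Ht. apply Rmult_le_compat.
        + apply Hp; lra.
        + left; apply Rinv_0_lt_compat; lra.
        + apply Hm; lra.
        + apply Rinv_le_contravar; lra. }
    replace ((a - a / 2) * (om (a / 2) / a)) with (om (a / 2) / 2) in Y by (field; lra). lra.
Qed.

(** The inequality for [df] is integrated downwards in t. With a = 2^-(k+1) the block of times
    [(a / 2)^4, a^4] has end ratio 16, so the excess om a + a over 1/2 costs at most ln 16 <= 4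
    times itself there, and these costs are summable. The fourth power leaves room in [orb_lower]
    for a Koebe image to fit within radius a. *)
Lemma dini_lower_bound (f df om : R -> R) (J : nat -> R) (B K : R) (k1 : nat) :
  0 <= K -> (forall t, 0 <= t -> 0 <= om t) ->
  (forall t, 0 < t <= ((/ 2) ^ (S k1)) ^ 4 -> is_derive f t (df t)) ->
  (forall k t, (k1 <= k)%nat -> ((/ 2) ^ (S (S k))) ^ 4 <= t <= ((/ 2) ^ (S k)) ^ 4 ->
     df t <= (1 / 2 + (om ((/ 2) ^ (S k)) + (/ 2) ^ (S k))) / t + K) ->
  (forall k, (k1 <= k)%nat -> J k <= B) ->
  (forall k, (k1 <= k)%nat -> om ((/ 2) ^ (S k)) <= 2 * (J (S k) - J k)) ->
  exists Cst, forall t, 0 < t <= ((/ 2) ^ (S k1)) ^ 4 -> ln t / 2 - Cst <= f t.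
Proof.
  intros HK Hp Hd Hdf HJ Hom.
  set (a := fun k => (/ 2) ^ (S k)). set (T := fun k => (a k) ^ 4).
  change (forall t, 0 < t <= T k1 -> is_derive f t (df t)) in Hd.
  change (forall k t, (k1 <= k)%nat -> T (S k) <= t <= T k -> df t <= (1 / 2 + (om (a k) + a k)) / t + K) in Hdf.
  change (forall k, (k1 <= k)%nat -> om (a k) <= 2 * (J (S k) - J k)) in Hom.
  change (exists Cst, forall t, 0 < t <= T k1 -> ln t / 2 - Cst <= f t).
  assert (Pa : forall k, 0 < a k) by (intros; apply pow_lt; lra).
  assert (aS : forall k, a (S k) = a k / 2) by (intros; unfold a; simpl; field).
  assert (PT : forall k, 0 < T k) by (intros; apply pow_lt; auto).
  assert (TS : forall k, T (S k) = T k / 16) by (intros; unfold T; rewrite aS; field).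
  set (Y := fun t => f t - ln t / 2 - K * t).
  assert (TD : forall j, T (k1 + j)%nat <= T k1).
  { induction j; [rewrite Nat.add_0_r; lra|]. rewrite Nat.add_succ_r, TS. specialize (PT (k1 + j)%nat). lra. }
  assert (ln16 : ln 16 <= 4).
  { rewrite <- (ln_exp 4). apply ln_le; [lra|].
    assert (E := exp_ineq1 1 ltac:(lra)). replace 4 with (1 + 1 + (1 + 1)) by ring. rewrite !exp_plus.
    assert (2 * 2 <= exp 1 * exp 1) by (apply Rmult_le_compat; lra). nra. }
  assert (St : forall j s t, T (S (k1 + j)) <= s <= t -> t <= T (k1 + j)%nat ->
    Y t - 4 * (om (a (k1 + j)%nat) + a (k1 + j)%nat) <= Y s).
  { intros j s t Hs Ht. set (k := (k1 + j)%nat) in *. set (de := om (a k) + a k).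
    assert (Pd : 0 <= de) by (unfold de; specialize (Hp (a k) ltac:(left; auto)); specialize (Pa k); lra).
    assert (Ps : 0 < s) by (specialize (PT (S k)); lra).
    assert (TK := TD j). fold k in TK.
    assert (Mo : - (f s - (1 / 2 + de) * ln s - K * s) <= - (f t - (1 / 2 + de) * ln t - K * t)).
    { apply (derive_nonneg_le (fun u => - (f u - (1 / 2 + de) * ln u - K * u))
        (fun u => - (df u - (1 / 2 + de) / u - K)) s t (proj2 Hs)).
      - intros u Hu. assert (D := Hd u ltac:(lra)).
        auto_derive; [split; [exists (df u); exact D|split; [lra|auto]]|].
        replace (Derive (fun x => f x) u) with (df u) by (symmetry; apply is_derive_unique; exact D).
        field. lra.
      - intros u Hu. assert (X := Hdf k u ltac:(unfold k; lia)).
        specialize (X ltac:(lra)). fold de in X. lra. }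
    assert (Ln : ln t - ln s <= 4).
    { assert (ln t <= ln (16 * s)) by (apply ln_le; [lra|]; rewrite TS in Hs; lra).
      rewrite ln_mult in H by lra. lra. }
    assert (de * (ln t - ln s) <= de * 4) by (apply Rmult_le_compat_l; lra).
    unfold Y. lra. }
  (* Both costs of a block telescope: 4 om <= 8 (J (k+1) - J k), and 4 a k = 8 (a k - a (k+1)). *)
  assert (Low : forall j, Y (T k1) - 8 * (J (k1 + j)%nat - J k1) - 8 * a k1 + 8 * a (k1 + j)%nat <= Y (T (k1 + j)%nat)).
  { induction j; [rewrite Nat.add_0_r; lra|].
    assert (X := St j (T (S (k1 + j))) (T (k1 + j)%nat)).
    specialize (X ltac:(split; [lra|rewrite TS; specialize (PT (k1 + j)%nat); lra]) (Rle_refl _)).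
    assert (O := Hom (k1 + j)%nat ltac:(lia)).
    rewrite Nat.add_succ_r. rewrite aS. lra. }
  set (M := Y (T k1) - 8 * (B - J k1) - 8 * a k1).
  (* [M] pays for the complete blocks; the last two terms pay for the partial block containing t,
     where a <= 1. *)
  exists (- (M - 8 * (B - J k1) - 4)).
  intros t Ht.
  assert (Find : exists j, T (S (k1 + j)) <= t <= T (k1 + j)%nat).
  { destruct (pow_lt_1_zero (/ 2) ltac:(rewrite Rabs_right; lra) t (proj1 Ht)) as [n Hn].
    assert (Tn : forall m, (n <= m)%nat -> T m < t).
    { intros m Hm. specialize (Hn (S m) ltac:(lia)). change ((/ 2) ^ S m) with (a m) in Hn. rewrite Rabs_right in Hn by (left; apply Pa).
      assert (A1 : a m <= 1). { unfold a. rewrite <- (pow1 (S m)). apply pow_incr. lra. }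
      assert (P := Pa m). unfold T. simpl.
      assert (a m * (a m * (a m * (a m * 1))) <= a m * 1).
      { apply Rmult_le_compat_l; [lra|]. assert (a m * a m <= 1) by nra. assert (0 <= a m * a m) by nra. nra. }
      lra. }
    assert (Ind : forall j, T (k1 + j)%nat < t -> exists i, T (S (k1 + i)) <= t <= T (k1 + i)%nat).
    { induction j; intros Hj; [rewrite Nat.add_0_r in Hj; lra|].
      rewrite Nat.add_succ_r in Hj.
      destruct (Rlt_le_dec (T (k1 + j)%nat) t); [apply IHj; auto|]. exists j. lra. }
    apply (Ind n). apply Tn. lia. }
  destruct Find as [j Hj].
  assert (X := St j t (T (k1 + j)%nat) Hj (Rle_refl _)).
  assert (Lj := Low j). assert (Bj := HJ (k1 + j)%nat ltac:(lia)).
  assert (O := Hom (k1 + j)%nat ltac:(lia)).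
  assert (B1 := HJ (S (k1 + j)) ltac:(lia)).
  assert (Jm : J k1 <= J (k1 + j)%nat).
  { clear - Hom Hp Pa. induction j; [rewrite Nat.add_0_r; lra|]. rewrite Nat.add_succ_r.
    assert (O := Hom (k1 + j)%nat ltac:(lia)). specialize (Hp (a (k1 + j)%nat) ltac:(left; apply Pa)). lra. }
  assert (A1 : a (k1 + j)%nat <= 1). { unfold a. rewrite <- (pow1 (S (k1 + j))). apply pow_incr. lra. }
  assert (Kt : 0 <= K * t) by (apply Rmult_le_pos; lra).
  assert (P := Pa (k1 + j)%nat).
  unfold M. unfold Y in X at 2. lra.
Qed.

(** * First-order behaviour of the flow line of w0 *)

Section shift.
Variables (phi : R -> C -> C) (tau : C) (h : C -> C) (sh : R -> C -> C) (X : C -> C) (w0 : C).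
Hypothesis M : linear_model phi tau h sh X.
Hypothesis v_neq : X w0 <> 0%C.

(** Since X is Lipschitz, the velocity differs from X w0 by O(t); integrating this gives the
    quadratic remainder. *)
Lemma shift_expansion : exists K d, 0 < K /\ 0 < d /\ forall t, 0 <= t < d ->
  Cmod (sh t w0 - w0 - X w0 * RtoC t) <= K * (t * t) /\ Cmod (X (sh t w0) - X w0) <= K * t.
Proof.
  destruct (model_lip M) as [La [HLa Hlip]].
  assert (Fl := model_flow M).
  destruct (proj1 (curve_deriv_eps _ _ _) (Fl 0 w0) 1 Rlt_0_1) as [d [Hd H]].
  rewrite (model_0 M) in H.
  assert (Pv := Cmod_ge_0 (X w0)).
  set (K := La * (Cmod (X w0) + 1)).
  assert (PK : 0 < K) by (apply Rmult_lt_0_compat; lra).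
  assert (B : forall t, 0 <= t < d -> Cmod (X (sh t w0) - X w0) <= K * t).
  { intros t Ht. eapply Rle_trans; [apply Hlip|]. unfold K. rewrite Rmult_assoc. apply Rmult_le_compat_l; [lra|].
    specialize (H t). rewrite Rminus_0_r, Rabs_right in H by lra. specialize (H ltac:(lra)).
    assert (T := Cmod_triangle (sh t w0 - w0 - X w0 * RtoC t) (X w0 * RtoC t)).
    replace (sh t w0 - w0 - X w0 * RtoC t + X w0 * RtoC t)%C with (sh t w0 - w0)%C in T by ring.
    rewrite Cmod_mult, Cmod_R, (Rabs_right t) in T by lra. lra. }
  exists K, d. split; [auto|split; [auto|]]. intros t Ht. split; [|apply B; auto].
  assert (Y := curve_increment_le (fun s => sh s w0 - RtoC s * X w0)%C (fun s => X (sh s w0) - X w0)%C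
    (fun s => K * (s * s) / 2) (fun s => K * s) 0 t (proj1 Ht)).
  cbv beta in Y. rewrite (model_0 M) in Y.
  replace (sh t w0 - RtoC t * X w0 - (w0 - RtoC 0 * X w0))%C with (sh t w0 - w0 - X w0 * RtoC t)%C in Y by ring.
  assert (Z : Cmod (sh t w0 - w0 - X w0 * RtoC t) <= K * (t * t) / 2 - K * (0 * 0) / 2).
  { apply Y.
    - intros s Hs. apply (curve_deriv_minus (fun s => sh s w0) (fun s => (RtoC s * X w0)%C)); [apply Fl|].
      split; simpl; auto_derive; auto; ring.
    - intros s Hs. auto_derive; auto. field.
    - intros s Hs. apply B. lra. }
  assert (0 <= K * (t * t)) by (apply Rmult_le_pos; nra). lra.
Qed.

(** The relative form: [K] absorbs |X w0|, and K t <= 1/4 keeps the displacement divided by t X w0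
    near 1, so that its argument is at most 2 K t. *)
Lemma shift_polar : exists K d, 0 < K /\ 0 < d /\ forall t, 0 < t < d ->
  K * t <= 1 / 4 /\
  Cmod (X w0) * t * (1 - K * t) <= Cmod (sh t w0 - w0) <= Cmod (X w0) * t * (1 + K * t) /\
  Cmod (X (sh t w0)) <= Cmod (X w0) * (1 + K * t) /\
  exists s, Rabs s <= 2 * (K * t) /\
    (sh t w0 - w0 = RtoC (Cmod (sh t w0 - w0)) * (X w0 / RtoC (Cmod (X w0)) * cunit s))%C.
Proof.
  destruct shift_expansion as [K0 [d0 [HK0 [Hd0 H]]]].
  set (v := X w0) in *. assert (Pv : 0 < Cmod v) by (apply Cmod_gt_0; auto).
  assert (vn : RtoC (Cmod v) <> 0%C) by (intros E; injection E; lra).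
  set (K := K0 / Cmod v). assert (PK : 0 < K) by (apply Rdiv_lt_0_compat; auto).
  assert (EK : K0 = K * Cmod v) by (unfold K; field; lra).
  assert (P4 : 0 < / (4 * K)) by (apply Rinv_0_lt_compat; lra).
  exists K, (Rmin d0 (/ (4 * K))). split; [auto|split; [apply Rmin_glb_lt; auto|]].
  intros t Ht. assert (L1 := Rmin_l d0 (/ (4 * K))). assert (L2 := Rmin_r d0 (/ (4 * K))).
  destruct (H t ltac:(lra)) as [H1 H2].
  assert (Kt : K * t <= 1 / 4).
  { apply Rle_trans with (K * / (4 * K)); [apply Rmult_le_compat_l; lra|right; field; lra]. }
  split; auto. set (w := sh t w0) in *.
  assert (tn : RtoC t <> 0%C) by (intros E; injection E; lra).
  assert (Mv : Cmod (v * RtoC t) = Cmod v * t) by (rewrite Cmod_mult, Cmod_R, Rabs_right; lra).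
  rewrite EK in H1, H2.
  split; [|split].
  - assert (T1 := Cmod_triangle_inv (w - w0) (v * RtoC t)). assert (T2 := Cmod_triangle_inv (v * RtoC t) (w - w0)).
    rewrite (Cmod_minus_sym (v * RtoC t) (w - w0)) in T2. rewrite Mv in T1, T2. split; nra.
  - assert (T1 := Cmod_triangle_inv (X w) v). nra.
  - set (k := ((w - w0) / (v * RtoC t))%C).
    assert (Nvt : (v * RtoC t <> 0)%C) by (apply Cmult_neq_0; auto).
    assert (Hk : Cmod (k - 1) <= K * t).
    { replace (k - 1)%C with ((w - w0 - v * RtoC t) / (v * RtoC t))%C by (unfold k; field; auto).
      rewrite Cmod_div, Mv by auto. apply Rmult_le_reg_r with (Cmod v * t); [nra|].
      unfold Rdiv. rewrite Rmult_assoc, Rinv_l by nra. nra. }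
    destruct (polar_near_one k (K * t) Hk ltac:(lra)) as [s [Es Hs]].
    exists s. split; auto.
    assert (Ek : (w - w0 = k * (v * RtoC t))%C) by (unfold k; field; split; auto).
    assert (Em : Cmod (w - w0) = Cmod k * (Cmod v * t)) by (rewrite Ek at 1; rewrite Cmod_mult, Mv; auto).
    rewrite Em, !RtoC_mult. rewrite Ek at 1. rewrite Es at 1. field. auto.
Qed.

End shift.

(** * Lower bound for the depth of the orbit *)

(** With y = q e, the cosine of the argument is (1 - |y|^2) / |1 - y^2| >= (1 - q^2) / (1 + q^2),
    hence an angle of at least (1 - q) / 2 to the imaginary axis, which squaring doubles to 1 - q
    from the slit. *)
Lemma koebe_half_bounds (q : R) (e : C) : 0 <= q < 1 -> udisc e ->
  0 < Re (koebe_half q e) /\ (1 - q) / 2 <= Re (koebe_half q e) / Cmod (koebe_half q e) /\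
  Cmod (koebe_half q e) * (1 - q) <= 2.
Proof.
  intros Hq He. unfold udisc in He. set (y := (RtoC q * e)%C).
  assert (Pe := Cmod_ge_0 e).
  assert (Ye : Cmod y = q * Cmod e) by (unfold y; rewrite Cmod_mult, Cmod_R, Rabs_right; lra).
  assert (Py := Cmod_ge_0 y). assert (Yq : Cmod y <= q) by nra.
  assert (T1 := Cmod_triangle_inv 1 y). assert (T2 := Cmod_triangle_inv 1 (- y)).
  replace (1 - - y)%C with (1 + y)%C in T2 by ring. rewrite Cmod_opp, Cmod_1 in *.
  assert (T3 := Cmod_triangle 1 y). rewrite Cmod_1 in T3.
  assert (N1 : (1 - y <> 0)%C) by (apply Cmod_gt_0; lra).
  assert (S1 := Cmod_sqr (1 - y)). assert (S0 := Cmod_sqr y). simpl in S1.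
  assert (ReE : Re (koebe_half q e) = (1 - Cmod y * Cmod y) / (Cmod (1 - y) * Cmod (1 - y))).
  { unfold koebe_half. fold y. rewrite S1, S0. unfold Re, Cdiv, Cinv, Cmult; simpl. field. nra. }
  assert (CmE : Cmod (koebe_half q e) = Cmod (1 + y) / Cmod (1 - y)).
  { unfold koebe_half. fold y. apply Cmod_div; auto. }
  rewrite ReE, CmE.
  assert (Prod : Cmod (1 - y) * Cmod (1 + y) <= 1 + q * q).
  { rewrite <- Cmod_mult. replace ((1 - y) * (1 + y))%C with (1 - y * y)%C by ring.
    eapply Rle_trans; [apply Cmod_minus_le|]. rewrite Cmod_1, Cmod_mult. nra. }
  set (a := Cmod (1 - y)) in *. set (b := Cmod (1 + y)) in *. set (m := Cmod y) in *.
  split; [|split].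
  - apply Rdiv_lt_0_compat; nra.
  - replace ((1 - m * m) / (a * a) / (b / a)) with ((1 - m * m) / (a * b)) by (field; lra).
    apply Rmult_le_reg_r with (a * b); [nra|]. replace ((1 - m * m) / (a * b) * (a * b)) with (1 - m * m) by (field; lra).
    apply Rle_trans with ((1 - q) / 2 * (1 + q * q)); [apply Rmult_le_compat_l; lra|].
    assert (m * m <= q * q) by (apply Rmult_le_compat; lra).
    assert (0 <= (1 - q) * (1 + 2 * q - q * q)) by (apply Rmult_le_pos; nra). lra.
  - apply Rmult_le_reg_r with a; [lra|]. replace (b / a * (1 - q) * a) with (b * (1 - q)) by (field; lra). nra.
Qed.

Lemma is_derive_ln_depth (a b : R -> R) (t a' b' : R) : is_derive a t a' -> is_derive b t b' ->
  0 < 1 - (a t * a t + b t * b t) ->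
  is_derive (fun s => ln (1 - (a s * a s + b s * b s))) t
    (- (2 * (a t * a' + b t * b')) / (1 - (a t * a t + b t * b t))).
Proof.
  intros Da Db P. auto_derive.
  - repeat split; try (eexists; eassumption); lra.
  - replace (Derive (fun x => a x) t) with a' by (symmetry; apply is_derive_unique; auto).
    replace (Derive (fun x => b x) t) with b' by (symmetry; apply is_derive_unique; auto).
    field. lra.
Qed.

Section lower.
Variables (phi : R -> C -> C) (G : C -> C) (tau : C).
Hypothesis phi_holo : forall t, 0 <= t -> holo udisc (phi t).
Hypothesis phi_disc : forall t z, 0 <= t -> udisc z -> udisc (phi t z).
Hypothesis G_holo : holo udisc G.
Hypothesis gen_0 : forall z eps, udisc z -> 0 < eps -> exists d, 0 < d /\
  forall s, 0 < s < d -> Cmod (phi s z - z - RtoC s * G z) <= eps * s.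
Variables (h : C -> C) (sh : R -> C -> C) (X : C -> C).
Hypothesis M : linear_model phi tau h sh X.
Variables (w0 : C) (e0 : R) (om : R -> R) (B : R).
Hypothesis v_neq : X w0 <> 0%C.
Hypothesis e0_pos : 0 < e0.
Hypothesis om_pos : forall t, 0 <= t -> 0 <= om t.
Hypothesis om_mono : forall t t', 0 <= t <= t' -> om t <= om t'.
Hypothesis om_0 : forall e, 0 < e -> exists d, 0 < d /\ forall t, 0 < t < d -> om t < e.
Hypothesis om_int : forall d, 0 < d < e0 ->
  exists pr : Riemann_integrable (fun t => om t / t) d e0, RiemannInt pr <= B.
Hypothesis sector : forall rho b, 0 < rho < e0 -> Rabs b < PI - om rho ->
  exists z, udisc z /\ h z = (w0 + RtoC rho * ((X w0 / RtoC (Cmod (X w0))) * cunit b))%C.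

Lemma forward_in_range : exists t1, 0 < t1 /\ forall t, 0 < t < t1 -> exists z, udisc z /\ h z = sh t w0.
Proof.
  destruct (shift_polar phi tau h sh X w0 M v_neq) as [K [d [HK [Hd H]]]].
  destruct (om_0 1 Rlt_0_1) as [d1 [Hd1 Hom]].
  assert (Pv : 0 < Cmod (X w0)) by (apply Cmod_gt_0; auto).
  set (m := Rmin d1 e0 / (2 * Cmod (X w0))).
  assert (Pm : 0 < m) by (apply Rdiv_lt_0_compat; [apply Rmin_glb_lt; auto|lra]).
  exists (Rmin d m). split; [apply Rmin_glb_lt; auto|].
  intros t Ht. assert (L1 := Rmin_l d m). assert (L2 := Rmin_r d m).
  destruct (H t ltac:(lra)) as [Kt [[A1 A2] [_ [s [Hs Es]]]]].
  assert (L3 := Rmin_l d1 e0). assert (L4 := Rmin_r d1 e0).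
  assert (R0 : Cmod (X w0) * t < Rmin d1 e0 / 2).
  { replace (Rmin d1 e0 / 2) with (Cmod (X w0) * m) by (unfold m; field; lra). apply Rmult_lt_compat_l; lra. }
  assert (Pvt : 0 < Cmod (X w0) * t) by nra.
  set (rho := Cmod (sh t w0 - w0)) in *.
  assert (R1 : 0 < rho < Rmin d1 e0) by (split; nra).
  destruct (sector rho s ltac:(lra)) as [z [Uz Ez]].
  - specialize (Hom rho ltac:(lra)). assert (PI2 := PI2_3_2). lra.
  - exists z. split; auto. rewrite Ez, <- Es. ring.
Qed.

(** Squaring doubles the argument: the total angle is at most 2 K t + pi - (1 - q) < pi - om r. The
    modulus is at most 4 |sh t w0 - w0| / (1 - q)^2 <= r, and om is monotone. *)
Lemma koebe_in_sector (t q r K s : R) : 0 < t -> 0 <= q < 1 -> 0 < r < e0 ->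
  0 < Cmod (sh t w0 - w0) -> Cmod (sh t w0 - w0) * 4 <= r * ((1 - q) * (1 - q)) ->
  Rabs s <= 2 * (K * t) ->
  (sh t w0 - w0 = RtoC (Cmod (sh t w0 - w0)) * (X w0 / RtoC (Cmod (X w0)) * cunit s))%C ->
  om r + 2 * (K * t) < 1 - q ->
  forall e, udisc e -> exists z, udisc z /\
     h z = (w0 + (sh t w0 - w0) * (koebe_half q e * koebe_half q e))%C.
Proof.
  intros Ht Hq Hr Pw Hw Hs Es Hom e He.
  destruct (koebe_half_bounds q e Hq He) as [G1 [G2 G3]].
  set (g := koebe_half q e) in *.
  destruct (polar_right g G1) as [a [Ea [Ha1 [Ha2 _]]]].
  assert (Pg : 0 < Cmod g). { assert (Y := re_le_Cmod g). rewrite Rabs_right in Y by lra. lra. }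
  set (d := Cmod (sh t w0 - w0)) in *.
  set (rho := d * (Cmod g * Cmod g)).
  assert (P1q : 0 < (1 - q) * (1 - q)) by nra.
  assert (R0 : 0 < rho) by (unfold rho; apply Rmult_lt_0_compat; nra).
  assert (R1 : rho <= r).
  { apply Rmult_le_reg_r with ((1 - q) * (1 - q)); auto.
    assert (Q : Cmod g * (1 - q) * (Cmod g * (1 - q)) <= 2 * 2) by (apply Rmult_le_compat; nra).
    unfold rho. nra. }
  destruct (sector rho (s + (a + a))) as [z [Uz Ez]].
  - lra.
  - assert (O := om_mono rho r ltac:(lra)).
    assert (T1 := Rabs_triang s (a + a)). assert (T2 := Rabs_triang a a). lra.
  - exists z. split; auto. rewrite Ez. f_equal. rewrite Es at 1. rewrite Ea at 1 2.
    rewrite !cunit_plus. unfold rho. rewrite !RtoC_mult. ring.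
Qed.

(** [G_orb_bound] is used with a q adapted to the dyadic scale of t, and bounds the derivative of ln
    (1 - |Z t|^2) in the form that [dini_lower_bound] integrates. *)
Lemma orb_lower (t1 : R) : 0 < t1 -> (forall t, 0 < t < t1 -> exists z, udisc z /\ h z = sh t w0) ->
  exists c t3, 0 < c /\ 0 < t3 <= t1 /\ forall t, 0 < t < t3 ->
    c * t <= (1 - sqmod (orb h sh w0 t)) * (1 - sqmod (orb h sh w0 t)).
Proof.
  intros Ht1 Hfw. set (Z := orb h sh w0).
  destruct (shift_polar phi tau h sh X w0 M v_neq) as [K [d [HK [Hd H]]]].
  destruct (om_0 (1/8) ltac:(lra)) as [d1 [Hd1 Hom]].
  destruct (dini_sum om e0 B e0_pos om_pos om_mono om_int) as [k0 [J [HJ HomJ]]].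
  assert (Pv : 0 < Cmod (X w0)) by (apply Cmod_gt_0; auto). set (V := Cmod (X w0)) in *.
  (* The bounds 1 / (8 V) and 1 / (4 K) let one spare factor a absorb the constants V and K. *)
  set (a0 := Rmin (Rmin (Rmin d t1) (Rmin d1 e0)) (Rmin (1/8) (Rmin (/ (8 * V)) (/ (4 * K))))).
  assert (Pa0 : 0 < a0).
  { unfold a0. repeat apply Rmin_glb_lt; auto; try lra; apply Rinv_0_lt_compat; lra. }
  assert (La0 : a0 <= d /\ a0 <= t1 /\ a0 <= d1 /\ a0 <= e0 /\ a0 <= 1 / 8 /\ a0 <= / (8 * V) /\ a0 <= / (4 * K)).
  { unfold a0. repeat split.
    - eapply Rle_trans; [apply Rmin_l|]. eapply Rle_trans; [apply Rmin_l|]. apply Rmin_l.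
    - eapply Rle_trans; [apply Rmin_l|]. eapply Rle_trans; [apply Rmin_l|]. apply Rmin_r.
    - eapply Rle_trans; [apply Rmin_l|]. eapply Rle_trans; [apply Rmin_r|]. apply Rmin_l.
    - eapply Rle_trans; [apply Rmin_l|]. eapply Rle_trans; [apply Rmin_r|]. apply Rmin_r.
    - eapply Rle_trans; [apply Rmin_r|]. apply Rmin_l.
    - eapply Rle_trans; [apply Rmin_r|]. eapply Rle_trans; [apply Rmin_r|]. apply Rmin_l.
    - eapply Rle_trans; [apply Rmin_r|]. eapply Rle_trans; [apply Rmin_r|]. apply Rmin_r. }
  destruct La0 as (A1 & A2 & A3 & A4 & A5 & A6 & A7).
  destruct (pow_lt_1_zero (/ 2) ltac:(rewrite Rabs_right; lra) a0 Pa0) as [k2 Hk2].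
  set (k1 := max k0 k2).
  assert (Small : forall k, (k1 <= k)%nat -> 0 < (/ 2) ^ (S k) < a0).
  { intros k Hk. assert (P : 0 < (/ 2) ^ (S k)) by (apply pow_lt; lra).
    specialize (Hk2 (S k) ltac:(unfold k1 in Hk; lia)). rewrite Rabs_right in Hk2 by lra. lra. }
  assert (Four : forall a, 0 < a < a0 -> a ^ 4 <= a * a * a /\ a ^ 4 < a0 /\ 0 < a ^ 4).
  { intros a Ha. assert (a * a <= a) by nra. assert (0 < a * a) by nra. assert (0 < a * a * a) by nra.
    replace (a ^ 4) with (a * (a * a * a)) by ring. repeat split; nra. }
  assert (UZ : forall t, 0 < t < t1 -> 0 < 1 - sqmod (Z t)).
  { intros t Ht. assert (U := proj1 (finv_spec h _ (Hfw t Ht))). apply udisc_sqmod in U. unfold Z, orb. lra. }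
  set (dZ := fun t => - (2 * (fst (Z t) * fst (G (Z t)) + snd (Z t) * snd (G (Z t)))) / (1 - sqmod (Z t))).
  assert (DZ : forall t, 0 < t < t1 -> is_derive (fun t => ln (1 - sqmod (Z t))) t (dZ t)).
  { intros t Ht.
    destruct (orb_deriv phi G tau gen_0 h sh X M w0 t1 Hfw t Ht) as [D1 D2].
    fold Z in D1, D2. specialize (UZ t Ht).
    exact (is_derive_ln_depth (fun s => fst (Z s)) (fun s => snd (Z s)) t _ _ D1 D2 UZ). }
  destruct (dini_lower_bound (fun t => ln (1 - sqmod (Z t))) dZ om J B (4 * K) k1) as [Cst HC].
  - lra.
  - auto.
  - intros t Ht. apply DZ. destruct (Four _ (Small k1 (Nat.le_refl _))) as [_ [F _]]. lra.
  - intros k t Hk Ht. set (a := (/ 2) ^ S k) in *. assert (Ha := Small k Hk). fold a in Ha.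
    destruct (Four a Ha) as [F1 [F2 F3]].
    assert (t0 : 0 < t). { eapply Rlt_le_trans; [|apply Ht]. apply pow_lt, pow_lt. lra. }
    assert (tt : 0 < t < t1) by lra.
    destruct (H t ltac:(lra)) as [Kt [[W1 W2] [W3 [s [Hs Es]]]]].
    assert (Oa := Hom a ltac:(lra)). assert (Oa0 := om_pos a ltac:(lra)).
    (* The angle 1 - q left beside the slit is shared: om a for the boundary, a for the rotation 2 K
       t of sh t w0 - w0. *)
    set (de := om a + a). set (q := 1 - de).
    assert (Hq : 1 / 2 <= q < 1) by (unfold q, de; lra).
    assert (KV : 8 * V * a <= 1).
    { apply Rle_trans with (8 * V * / (8 * V)); [apply Rmult_le_compat_l; lra|right; field; lra]. }
    assert (KK : 4 * K * a <= 1).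
    { apply Rle_trans with (4 * K * / (4 * K)); [apply Rmult_le_compat_l; lra|right; field; lra]. }
    assert (taaa : t <= a * a * a) by lra.
    assert (aa : 0 < a * a) by nra.
    assert (Kta : 2 * (K * t) < a).
    { assert (K * t <= K * (a * a * a)) by (apply Rmult_le_compat_l; lra).
      assert (K * a * (a * a) <= 1 / 4 * (a * a)) by (apply Rmult_le_compat_r; lra). nra. }
    set (wd := Cmod (sh t w0 - w0)) in *.
    assert (Wd0 : 0 < V * t) by nra.
    assert (Wlo : V * t * (3 / 4) <= wd) by nra.
    assert (Whi : wd <= V * t * 2) by nra.
    assert (GB := G_orb_bound phi G tau gen_0 h sh X M w0 t1 Hfw t q tt ltac:(lra)).
    fold wd Z in GB.
    (* The image fits within radius a because 4 wd <= 8 V t <= 8 V a^4 <= a^3 <= a de^2. *)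
    assert (Psi : forall e, udisc e -> exists z, udisc z /\ h z = (w0 + (sh t w0 - w0) * (koebe_half q e * koebe_half q e))%C).
    { apply (koebe_in_sector t q a K s); auto; try lra.
      - fold wd. lra.
      - fold wd. replace (1 - q) with de by (unfold q; ring).
        assert (a * a <= de * de) by (apply Rmult_le_compat; unfold de; lra).
        assert (ta : t <= a * (a * a * a)) by (replace (a * (a * a * a)) with (a ^ 4) by ring; lra).
        assert (V * t <= V * (a * (a * a * a))) by (apply Rmult_le_compat_l; lra).
        assert (0 < a * a * a) by nra.
        assert (8 * V * a * (a * a * a) <= 1 * (a * a * a)) by (apply Rmult_le_compat_r; lra).
        assert (a * (a * a) <= a * (de * de)) by (apply Rmult_le_compat_l; lra).
        lra.
      - unfold q, de. lra. }
    specialize (GB Psi). specialize (UZ t tt).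
    set (D := 1 - sqmod (Z t)) in *.
    set (g := Cmod (G (Z t))) in *.
    assert (Pg : 0 <= g) by apply Cmod_ge_0.
    assert (Dz : dZ t <= 2 * g / D).
    { unfold dZ. fold D. apply Rmult_le_compat_r; [left; apply Rinv_0_lt_compat; auto|].
      assert (Y := dot_le_Cmod (- Z t)%C (G (Z t))). rewrite Cmod_opp in Y. simpl in Y. fold g in Y.
      assert (Cmod (Z t) <= 1).
      { assert (U := proj1 (finv_spec h _ (Hfw t tt))). unfold udisc in U. unfold Z, orb. lra. }
      assert (Cmod (Z t) * g <= 1 * g) by (apply Rmult_le_compat_r; lra). lra. }
    eapply Rle_trans; [exact Dz|].
    assert (G1 : 4 * q * (V * t * (1 - K * t)) * g <= D * (V * (1 + K * t))).
    { apply Rle_trans with (4 * q * wd * g).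
      - apply Rmult_le_compat_r; auto. apply Rmult_le_compat_l; lra.
      - eapply Rle_trans; [exact GB|]. apply Rmult_le_compat_l; lra. }
    assert (G2 : 4 * q * t * (1 - K * t) * g <= D * (1 + K * t)).
    { apply Rmult_le_reg_l with V; auto. lra. }
    set (x := K * t) in *. assert (Px : 0 < x) by (unfold x; nra).
    (* These replace 1 / q by 1 + 2 de and (1 + x) / (1 - x) by 1 + 4 x, so that the coefficient of
       1 / t becomes 1/2 + de and the rest is at most 4 K. *)
    assert (Q1 : 1 <= q * (1 + 2 * de)) by (unfold q; assert (de <= 1/2) by (unfold de; lra); assert (0 <= de) by (unfold de; lra); nra).
    assert (Q2 : 1 + x <= (1 - x) * (1 + 4 * x)) by nra.
    assert (G3 : 2 * t * g <= D * ((1 / 2 + de) * (1 + 4 * x))).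
    { assert (P1 : 0 < q * (1 - x)) by nra.
      apply Rmult_le_reg_l with (2 * (q * (1 - x))); [lra|].
      apply Rle_trans with (D * (1 + x)); [lra|].
      apply Rle_trans with (D * ((1 - x) * (1 + 4 * x))); [apply Rmult_le_compat_l; lra|].
      assert (0 <= D * ((1 - x) * (1 + 4 * x))) by (apply Rmult_le_pos; nra). nra. }
    apply Rmult_le_reg_r with (D * t); [nra|].
    replace (2 * g / D * (D * t)) with (2 * t * g) by (field; lra).
    replace (((1 / 2 + de) / t + 4 * K) * (D * t)) with (D * ((1 / 2 + de) + 4 * x)) by (unfold x; field; lra).
    eapply Rle_trans; [exact G3|]. apply Rmult_le_compat_l; [lra|].
    assert (de <= 1 / 2) by (unfold de; lra). nra.
  - intros k Hk. apply HJ. unfold k1 in Hk. lia.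
  - intros k Hk. apply HomJ. unfold k1 in Hk. lia.
  - set (T := ((/ 2) ^ S k1) ^ 4) in *.
    destruct (Four _ (Small k1 (Nat.le_refl _))) as [_ [F PT]]. fold T in F, PT.
    (* Twice the inequality ln t / 2 - Cst <= ln D, exponentiated. *)
    exists (exp (- (2 * Cst))), T. split; [apply exp_pos|split; [lra|]].
    intros t Ht. specialize (HC t ltac:(lra)). cbv beta in HC. specialize (UZ t ltac:(lra)).
    set (D := 1 - sqmod (Z t)) in *.
    rewrite <- (exp_ln t) by lra. rewrite <- exp_plus.
    rewrite <- (exp_ln D UZ), <- exp_plus.
    destruct (Req_dec (- (2 * Cst) + ln t) (ln D + ln D)) as [E|N]; [rewrite E; lra|].
    left. apply exp_increasing. lra.
Qed.

End lower.

(** * The Julia-Wolff-Caratheodory limit *)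

Lemma cayley_Re (e : C) : udisc e -> (1 - e <> 0)%C /\ 0 < 1 - sqmod e /\ 0 < sqmod (1 - e)%C /\
  Re ((1 + e) / (1 - e)) = (1 - sqmod e) / sqmod (1 - e)%C.
Proof.
  intros He. assert (P := proj1 (udisc_sqmod _) He).
  assert (N : (1 - e <> 0)%C).
  { intros E. unfold udisc in He. replace e with (RtoC 1) in He; [rewrite Cmod_1 in He; lra|].
    rewrite <- (Cplus_0_l e), <- E. ring. }
  assert (Q := sqmod_gt_0 _ N).
  split; [auto|split; [lra|split; [auto|]]].
  unfold sqmod, Re, Cdiv, Cinv, Cmult in *; simpl in *. field. nra.
Qed.

(** c is the infimum of Re f over the Poisson kernel k at 1. Subtracting c (1 + e) / (1 - e) leaves
    a function Q with Re Q >= 0 and infimum 0. A point e0 where Re Q is a tiny multiple of k,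
    compared with e by half-plane Schwarz-Pick, makes Q e (1 - e) small in Stolz regions; the
    subtracted term contributes 2 c. *)
Lemma julia_wolff (f : C -> C) : holo udisc f -> (forall e, udisc e -> 0 <= Re (f e)) ->
  exists c, 0 <= c /\ forall K eps, 1 <= K -> 0 < eps -> exists d, 0 < d /\
    forall e, udisc e -> Cmod (1 - e) <= K * (1 - sqmod e) -> Cmod (1 - e) < d ->
      Cmod (f e * (1 - e) - RtoC (2 * c)) < eps.
Proof.
  intros Hf Hp.
  (* The sign turns the infimum into the supremum that [completeness] provides. *)
  set (E := fun r => exists e, udisc e /\ r = - (Re (f e) * (sqmod (1 - e)%C / (1 - sqmod e)))).
  assert (U0 : udisc 0%C) by (unfold udisc; rewrite Cmod_0; lra).
  destruct (completeness E) as [m [Hub Hlub]].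
  - exists 0. intros r [e [He ->]]. destruct (cayley_Re e He) as [_ [P1 [P2 _]]].
    assert (0 <= Re (f e) * (sqmod (1 - e)%C / (1 - sqmod e))); [|lra].
    apply Rmult_le_pos; auto. left. apply Rdiv_lt_0_compat; auto.
  - exists (- (Re (f 0%C) * (sqmod (1 - 0)%C / (1 - sqmod 0)))), 0%C. split; auto.
  - set (c := - m).
    assert (c0 : 0 <= c).
    { assert (m <= 0); [|unfold c; lra]. apply Hlub. intros r [e [He ->]]. destruct (cayley_Re e He) as [_ [P1 [P2 _]]].
      assert (0 <= Re (f e) * (sqmod (1 - e)%C / (1 - sqmod e))); [|lra].
      apply Rmult_le_pos; auto. left. apply Rdiv_lt_0_compat; auto. }
    set (k := fun e => (1 - sqmod e) / sqmod (1 - e)%C).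
    assert (Pk : forall e, udisc e -> 0 < k e).
    { intros e He. destruct (cayley_Re e He) as [_ [P1 [P2 _]]]. apply Rdiv_lt_0_compat; auto. }
    assert (Low : forall e, udisc e -> c * k e <= Re (f e)).
    { intros e He. destruct (cayley_Re e He) as [_ [P1 [P2 _]]].
      assert (X : - (Re (f e) * (sqmod (1 - e)%C / (1 - sqmod e))) <= m) by (apply Hub; exists e; auto).
      apply Rmult_le_reg_r with (sqmod (1 - e)%C / (1 - sqmod e)); [apply Rdiv_lt_0_compat; auto|].
      unfold k. replace (c * ((1 - sqmod e) / sqmod (1 - e)%C) * (sqmod (1 - e)%C / (1 - sqmod e))) with c by (field; lra).
      unfold c. lra. }
    assert (Near : forall x, 0 < x -> exists e, udisc e /\ Re (f e) < (c + x) * k e).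
    { intros x Hx. apply NNPP. intros N.
      assert (m <= m - x); [|lra]. apply Hlub. intros r [e [He ->]].
      destruct (cayley_Re e He) as [_ [P1 [P2 _]]].
      assert (Y : (c + x) * k e <= Re (f e)) by (apply Rnot_lt_le; intros L; apply N; eauto).
      apply Rmult_le_compat_r with (r := sqmod (1 - e)%C / (1 - sqmod e)) in Y; [|left; apply Rdiv_lt_0_compat; auto].
      unfold k in Y. replace ((c + x) * ((1 - sqmod e) / sqmod (1 - e)%C) * (sqmod (1 - e)%C / (1 - sqmod e))) with (c + x) in Y by (field; lra).
      unfold c in Y. lra. }
    set (Q := fun e => (f e - RtoC c * ((1 + e) / (1 - e)))%C).
    assert (HQ : holo udisc Q).
    { intros e He. destruct (Hf e He) as [l Hl]. destruct (cayley_Re e He) as [N _]. eexists.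
      apply cderiv_minus; [exact Hl|]. apply cderiv_scal.
      apply (cderiv_div (fun e => 1 + e)%C (fun e => 1 - e)%C); auto.
      - apply cderiv_plus; [apply cderiv_const|apply cderiv_id].
      - apply cderiv_minus; [apply cderiv_const|apply cderiv_id]. }
    assert (ReQ : forall e, udisc e -> Re (Q e) = Re (f e) - c * k e).
    { intros e He. destruct (cayley_Re e He) as [_ [_ [_ ER]]]. unfold Q, k. rewrite <- ER.
      unfold Cminus. rewrite re_plus, re_opp, re_scal_l. ring. }
    assert (PQ : forall e, udisc e -> 0 <= Re (Q e)).
    { intros e He. rewrite ReQ by auto. specialize (Low e He). lra. }
    exists c. split; auto. intros K eps HK He.
    (* Chosen so that kap = 16 K x = eps / 12: the error is at most 2 kap + x + eps / 2 with x <=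
       kap. *)
    set (x := eps / (4 * (16 * K) * 3)).
    assert (Px : 0 < x) by (unfold x; apply Rdiv_lt_0_compat; lra).
    destruct (Near x Px) as [e0 [U1 N0]].
    destruct (cayley_Re e0 U1) as [Ne0 [D0 [S0 _]]].
    assert (RQ0 : Re (Q e0) <= x * k e0) by (rewrite ReQ by auto; lra).
    assert (Pq0 := Cmod_ge_0 (Q e0)).
    set (y0 := Cmod (1 - e0)). assert (Py0 : 0 < y0) by (apply Cmod_gt_0; auto).
    exists (Rmin y0 (Rmin (x / (Cmod (Q e0) + 1)) (eps / (2 * (c + 1))))). split.
    { repeat apply Rmin_glb_lt; auto; apply Rdiv_lt_0_compat; lra. }
    intros e Ue Hst Hd. set (y := Cmod (1 - e)) in *.
    assert (L1 := Rmin_l y0 (Rmin (x / (Cmod (Q e0) + 1)) (eps / (2 * (c + 1))))).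
    assert (L2 := Rmin_r y0 (Rmin (x / (Cmod (Q e0) + 1)) (eps / (2 * (c + 1))))).
    assert (L3 := Rmin_l (x / (Cmod (Q e0) + 1)) (eps / (2 * (c + 1)))).
    assert (L4 := Rmin_r (x / (Cmod (Q e0) + 1)) (eps / (2 * (c + 1)))).
    destruct (cayley_Re e Ue) as [Ne [D1 [S1 _]]].
    assert (Py : 0 < y) by (apply Cmod_gt_0; auto).
    assert (SP := schwarz_pick_halfplane Q e0 e HQ PQ U1 Ue).
    rewrite <- !sqmod_Cmod in SP.
    set (A := Cmod (Q e - Q e0)). assert (PA : 0 <= A) by apply Cmod_ge_0.
    rewrite (sqmod_Cmod (Q e - Q e0)%C) in SP. fold A in SP.
    (* As e is nearer to 1 than e0 is, |e - e0| <= 2 y0, and y0^2 cancels against the denominator of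
       k e0; the estimate becomes uniform in e0. *)
    assert (Dist : sqmod (e - e0)%C <= 4 * (y0 * y0)).
    { rewrite sqmod_Cmod.
      assert (T := Cmod_minus_le (1 - e0) (1 - e)).
      replace (1 - e0 - (1 - e))%C with (e - e0)%C in T by ring. fold y0 y in T.
      assert (P := Cmod_ge_0 (e - e0)).
      assert (Cmod (e - e0) * Cmod (e - e0) <= (2 * y0) * (2 * y0)) by (apply Rmult_le_compat; lra). lra. }
    assert (ReA : Re (Q e) <= A + Cmod (Q e0)).
    { eapply Rle_trans; [apply Rle_abs|]. eapply Rle_trans; [apply re_le_Cmod|].
      assert (T := Cmod_triangle_inv (Q e) (Q e0)). fold A in T. lra. }
    assert (PRe := PQ e Ue). assert (PRe0 := PQ e0 U1).
    assert (k0E : k e0 * (y0 * y0) = 1 - sqmod e0).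
    { unfold k, y0. rewrite <- sqmod_Cmod. field. lra. }
    assert (B1 : A * A * (1 - sqmod e) <= 16 * x * (A + Cmod (Q e0))).
    { apply Rmult_le_reg_r with (1 - sqmod e0); auto.
      apply Rle_trans with (4 * sqmod (e - e0)%C * (Re (Q e) * Re (Q e0))); [lra|].
      assert (M1 : Re (Q e) * Re (Q e0) <= (A + Cmod (Q e0)) * (x * k e0)) by (apply Rmult_le_compat; auto).
      assert (P1 : 0 <= (A + Cmod (Q e0)) * (x * k e0)) by (eapply Rle_trans; [|exact M1]; apply Rmult_le_pos; auto).
      assert (P2 := sqmod_pos (e - e0)%C).
      apply Rle_trans with (4 * (4 * (y0 * y0)) * ((A + Cmod (Q e0)) * (x * k e0))).
      - apply Rmult_le_compat; try lra. apply Rmult_le_pos; auto.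
      - rewrite <- k0E. right. ring. }
    set (q0 := Cmod (Q e0)) in *.
    assert (yq : y * q0 <= x).
    { apply Rle_trans with (x / (q0 + 1) * (q0 + 1)); [apply Rmult_le_compat; lra|right; field; lra]. }
    set (T := A * y). assert (PT : 0 <= T) by (apply Rmult_le_pos; lra).
    (* Since y <= K (1 - |e|^2), multiplying [B1] by K y gives a quadratic inequality in T = A y,
       which forces T <= 2 kap. *)
    assert (B2 : T * T <= 16 * K * x * (T + x)).
    { assert (B3 : A * A * y <= K * (16 * x * (A + q0))).
      { apply Rle_trans with (A * A * (K * (1 - sqmod e))); [apply Rmult_le_compat_l; nra|].
        replace (A * A * (K * (1 - sqmod e))) with (K * (A * A * (1 - sqmod e))) by ring.
        apply Rmult_le_compat_l; lra. }
      apply Rmult_le_compat_r with (r := y) in B3; [|lra].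
      apply Rle_trans with (16 * K * x * (T + y * q0)); [unfold T; lra|].
      apply Rmult_le_compat_l; [|lra]. apply Rmult_le_pos; lra. }
    set (kap := 16 * K * x) in *.
    assert (xk : x <= kap) by (unfold kap; nra).
    assert (B4 : T <= 2 * kap).
    { apply Rnot_lt_le. intros L. assert (0 < kap) by lra.
      assert (kap * (T + x) <= kap * (T + kap)) by (apply Rmult_le_compat_l; lra). nra. }
    assert (Ek : 12 * kap = eps) by (unfold kap, x; field; lra).
    replace (f e * (1 - e) - RtoC (2 * c))%C with ((Q e - Q e0) * (1 - e) + Q e0 * (1 - e) + - (RtoC c * (1 - e)))%C.
    2:{ unfold Q at 1. rewrite RtoC_mult. unfold Q. field. split; auto. }
    eapply Rle_lt_trans; [apply Cmod_triangle|].
    eapply Rle_lt_trans; [apply Rplus_le_compat_r, Cmod_triangle|].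
    rewrite Cmod_opp, !Cmod_mult, Cmod_R, (Rabs_right c) by lra. fold y A q0. fold T.
    assert (cy : c * y <= eps / 2).
    { apply Rle_trans with ((c + 1) * (eps / (2 * (c + 1)))); [apply Rmult_le_compat; lra|right; field; lra]. }
    lra.
Qed.

(** e is the coordinate of z in the disc of radius R0 internally tangent at x. With u = 1 - z / x
    and d = |u|, R0^2 (1 - |e|^2) = 2 R0 Re u - d^2, and the Stolz condition bounds Re u below by a
    multiple of d; d <= R0 / (2 K) makes d^2 harmless. *)
Lemma pseudo_stolz (x z : C) (K R0 : R) : Cmod x = 1 -> 0 < R0 <= 1/2 -> 1 <= K ->
  in_stolz x K z -> Cmod (x - z) <= R0 / (2 * K) ->
  let e := ((z - RtoC (1 - R0) * x) / (RtoC R0 * x))%C in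
  udisc e /\ (z = RtoC (1 - R0) * x + RtoC R0 * x * e)%C /\
  (1 - e = (x - z) / (RtoC R0 * x))%C /\ Cmod (1 - e) <= 2 * K * (1 - sqmod e).
Proof.
  intros Hx HR HK [Uz Sz] Hn e. rewrite !Cnorm_Cmod, Csub_Cminus in Sz. unfold inD in Uz. rewrite Cnorm_Cmod in Uz.
  assert (xn : x <> 0%C) by (intros E; rewrite E, Cmod_0 in Hx; lra).
  assert (rn : RtoC R0 <> 0%C) by (intros E; injection E; lra).
  assert (Pm : Cmod (RtoC R0 * x) = R0) by (rewrite Cmod_mult, Hx, Cmod_R, Rabs_right; lra).
  assert (E1 : (1 - e = (x - z) / (RtoC R0 * x))%C).
  { unfold e. rewrite RtoC_minus. field. split; auto. }
  assert (E2 : (z = RtoC (1 - R0) * x + RtoC R0 * x * e)%C) by (unfold e; field; split; auto).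
  set (u := ((x - z) / x)%C).
  assert (Mu : Cmod u = Cmod (x - z)) by (unfold u; rewrite Cmod_div, Hx by auto; field).
  assert (Ez : (z = x * (1 - u))%C) by (unfold u; field; auto).
  assert (Ee : (e = 1 - u / RtoC R0)%C) by (unfold e, u; rewrite RtoC_minus; field; split; auto).
  assert (Pz := Cmod_ge_0 z).
  assert (Sz2 : Cmod z * Cmod z = (1 - fst u) * (1 - fst u) + snd u * snd u).
  { rewrite Ez, Cmod_mult, Hx, Rmult_1_l, Cmod_sqr. simpl. ring. }
  assert (Su := Cmod_sqr u). rewrite Mu in Su.
  set (d := Cmod (x - z)) in *. assert (Pd := Cmod_ge_0 (x - z)). fold d in Pd.
  assert (Se : R0 * R0 * (1 - sqmod e) = 2 * R0 * fst u - d * d).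
  { assert (Gen : forall u : C, R0 * R0 * (1 - sqmod (1 - u / RtoC R0)%C) = 2 * R0 * fst u - (fst u * fst u + snd u * snd u)).
    { clear - HR. intros u. unfold sqmod, Cdiv. rewrite <- RtoC_inv by lra. simpl. field. lra. }
    rewrite Ee, Su. apply Gen. }
  assert (D1 : d <= K * (2 * fst u - d * d)).
  { eapply Rle_trans; [exact Sz|]. apply Rmult_le_compat_l; [lra|].
    assert (1 - Cmod z <= 1 - Cmod z * Cmod z) by nra. lra. }
  assert (DR : d * (2 * K) <= R0).
  { apply Rmult_le_compat_r with (r := 2 * K) in Hn; [|lra].
    replace (R0 / (2 * K) * (2 * K)) with R0 in Hn by (field; lra). auto. }
  assert (Main : d * R0 <= 2 * K * (R0 * R0 * (1 - sqmod e))).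
  { rewrite Se.
    assert (R0 * d <= R0 * (K * (2 * fst u - d * d))) by (apply Rmult_le_compat_l; lra).
    assert (d * (2 * K) * d <= R0 * d) by (apply Rmult_le_compat_r; lra).
    assert (0 <= R0 * K * (d * d)) by (repeat apply Rmult_le_pos; lra).
    lra. }
  assert (dpos : 0 < d).
  { destruct Pd as [|E]; auto. exfalso. assert (Cmod z = 1); [|lra].
    assert (F : (x - z = 0)%C) by (apply Cmod_eq_0; unfold d in E; auto).
    replace z with x; auto. rewrite <- (Cplus_0_l z), <- F. ring. }
  assert (RR : 0 < R0 * R0) by nra.
  assert (Pse : 0 < 1 - sqmod e).
  { apply Rmult_lt_reg_l with (2 * K * (R0 * R0)); [nra|]. assert (0 < d * R0) by nra. lra. }
  split; [apply udisc_sqmod; lra|]. split; auto. split; auto.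
  rewrite E1, Cmod_div, Pm by (apply Cmult_neq_0; auto). fold d.
  apply Rmult_le_reg_r with (R0 * R0); auto.
  replace (d / R0 * (R0 * R0)) with (d * R0) by (field; lra). lra.
Qed.

(** * Angular limit of the generator at x and its positivity *)

Section final.
Variables (phi : R -> C -> C) (G : C -> C) (tau : C).
Hypothesis phi_holo : forall t, 0 <= t -> holo udisc (phi t).
Hypothesis phi_disc : forall t z, 0 <= t -> udisc z -> udisc (phi t z).
Hypothesis phi_add : forall s t z, 0 <= s -> 0 <= t -> udisc z -> phi (s + t) z = phi s (phi t z).
Hypothesis phi_0 : forall z, udisc z -> phi 0 z = z.
Hypothesis G_holo : holo udisc G.
Hypothesis gen_0 : forall z eps, udisc z -> 0 < eps -> exists d, 0 < d /\
  forall s, 0 < s < d -> Cmod (phi s z - z - RtoC s * G z) <= eps * s.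
Hypothesis gen_t : forall z t, udisc z -> 0 < t -> curve_deriv (fun s => phi s z) t (G (phi t z)).
Hypothesis tau_le : Cmod tau <= 1.
Hypothesis dw : forall z eps, udisc z -> 0 < eps -> exists T, forall t, T <= t -> Cmod (phi t z - tau) < eps.

Lemma annulus_radius : exists R0, 0 < R0 <= 1 / 2 /\ forall z, 1 - 2 * R0 < Cmod z < 1 -> z <> tau.
Proof.
  destruct tau_le as [L|E].
  - exists ((1 - Cmod tau) / 2). assert (P := Cmod_ge_0 tau). split; [lra|].
    intros z Hz Ez. rewrite Ez in Hz. lra.
  - exists (1 / 2). split; [lra|]. intros z Hz Ez. rewrite Ez in Hz. lra.
Qed.

(** p may be undefined at tau, so Julia-Wolff is applied in a disc internally tangent at x that
    avoids tau. There G z (x - z) = cfac z * p z (1 - e) R0 x, with [cfac] continuous at x. The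
    limit may still be 0. *)
Lemma generator_angular_limit (x : C) : Cmod x = 1 -> x <> tau ->
  exists L, 0 <= L /\ forall K eps, 0 < eps -> exists d, 0 < d /\
    forall z, in_stolz x K z -> Cmod (z - x) < d -> Rabs (Cmod (G z * (x - z)) - L) < eps.
Proof.
  intros Hx Nx. destruct annulus_radius as [R0 [HR Hann]].
  assert (xn : x <> 0%C) by (intros E; rewrite E, Cmod_0 in Hx; lra).
  assert (rn : RtoC R0 <> 0%C) by (intros E; injection E; lra).
  set (ctr := fun e => (RtoC (1 - R0) * x + RtoC R0 * x * e)%C).
  assert (Ain : forall e, udisc e -> 1 - 2 * R0 < Cmod (ctr e) < 1).
  { intros e He. apply (disc_in_annulus R0 HR x); auto. unfold ctr.
    replace (RtoC (1 - R0) * x + RtoC R0 * x * e - RtoC (1 - R0) * x)%C with (RtoC R0 * x * e)%C by ring.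
    rewrite !Cmod_mult, Hx, Cmod_R, Rabs_right by lra. unfold udisc in He. nra. }
  destruct (julia_wolff (fun e => pgen G tau (ctr e))) as [c [c0 Hc]].
  - intros e He. specialize (Ain e He). assert (U : udisc (ctr e)) by (unfold udisc; lra).
    destruct (G_holo _ U) as [l Hl]. eexists.
    apply (cderiv_comp ctr (pgen G tau)).
    + unfold ctr. apply cderiv_plus; [apply cderiv_const|apply cderiv_scal, cderiv_id].
    + unfold pgen. apply (cderiv_div G (cfac tau)).
      * exact Hl.
      * unfold cfac. apply (cderiv_mult (fun z => tau - z)%C (fun z => 1 - Cconj tau * z)%C).
        -- apply cderiv_minus; [apply cderiv_const|apply cderiv_id].
        -- apply cderiv_minus; [apply cderiv_const|apply cderiv_scal, cderiv_id].
      * apply cfac_neq_0; auto.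
  - intros e He. specialize (Ain e He).
    apply (pgen_pos phi G tau phi_holo phi_disc phi_add phi_0 gen_0 tau_le dw); [unfold udisc; lra|auto].
  - set (l := (RtoC (2 * c) * (RtoC R0 * x))%C).
    set (L := Cmod (cfac tau x * l)).
    exists L. split; [apply Cmod_ge_0|]. intros K0 eps He.
    set (K := Rmax 1 K0). assert (K1 : 1 <= K) by apply Rmax_l.
    assert (KK : K0 <= K) by apply Rmax_r.
    assert (Pl := Cmod_ge_0 l). assert (Pc := Cmod_ge_0 (cfac tau x)).
    assert (He1 : 0 < eps / 16) by lra.
    destruct (Hc (2 * K) (eps / 16) ltac:(lra) He1) as [d1 [Hd1 H1]].
    assert (Cc : ccont (cfac tau) x).
    { eapply cderiv_ccont. unfold cfac. apply (cderiv_mult (fun z => tau - z)%C (fun z => 1 - Cconj tau * z)%C).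
      - apply cderiv_minus; [apply cderiv_const|apply cderiv_id].
      - apply cderiv_minus; [apply cderiv_const|apply cderiv_scal, cderiv_id]. }
    destruct (Cc (eps / (4 * (Cmod l + 1)))) as [d2 [Hd2 H2]]; [apply Rdiv_lt_0_compat; lra|].
    assert (P3 : 0 < R0 / (2 * K)) by (apply Rdiv_lt_0_compat; lra).
    assert (P4 : 0 < R0 * d1) by (apply Rmult_lt_0_compat; lra).
    exists (Rmin (Rmin d2 (R0 / (2 * K))) (R0 * d1)). split; [repeat apply Rmin_glb_lt; auto|].
    intros z Sz Hz.
    assert (L1 := Rmin_l (Rmin d2 (R0 / (2 * K))) (R0 * d1)). assert (L2 := Rmin_r (Rmin d2 (R0 / (2 * K))) (R0 * d1)).
    assert (L3 := Rmin_l d2 (R0 / (2 * K))). assert (L4 := Rmin_r d2 (R0 / (2 * K))).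
    assert (Sz' : in_stolz x K z).
    { destruct Sz as [A B]. split; auto. eapply Rle_trans; [exact B|]. apply Rmult_le_compat_r; auto.
      unfold inD in A. lra. }
    destruct (pseudo_stolz x z K R0 Hx HR K1 Sz') as [Ue [Ez [E1 Se]]].
    { rewrite Cmod_minus_sym. lra. }
    set (e := ((z - RtoC (1 - R0) * x) / (RtoC R0 * x))%C) in *.
    assert (Pm : Cmod (RtoC R0 * x) = R0) by (rewrite Cmod_mult, Hx, Cmod_R, Rabs_right; lra).
    assert (Dn : Cmod (1 - e) < d1).
    { rewrite E1, Cmod_div, Pm by (apply Cmult_neq_0; auto). rewrite Cmod_minus_sym.
      apply Rmult_lt_reg_r with R0; [lra|]. unfold Rdiv. rewrite Rmult_assoc, Rinv_l by lra. lra. }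
    specialize (H1 e Ue Se Dn). cbv beta in H1. change (ctr e) with (RtoC (1 - R0) * x + RtoC R0 * x * e)%C in H1.
    rewrite <- Ez in H1.
    specialize (H2 z ltac:(lra)).
    assert (Uz : udisc z). { destruct Sz as [A _]. unfold inD in A. rewrite Cnorm_Cmod in A. exact A. }
    assert (Nz : z <> tau). { apply Hann. rewrite Ez. apply (Ain e Ue). }
    assert (Nc := cfac_neq_0 tau tau_le z Uz Nz).
    assert (Id : (G z * (x - z) = cfac tau z * (pgen G tau z * (1 - e) * (RtoC R0 * x)))%C).
    { rewrite E1. unfold pgen. field. repeat split; auto. }
    assert (Close : Cmod (G z * (x - z) - cfac tau x * l) < eps).
    { rewrite Id.
      replace (cfac tau z * (pgen G tau z * (1 - e) * (RtoC R0 * x)) - cfac tau x * l)%C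
        with (cfac tau z * ((pgen G tau z * (1 - e) - RtoC (2 * c)) * (RtoC R0 * x)) + (cfac tau z - cfac tau x) * l)%C
        by (unfold l; ring).
      eapply Rle_lt_trans; [apply Cmod_triangle|]. rewrite !Cmod_mult. rewrite <- (Cmod_mult (RtoC R0) x), Pm.
      assert (B1 := cfac_bound tau tau_le z Uz).
      assert (M1 : Cmod (cfac tau z) * (Cmod (pgen G tau z * (1 - e) - RtoC (2 * c)) * R0) <= 4 * (eps / 16 * 1)).
      { apply Rmult_le_compat; try apply Cmod_ge_0; auto.
        - apply Rmult_le_pos; [apply Cmod_ge_0|lra].
        - apply Rmult_le_compat; try apply Cmod_ge_0; lra. }
      assert (M2 : Cmod (cfac tau z - cfac tau x) * Cmod l <= eps / (4 * (Cmod l + 1)) * (Cmod l + 1)).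
      { apply Rmult_le_compat; try apply Cmod_ge_0; lra. }
      replace (eps / (4 * (Cmod l + 1)) * (Cmod l + 1)) with (eps / 4) in M2 by (field; lra). lra. }
    assert (T1 := Cmod_triangle_inv (G z * (x - z)) (cfac tau x * l)).
    assert (T2 := Cmod_triangle_inv (cfac tau x * l) (G z * (x - z))).
    rewrite (Cmod_minus_sym (cfac tau x * l) (G z * (x - z))) in T2. fold L in T1, T2.
    apply Rabs_def1; lra.
Qed.

Variables (h : C -> C) (sh : R -> C -> C) (X : C -> C).
Hypothesis M : linear_model phi tau h sh X.
Variables (x w0 : C) (e0 : R) (om : R -> R) (B : R).
Hypothesis x1 : Cmod x = 1.
Hypothesis radial_limit : forall eps, 0 < eps -> near_one (fun s => Cmod (h (RtoC s * x)%C - w0) < eps).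
Hypothesis v_neq : X w0 <> 0%C.
Hypothesis e0_pos : 0 < e0.
Hypothesis om_pos : forall t, 0 <= t -> 0 <= om t.
Hypothesis om_mono : forall t t', 0 <= t <= t' -> om t <= om t'.
Hypothesis om_0 : forall e, 0 < e -> exists d, 0 < d /\ forall t, 0 < t < d -> om t < e.
Hypothesis om_int : forall d, 0 < d < e0 ->
  exists pr : Riemann_integrable (fun t => om t / t) d e0, RiemannInt pr <= B.
Hypothesis sector : forall rho b, 0 < rho < e0 -> Rabs b < PI - om rho ->
  exists z, udisc z /\ h z = (w0 + RtoC rho * ((X w0 / RtoC (Cmod (X w0))) * cunit b))%C.

Lemma generator_angular_limit_pos : exists L, 0 < L /\ forall K eps, 0 < eps -> exists d, 0 < d /\
  forall z, in_stolz x K z -> Cmod (z - x) < d -> Rabs (Cmod (G z * (x - z)) - L) < eps.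
Proof.
  destruct (forward_in_range phi tau h sh X M w0 e0 om v_neq e0_pos om_0 sector) as [t1 [Ht1 Hfw]].
  assert (Nx : x <> tau).
  { exact (x_neq_tau phi tau phi_holo phi_disc phi_add phi_0 tau_le dw h sh X M x w0 x1 radial_limit t1 Ht1 Hfw). }
  destruct (generator_angular_limit x x1 Nx) as [L [[HL|HL] Hlim]]; [eauto|exfalso].
  destruct annulus_radius as [R0 [HR Hann]].
  destruct (Vfun_lower_bound phi G tau phi_holo phi_disc phi_add phi_0 G_holo gen_0 gen_t tau_le dw h sh X M
     x w0 x1 radial_limit t1 Ht1 Hfw R0 HR Hann) as [ka [Hka Vlow]].
  destruct (near_x_primitive phi G tau G_holo gen_0 h sh X M x x1 R0 HR Hann) as [W HW].
  assert (Est := orb_estimates phi G tau phi_disc phi_0 gen_0 gen_t tau_le h sh X M x w0 x1 radial_limit t1 Hfw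
     R0 HR Hann W ka HW Hka Vlow).
  assert (T2 := t2_pos t1 Ht1 R0 HR ka Hka). set (tt := t2 t1 R0 ka) in *.
  assert (T21 : tt <= t1) by apply Rmin_l.
  destruct (orb_lower phi G tau gen_0 h sh X M w0 e0 om B v_neq e0_pos om_pos om_mono om_0 om_int sector t1 Ht1 Hfw)
    as [c [t3 [Hc [Ht3 Low]]]].
  set (Z := orb h sh w0) in *.
  assert (UZ : forall t, 0 < t < t1 -> udisc (Z t)) by (intros t Ht; apply (finv_spec h _ (Hfw t Ht))).
  set (C1 := 32 / ka). set (C3 := 192 / ka).
  assert (PC1 : 0 < C1) by (apply Rdiv_lt_0_compat; lra). assert (PC3 : 0 < C3) by (apply Rdiv_lt_0_compat; lra).
  (* From d D <= C1 t and c t <= D^2 follows d <= (C1 / c) D <= (2 C1 / c) (1 - |z|), the Stolz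
     condition. *)
  set (K := 2 * C1 / c + 1).
  assert (PK : 0 < 2 * C1 / c) by (apply Rdiv_lt_0_compat; lra).
  assert (Geo : forall t, 0 < t < Rmin tt t3 ->
     in_stolz x K (Z t) /\ (1 - sqmod (Z t)) <= 2 * Cmod (Z t - x)).
  { intros t Ht. assert (L1 := Rmin_l tt t3). assert (L2 := Rmin_r tt t3).
    assert (U := UZ t ltac:(lra)). assert (U' := U). unfold udisc in U'. assert (Pz := Cmod_ge_0 (Z t)).
    destruct (Est t ltac:(lra)) as [_ E2]. specialize (Low t ltac:(lra)).
    fold Z in E2. fold C1 in E2. set (d := Cmod (Z t - x)) in *.
    assert (Pd : 0 <= d) by apply Cmod_ge_0.
    set (D := 1 - sqmod (Z t)) in *.
    assert (PD : 0 < D) by (apply udisc_sqmod in U; unfold D; lra).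
    assert (D2 : D <= 2 * (1 - Cmod (Z t))) by (unfold D; rewrite sqmod_Cmod; nra).
    assert (T := Cmod_triangle_inv x (Z t)). rewrite x1, Cmod_minus_sym in T. fold d in T.
    split; [|lra]. split; [unfold inD; rewrite Cnorm_Cmod; auto|].
    rewrite !Cnorm_Cmod, Csub_Cminus, Cmod_minus_sym. fold d.
    assert (dD : d <= C1 / c * D).
    { apply Rmult_le_reg_r with (c * D); [nra|].
      replace (C1 / c * D * (c * D)) with (C1 * (D * D)) by (field; lra).
      assert (C1 * (c * t) <= C1 * (D * D)) by (apply Rmult_le_compat_l; lra). nra. }
    assert (Pcc : 0 < C1 / c) by (apply Rdiv_lt_0_compat; lra).
    assert (C1 / c * D <= C1 / c * (2 * (1 - Cmod (Z t)))) by (apply Rmult_le_compat_l; lra).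
    unfold K. replace (2 * C1 / c) with (2 * (C1 / c)) by (field; lra). nra. }
  set (sc := sqrt c). assert (Psc : 0 < sc) by (apply sqrt_lt_R0; auto).
  assert (Esc : sc * sc = c) by (apply sqrt_sqrt; lra).
  (* Since |Z t - x| >= D / 2 >= sc sqrt t / 2, the tolerance c / 16 with L = 0 bounds the speed by
     sc / (8 sqrt t). *)
  destruct (Hlim K (c / 16) ltac:(lra)) as [d0 [Hd0 Hl]].
  set (t4 := Rmin (Rmin tt t3) (d0 * d0 * d0 / (2 * C3))).
  assert (P5 : 0 < d0 * d0 * d0) by (repeat apply Rmult_lt_0_compat; auto).
  assert (P4 : 0 < t4).
  { unfold t4. apply Rmin_glb_lt; [apply Rmin_glb_lt; lra|]. apply Rdiv_lt_0_compat; lra. }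
  assert (l1 : t4 <= Rmin tt t3) by apply Rmin_l. assert (l2 : t4 <= d0 * d0 * d0 / (2 * C3)) by apply Rmin_r.
  assert (L1 := Rmin_l tt t3). assert (L2 := Rmin_r tt t3).
  assert (Near : forall t, 0 < t < t4 -> Cmod (Z t - x) < d0).
  { intros t Ht. destruct (Est t ltac:(lra)) as [E1 _]. fold Z C3 in E1.
    set (d := Cmod (Z t - x)) in *. apply Rnot_le_lt. intros N.
    assert (d0 * d0 * d0 <= d * d * d) by (apply Rmult_le_compat; try lra; [nra|apply Rmult_le_compat; lra]).
    assert (C3 * t < d0 * d0 * d0); [|lra].
    apply Rlt_le_trans with (C3 * (d0 * d0 * d0 / (2 * C3))); [apply Rmult_lt_compat_l; lra|].
    replace (C3 * (d0 * d0 * d0 / (2 * C3))) with (d0 * d0 * d0 / 2) by (field; lra). lra. }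
  assert (Sq : forall t, 0 < t < t4 -> sc * sqrt t <= 1 - sqmod (Z t)).
  { intros t Ht. specialize (Low t ltac:(lra)). assert (U := UZ t ltac:(lra)). apply udisc_sqmod in U.
    apply Rsqr_incr_0_var; [|lra]. unfold Rsqr.
    replace (sc * sqrt t * (sc * sqrt t)) with (sc * sc * (sqrt t * sqrt t)) by ring.
    rewrite Esc, sqrt_sqrt by lra. exact Low. }
  assert (Speed : forall t, 0 < t < t4 -> Cmod (G (Z t)) <= sc / (8 * sqrt t)).
  { intros t Ht. destruct (Geo t ltac:(lra)) as [St D2]. specialize (Hl (Z t) St (Near t Ht)).
    rewrite <- HL, Rminus_0_r, Cmod_mult in Hl. rewrite Rabs_right in Hl.
    2:{ apply Rle_ge, Rmult_le_pos; apply Cmod_ge_0. }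
    rewrite (Cmod_minus_sym x) in Hl. specialize (Sq t Ht).
    assert (Ps : 0 < sqrt t) by (apply sqrt_lt_R0; lra).
    set (g := Cmod (G (Z t))) in *. assert (Pg : 0 <= g) by apply Cmod_ge_0.
    assert (g * (sc * sqrt t / 2) <= c / 16).
    { apply Rle_trans with (g * Cmod (Z t - x)); [apply Rmult_le_compat_l; lra|lra]. }
    apply Rmult_le_reg_r with (sc * sqrt t / 2); [nra|].
    eapply Rle_trans; [exact H|]. right. rewrite <- Esc. field. lra. }
  set (t := t4 / 2). assert (Ht : 0 < t < t4) by (unfold t; lra).
  assert (Inc : forall a, 0 < a <= t -> Cmod (Z t - Z a) <= sc / 4 * sqrt t).
  { intros a Ha.
    apply Rle_trans with (sc / 4 * sqrt t - sc / 4 * sqrt a).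
    - apply (curve_increment_le Z (fun s => G (Z s)) (fun s => sc / 4 * sqrt s) (fun s => sc / (8 * sqrt s)) a t (proj2 Ha)).
      + intros s Hs. apply (orb_deriv phi G tau gen_0 h sh X M w0 t1 Hfw). lra.
      + intros s Hs. assert (Ps : 0 < sqrt s) by (apply sqrt_lt_R0; lra). auto_derive; [lra|]. unfold Rdiv. field. lra.
      + intros s Hs. apply Speed. lra.
    - assert (P := sqrt_pos a). nra. }
  assert (Ps : 0 < sqrt t) by (apply sqrt_lt_R0; lra).
  destruct (Geo t ltac:(lra)) as [_ D2]. specialize (Sq t Ht).
  assert (Dx : sc * sqrt t / 2 <= Cmod (Z t - x)) by lra.
  (* From within sc sqrt t / 8 of x, a journey of length sc sqrt t / 4 cannot reach the distance sc
     sqrt t / 2 that [Dx] demands. The cubic estimate supplies such a start [Z a]. *)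
  set (del := sc * sqrt t / 8). assert (Pdel : 0 < del) by (unfold del; nra).
  set (a := Rmin t (del * del * del / (2 * C3))).
  assert (P6 : 0 < del * del * del) by (apply Rmult_lt_0_compat; [apply Rmult_lt_0_compat|]; exact Pdel).
  assert (a1 : a <= t) by apply Rmin_l. assert (a2 : a <= del * del * del / (2 * C3)) by apply Rmin_r.
  assert (a0 : 0 < a) by (apply Rmin_glb_lt; [lra|apply Rdiv_lt_0_compat; lra]).
  destruct (Est a ltac:(lra)) as [E1 _]. fold Z C3 in E1.
  assert (Da : Cmod (Z a - x) < del).
  { set (d := Cmod (Z a - x)) in *. apply Rnot_le_lt. intros N.
    assert (del * del * del <= d * d * d) by (apply Rmult_le_compat; try lra; [nra|apply Rmult_le_compat; lra]).
    assert (C3 * a <= C3 * (del * del * del / (2 * C3))) by (apply Rmult_le_compat_l; lra).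
    replace (C3 * (del * del * del / (2 * C3))) with (del * del * del / 2) in H0 by (field; lra). lra. }
  specialize (Inc a ltac:(lra)).
  assert (Tr := Cmod_minus_triangle (Z t) (Z a) x). unfold del in Da. nra.
Qed.

Lemma regular_pole_of_corner : regular_pole G x.
Proof.
  destruct generator_angular_limit_pos as [L [HL Hlim]].
  assert (Conv : forall zs, nontangential_seq x zs -> forall eps, 0 < eps -> exists N, forall n, (N <= n)%nat ->
     Rabs (Cnorm (Cmul (G (zs n)) (Csub x (zs n))) - L) < eps).
  { intros zs [[K HK] Hcv] eps He. destruct (Hlim K eps He) as [d [Hd H]].
    destruct (Hcv d Hd) as [N HN]. exists N. intros n Hn.
    rewrite Cnorm_Cmod. apply H; auto. specialize (HN n Hn). rewrite Cnorm_Cmod in HN. exact HN. }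
  exists L. split; auto. split.
  - intros zs Hzs b Hb. destruct (Conv zs Hzs (L - b) ltac:(lra)) as [N HN]. exists N. intros n Hn.
    specialize (HN n Hn). apply Rabs_def2 in HN. lra.
  (* A radial sequence shows that the infimum over nontangential sequences is not larger than L. *)
  - intros L' HL'. set (s := fun n : nat => 1 - / (INR n + 1)).
    assert (Pn : forall n, 0 < INR n + 1) by (intros n; assert (Y := pos_INR n); lra).
    assert (Sn : forall n, 0 <= s n < 1).
    { intros n. unfold s. assert (0 < / (INR n + 1)) by (apply Rinv_0_lt_compat; auto).
      assert (/ (INR n + 1) <= / 1); [|lra]. apply Rinv_le_contravar; [lra|]. assert (Y := pos_INR n). lra. }
    assert (Mz : forall n, Cmod (RtoC (s n) * x) = s n).
    { intros n. specialize (Sn n). rewrite Cmod_mult, x1, Cmod_R, Rabs_right; lra. }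
    assert (Mx : forall n, Cmod (x - RtoC (s n) * x) = 1 - s n).
    { intros n. specialize (Sn n). replace (x - RtoC (s n) * x)%C with (RtoC (1 - s n) * x)%C by (rewrite RtoC_minus; ring).
      rewrite Cmod_mult, x1, Cmod_R, Rabs_right; lra. }
    assert (NT : nontangential_seq x (fun n => (RtoC (s n) * x)%C)).
    { split.
      - exists 1. intros n. specialize (Sn n). split.
        + unfold inD. rewrite Cnorm_Cmod, Mz. lra.
        + rewrite !Cnorm_Cmod, Csub_Cminus, Mx, Mz. lra.
      - intros eps He. destruct (INR_unbounded (/ eps)) as [N HN]. exists N. intros n Hn.
        rewrite Cnorm_Cmod, Csub_Cminus, Cmod_minus_sym, Mx. unfold s.
        assert (INR N <= INR n) by (apply le_INR; auto).
        replace (1 - (1 - / (INR n + 1))) with (/ (INR n + 1)) by ring.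
        rewrite <- (Rinv_inv eps). apply Rinv_lt_contravar; [|lra].
        apply Rmult_lt_0_compat; auto. apply Rinv_0_lt_compat; auto. }
    exists (fun n => (RtoC (s n) * x)%C). split; auto. intros Hge.
    destruct (Hge ((L + L') / 2) ltac:(lra)) as [N1 H1].
    destruct (Conv _ NT ((L' - L) / 2) ltac:(lra)) as [N2 H2].
    specialize (H1 (max N1 N2) ltac:(lia)). specialize (H2 (max N1 N2) ltac:(lia)).
    apply Rabs_def2 in H2. cbv beta in H1, H2. lra.
Qed.

End final.

(** * Passage from the stated notions to those of the proof *)

Lemma Cinv_Cinv (z : C) : Defs.Cinv z = (/ z)%C.
Proof. unfold Defs.Cinv, Cinv. Cext; f_equal; ring. Qed.

Lemma C_deriv_cderiv (f : C -> C) (z l : C) : C_deriv f z l -> cderiv f z l.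
Proof.
  intros H eps He. destruct (H eps He) as [d [Hd Hw]]. exists d; split; auto. intros w Hwd.
  destruct (classic (w = z)) as [->|N].
  - replace (f z - f z - l * (z - z))%C with (RtoC 0) by ring. rewrite Cmod_0.
    apply Rmult_le_pos; [lra|apply Cmod_ge_0].
  - specialize (Hw w N). rewrite !Cnorm_Cmod in Hw. specialize (Hw Hwd).
    assert (Nw : (w - z <> 0)%C). { intros E. apply N. rewrite <- (Cplus_0_l z), <- E. ring. }
    unfold Defs.Cdiv in Hw. rewrite Cinv_Cinv in Hw.
    change (Cmod ((f w - f z) * / (w - z) - l) < eps) in Hw.
    replace (f w - f z - l * (w - z))%C with (((f w - f z) * / (w - z) - l) * (w - z))%C by (field; auto).
    rewrite Cmod_mult. apply Rmult_le_compat_r; [apply Cmod_ge_0|lra].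
Qed.

Lemma inD_udisc (z : C) : inD z <-> udisc z.
Proof. unfold inD, udisc. rewrite Cnorm_Cmod. tauto. Qed.

Lemma holo_on_D_udisc (f : C -> C) : holo_on_D f -> holo udisc f.
Proof.
  intros H z Hz. destruct (H z (proj2 (inD_udisc z) Hz)) as [l Hl]. exists l. apply C_deriv_cderiv; auto.
Qed.

Lemma angular_radial (h : C -> C) (x w0 : C) : Cmod x = 1 -> angular_limit h x w0 ->
  forall eps, 0 < eps -> near_one (fun s => Cmod (h (RtoC s * x)%C - w0) < eps).
Proof.
  intros Hx H eps He. destruct (H 2 eps ltac:(lra) He) as [d [Hd Hz]].
  exists (Rmax 0 (1 - d)). split; [apply Rmax_lub_lt; lra|]. intros s Hs.
  assert (L1 := Rmax_l 0 (1 - d)). assert (L2 := Rmax_r 0 (1 - d)).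
  assert (M1 : Cmod (RtoC s * x) = s) by (rewrite Cmod_mult, Hx, Cmod_R, Rabs_right; lra).
  assert (M2 : Cmod (x - RtoC s * x) = 1 - s).
  { replace (x - RtoC s * x)%C with (RtoC (1 - s) * x)%C by (rewrite RtoC_minus; ring).
    rewrite Cmod_mult, Hx, Cmod_R, Rabs_right; lra. }
  specialize (Hz (RtoC s * x)%C). rewrite !Cnorm_Cmod in Hz. apply Hz.
  - split; [apply inD_udisc; unfold udisc; lra|]. rewrite !Cnorm_Cmod, Csub_Cminus, M1, M2. lra.
  - rewrite Csub_Cminus, Cmod_minus_sym, M2. lra.
Qed.

Lemma generator_0 (phi : R -> C -> C) (G : C -> C) : is_generator phi G -> (forall z, inD z -> phi 0 z = z) ->
  forall z eps, udisc z -> 0 < eps -> exists d, 0 < d /\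
    forall s, 0 < s < d -> Cmod (phi s z - z - RtoC s * G z) <= eps * s.
Proof.
  intros [_ H] H0 z eps Hz He. apply inD_udisc in Hz.
  destruct (H z 0 Hz (Rle_refl 0) eps He) as [d [Hd Hs]]. exists d; split; auto. intros s Hsd.
  specialize (Hs s ltac:(lra) ltac:(lra) ltac:(rewrite Rminus_0_r, Rabs_right; lra)).
  rewrite H0, Rminus_0_r, Cnorm_Cmod, Cscale_Cmult, !Csub_Cminus in Hs by auto.
  assert (sn : RtoC s <> 0%C) by (intros E; injection E; lra).
  replace (phi s z - z - RtoC s * G z)%C with (RtoC s * (RtoC (/ s) * (phi s z - z) - G z))%C.
  - rewrite Cmod_mult, Cmod_R, Rabs_right by lra. rewrite Rmult_comm. apply Rmult_le_compat_r; [lra|left; exact Hs].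
  - rewrite RtoC_inv by lra. field. auto.
Qed.

Lemma generator_t (phi : R -> C -> C) (G : C -> C) : is_generator phi G ->
  forall z t, udisc z -> 0 < t -> curve_deriv (fun s => phi s z) t (G (phi t z)).
Proof.
  intros [_ H] z t Hz Ht. apply inD_udisc in Hz. apply curve_deriv_eps. intros eps He.
  destruct (H z t Hz ltac:(lra) eps He) as [d [Hd Hs]]. exists (Rmin d t); split; [apply Rmin_glb_lt; auto|].
  intros s Hsd. assert (L1 := Rmin_l d t). assert (L2 := Rmin_r d t).
  destruct (Req_dec s t) as [->|N].
  { replace (phi t z - phi t z - G (phi t z) * RtoC (t - t))%C with (RtoC 0) by (rewrite RtoC_minus; ring).
    rewrite Cmod_0. apply Rmult_le_pos; [lra|apply Rabs_pos]. }
  assert (s0 : 0 <= s). { assert (X := Hsd). apply Rabs_def2 in X. lra. }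
  specialize (Hs s s0 N ltac:(lra)).
  rewrite Cnorm_Cmod, Cscale_Cmult, !Csub_Cminus in Hs.
  assert (sn : RtoC (s - t) <> 0%C) by (intros E; injection E; lra).
  replace (phi s z - phi t z - G (phi t z) * RtoC (s - t))%C
    with (RtoC (s - t) * (RtoC (/ (s - t)) * (phi s z - phi t z) - G (phi t z)))%C.
  - rewrite Cmod_mult, Cmod_R, Rmult_comm. apply Rmult_le_compat_r; [apply Rabs_pos|left; exact Hs].
  - rewrite RtoC_inv by lra. field. auto.
Qed.

Lemma RtoC_1_neq_0 : RtoC 1 <> 0%C.
Proof. intros E; injection E; lra. Qed.

(** The last clause will be applied to w0: in the interior case X vanishes only at 0 = h tau, which
    lies in the range of h, and in the boundary case X is 1. *)
Lemma koenigs_linear_model (phi : R -> C -> C) (G : C -> C) (tau : C) (h : C -> C) :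
  denjoy_wolff phi tau -> koenigs_function phi G tau h ->
  (forall t z, 0 <= t -> udisc z -> udisc (phi t z)) ->
  exists sh X, linear_model phi tau h sh X /\
    forall w, ~ (exists z, udisc z /\ h z = w) -> X w <> 0%C.
Proof.
  intros [Htau Hdw] [[Hh Hinj] [Hint Hbd]] Hdisc. rewrite Cnorm_Cmod in Htau.
  assert (Hinj' : forall z w, udisc z -> udisc w -> h z = h w -> z = w).
  { intros z w Hz Hw. apply Hinj; apply inD_udisc; auto. }
  apply holo_on_D_udisc in Hh.
  destruct Htau as [Lt|Eq].
  - assert (Ut : udisc tau) by exact Lt.
    destruct (Hint (proj2 (inD_udisc tau) Ut)) as [H0 [H1 [lam [_ Hcj]]]].
    apply C_deriv_cderiv in H1.
    assert (Hcj' : forall t z, 0 <= t -> udisc z -> h (phi t z) = (cexp (RtoC t * lam) * h z)%C).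
    { intros t z Ht Hz. rewrite Hcj by (auto; apply inD_udisc; auto). rewrite Cscale_Cmult. reflexivity. }
    (* If lam = 0, h is constant along orbits; these converge to tau, so h z = h tau, against
       injectivity. *)
    assert (lam0 : forall z, udisc z -> z <> tau -> lam <> RtoC 0).
    { intros z Hz N E. apply N. apply Hinj'; auto. rewrite H0.
      apply NNPP. intros Nz. assert (P : 0 < Cmod (h z)) by (apply Cmod_gt_0; auto).
      destruct (cderiv_ccont _ _ _ H1 _ P) as [d [Hd Hc]].
      destruct (Hdw z (proj2 (inD_udisc z) Hz) d Hd) as [T HT].
      specialize (HT (Rmax 0 T) (Rmax_r 0 T)). rewrite Cnorm_Cmod in HT.
      specialize (Hc _ HT). rewrite Hcj', H0, E in Hc by (auto; apply Rmax_l).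
      replace (RtoC (Rmax 0 T) * 0)%C with (RtoC 0) in Hc by ring.
      replace (cexp (RtoC 0)) with (RtoC 1) in Hc.
      - replace (1 * h z - C0)%C with (h z) in Hc by (unfold C0; Cext; ring). lra.
      - unfold cexp, Cexp, Cscale. Cext; rewrite exp_0, ?cos_0, ?sin_0; ring. }
    assert (Lam : lam <> RtoC 0).
    (* Only a point of the disc other than tau is wanted. *)
    { destruct (classic (tau = 0%C)) as [E|N].
      - apply (lam0 (RtoC (1/2))).
        + unfold udisc. rewrite Cmod_R, Rabs_right; lra.
        + rewrite E. intros F. injection F. lra.
      - apply (lam0 0%C); auto. unfold udisc. rewrite Cmod_0; lra. }
    exists (fun t w => cexp (RtoC t * lam) * w)%C, (fun w => lam * w)%C. split.
    + constructor; auto.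
      * intros t w. eapply curve_deriv_eq.
        -- apply (curve_deriv_comp (fun z => cexp z * w)%C (fun s => RtoC s * lam)%C t lam).
           ++ split; simpl; auto_derive; auto; ring.
           ++ eapply cderiv_eq; [apply (cderiv_mult cexp (fun _ => w)); [apply cderiv_cexp|apply cderiv_const]|reflexivity].
        -- cbv beta. ring.
      * intros w. replace (RtoC 0 * lam)%C with (RtoC 0) by ring.
        replace (cexp (RtoC 0)) with (RtoC 1); [ring|].
        unfold cexp, Cexp, Cscale. Cext; rewrite exp_0, ?cos_0, ?sin_0; ring.
      * intros s t w. rewrite RtoC_plus, Cmult_plus_distr_r, cexp_plus. ring.
      * intros t w. eapply cderiv_ccont. apply cderiv_scal. apply cderiv_id.
      * exists (Cmod lam + 1). assert (P := Cmod_ge_0 lam). split; [lra|]. intros a b.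
        replace (lam * a - lam * b)%C with (lam * (a - b))%C by ring. rewrite Cmod_mult.
        apply Rmult_le_compat_r; [apply Cmod_ge_0|lra].
      * intros z Hz N. apply Cmult_neq_0; auto. intros E. apply N. apply Hinj'; auto. rewrite H0. exact E.
      * intros l _ Hl. rewrite (cderiv_unique _ _ _ _ Hl H1). exact RtoC_1_neq_0.
    + intros w Hw. apply Cmult_neq_0; auto. intros E. apply Hw. exists tau. split; auto. rewrite H0, E. reflexivity.
  - assert (Nt : ~ udisc tau) by (unfold udisc; lra).
    destruct (Hbd ltac:(rewrite Cnorm_Cmod; auto)) as [_ Hcj].
    exists (fun t w => w + RtoC t)%C, (fun _ => RtoC 1). split.
    + constructor; auto.
      * intros t z Ht Hz. rewrite Hcj; [reflexivity|auto|apply inD_udisc; auto].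
      * intros t w. split; simpl; auto_derive; auto; ring.
      * intros w. ring.
      * intros s t w. rewrite RtoC_plus. ring.
      * intros t w. eapply cderiv_ccont. apply cderiv_plus; [apply cderiv_id|apply cderiv_const].
      * exists 1. split; [lra|]. intros a b. replace (1 - 1)%C with (RtoC 0) by ring. rewrite Cmod_0.
        assert (P := Cmod_ge_0 (a - b)). lra.
      * intros; exact RtoC_1_neq_0.
    + intros; exact RtoC_1_neq_0.
Qed.

Theorem theorem6p5 (phi : R -> Cx -> Cx) (G : Cx -> Cx) (tau : Cx) (h : Cx -> Cx)
  (x : Cx) (gamma : R -> Cx) (Omega0 : Cx -> Prop) (w0 : Cx) (r : R) :
  one_param_semigroup phi ->
  is_generator phi G ->
  denjoy_wolff phi tau ->
  koenigs_function phi G tau h ->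
  Cnorm x = 1 ->
  angular_limit h x w0 ->
  jordan_domain gamma Omega0 ->
  (forall w, Omega0 w -> exists z, inD z /\ h z = w) ->
  trace gamma w0 ->
  0 < r < 1 ->
  (forall s, r <= s < 1 -> Omega0 (h (Cscale s x))) ->
  dini_smooth_corner gamma Omega0 w0 (2 * PI) ->
  regular_pole G x.
Proof.
  intros [Hself [Hid [Hadd _]]] Hgen Hdw Hk Hx Hang _ Hsub _ _ _ Hcorner.
  rewrite Cnorm_Cmod in Hx.
  assert (Hdisc : forall t z, 0 <= t -> udisc z -> udisc (phi t z)).
  { intros t z Ht Hz. apply inD_udisc, (Hself t Ht), inD_udisc, Hz. }
  assert (Hholo : forall t, 0 <= t -> holo udisc (phi t)) by (intros t Ht; apply holo_on_D_udisc, Hself, Ht).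
  assert (Hid' : forall z, udisc z -> phi 0 z = z) by (intros z Hz; apply Hid, inD_udisc, Hz).
  assert (Hadd' : forall s t z, 0 <= s -> 0 <= t -> udisc z -> phi (s + t) z = phi s (phi t z)).
  { intros s t z Hs Ht Hz. apply Hadd; auto. apply inD_udisc, Hz. }
  assert (HG : holo udisc G) by (apply holo_on_D_udisc, Hgen).
  destruct (koenigs_linear_model phi G tau h Hdw Hk Hdisc) as [sh [X [M HX]]].
  assert (Hrad := angular_radial h x w0 Hx Hang).
  assert (Hw0 := radial_limit_not_in_range h (model_holo M) (model_inj M) x w0 Hx Hrad).
  assert (Hv := HX w0 Hw0).
  (* The backward flow line of w0 will serve as the curve outside Omega0 that orients the corner. *)
  assert (Hp : curve_deriv (fun t => sh (- t) w0) 0 (- X w0)%C).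
  { apply curve_deriv_eps. intros eps He.
    assert (Fl := model_flow M 0 w0). rewrite (model_0 M) in Fl.
    destruct (proj1 (curve_deriv_eps _ _ _) Fl eps He) as [d [Hd H]].
    exists d; split; auto. intros s Hs. rewrite Rminus_0_r in Hs. specialize (H (- s)).
    rewrite !Rminus_0_r in *. rewrite Rabs_Ropp in H. rewrite Ropp_0. specialize (H Hs).
    replace (- X w0 * RtoC s)%C with (X w0 * RtoC (- s))%C by (rewrite RtoC_opp; ring). exact H. }
  destruct (corner_sector gamma Omega0 w0 (X w0) (fun t => sh (- t) w0) Hv Hp) as
    [e0 [om [He0 [om_pos [om_mono [om_0 [[B HB] Hsec]]]]]]]; auto.
  - rewrite Ropp_0. apply (model_0 M).
  - intros t Ht HO. destruct (Hsub _ HO) as [z [Hz Ez]].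
    apply (backward_not_in_range phi tau Hdisc h sh X M x w0 Hx Hrad t ltac:(lra)).
    exists z. split; auto. apply inD_udisc; auto.
  - apply (regular_pole_of_corner phi G tau Hholo Hdisc Hadd' Hid' HG (generator_0 phi G Hgen Hid)
      (generator_t phi G Hgen)) with (h := h) (sh := sh) (X := X) (w0 := w0) (e0 := e0) (om := om) (B := B); auto.
    + destruct Hdw as [L _]. rewrite Cnorm_Cmod in L. exact L.
    + intros z eps Hz He. destruct Hdw as [_ D]. destruct (D z (proj2 (inD_udisc z) Hz) eps He) as [T HT].
      exists T. intros t Ht. specialize (HT t Ht). rewrite Cnorm_Cmod in HT. exact HT.
    + intros rho b Hr Hb. destruct (Hsub _ (Hsec rho b Hr Hb)) as [z [Hz Ez]].
      exists z. split; auto. apply inD_udisc; auto.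
Qed.
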